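(* Let $N\ge3$ and let $\mu$ be a nonnegative finite Borel measure on $[0,1]$ (i.e. $\mu^-=0$) such that $\mu([\bar s,1])>0$ for some $\bar s\in(0,1]$. Let $\phi:\mathbb{R}\to[0,+\infty)$ be a $C^\infty$ and convex function such that $\phi(t)=0$ for all $t\le0$ and $|\phi'(t)|+|\phi''(t)|\le L$ for every $t\in\mathbb{R}$, for some $L\in[0,+\infty)$. Then, for all nonnegative functions $v\in H^\mu(\mathbb{R}^N)$, we have that $\phi(v)\in H^\mu(\mathbb{R}^N)$ and, for all nonnegative functions $\varphi\in H^\mu(\mathbb{R}^N)$, $$\int_{[0,1]}B_s\big(\phi(v),\varphi\big)\,d\mu(s)\le\int_{[0,1]}B_s\big(v,\phi'(v)\varphi\big)\,d\mu(s).$$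
   Context: For $s\in(0,1)$, $B_s(u,w)=C_{N,s}\iint_{\mathbb{R}^{2N}}\frac{(u(x)-u(y))(w(x)-w(y))}{|x-y|^{N+2s}}\,dx\,dy$ with $C_{N,s}=\frac{2^{2s-1}s\,\Gamma(\frac{N+2s}{2})}{\pi^{N/2}\Gamma(1-s)}$; for the endpoints, $B_0(u,w)=\int uw\,dx$ and $B_1(u,w)=\int\nabla u\cdot\nabla w\,dx$. $[u]_s^2=B_s(u,u)$. $H^\mu(\mathbb{R}^N)$ is the closure of $C_c^\infty(\mathbb{R}^N)$ in the norm $\|u\|_\mu=\big(\int_{[0,1]}[u]_s^2\,d\mu(s)+\|u\|_{L^2}^2\big)^{1/2}$. The right-hand side is understood with values in $(-\infty,+\infty]$: writing $\phi'(v(x))\varphi(x)-\phi'(v(y))\varphi(y)=\phi'(v(x))(\varphi(x)-\varphi(y))+(\phi'(v(x))-\phi'(v(y)))\varphi(y)$, the first term contributes an absolutely convergent integral and the second a nonnegative integrand (similarly, for $s=1$, $\nabla v\cdot\nabla(\phi'(v)\varphi)=\phi'(v)\nabla v\cdot\nabla\varphi+\phi''(v)|\nabla v|^2\varphi$). *)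

(* Defs.v *)
From HB Require Import structures.
From mathcomp Require Import all_boot all_order all_algebra.
From mathcomp Require Import all_classical all_reals all_analysis.
Set Implicit Arguments.
Unset Strict Implicit.
Unset Printing Implicit Defensive.
Import Order.TTheory GRing.Theory Num.Theory.
Import numFieldNormedType.Exports.
Local Open Scope classical_set_scope.
Local Open Scope ring_scope.

(* R^n is 'rV[R]_n.  Its sigma-algebra is generated by the coordinate maps,
   which for a real field is the Borel sigma-algebra.  Beware that the library
   norm `|x| on 'rV[R]_n is the sup norm; the Euclidean one is [enorm]. *)
Definition rV_display : measure_display.
Proof. exact: default_measure_display. Qed.

Section measurable_rV.
Context {R : realType}.
Variable n : nat.

Definition rV_coord (i : 'I_n) (x : 'rV[R]_n) : measurableTypeR R := x 0 i.

Let rV_set0 : g_sigma_preimage rV_coord set0.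
Proof. exact: sigma_algebra0. Qed.

Let rV_setC A : g_sigma_preimage rV_coord A -> g_sigma_preimage rV_coord (~` A).
Proof. exact: sigma_algebraC. Qed.

Let rV_bigcup (F : (set 'rV[R]_n)^nat) :
  (forall i, g_sigma_preimage rV_coord (F i)) ->
  g_sigma_preimage rV_coord (\bigcup_i (F i)).
Proof. exact: sigma_algebra_bigcup. Qed.

HB.instance Definition _ := @isMeasurable.Build
  rV_display 'rV[R]_n
  (g_sigma_preimage rV_coord) rV_set0 rV_setC rV_bigcup.

End measurable_rV.

Section measurable_rV_lemmas.
Context {R : realType}.

Lemma measurable_rV_coord n (i : 'I_n) :
  measurable_fun [set: 'rV[R]_n] (rV_coord i).
Proof.
move=> _ Y mY; rewrite setTI; apply: sub_sigma_algebra => /=.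
rewrite -bigcup_seq/=; exists i => /=; first by rewrite mem_index_enum.
by exists Y => //; rewrite setTI.
Qed.

Lemma measurable_rV_coordP d (T : measurableType d) n (f : T -> 'rV[R]_n) :
  (forall i, measurable_fun [set: T] (rV_coord i \o f)) ->
  measurable_fun [set: T] f.
Proof.
move=> mf _ A mA; rewrite setTI.
pose G := [set B : set 'rV[R]_n | measurable (f @^-1` B)].
have sG : sigma_algebra setT G.
  split => [|B GB|F GF]; rewrite /G/=.
  - by rewrite preimage_set0.
  - by rewrite setTD preimage_setC; exact: measurableC.
  - by rewrite preimage_bigcup; exact: bigcupT_measurable.
apply: (mA G); split => //.
move=> B; rewrite -bigcup_seq => -[i _ [C mC <-]].
by rewrite /G/= setTI -[X in measurable X]setTI; exact: mf.
Qed.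

End measurable_rV_lemmas.

Section lebesgue_rV.
Context {R : realType}.
Local Notation leb1 := (@lebesgue_measure R).

Definition rV_cons n (p : measurableTypeR R * 'rV[R]_n) : 'rV[R]_n.+1 :=
  row_mx (p.1 : R)%:M p.2.

Definition rV_uncons n (x : 'rV[R]_n.+1) : measurableTypeR R * 'rV[R]_n :=
  (x 0 ord0, \row_j x 0 (lift ord0 j)).

Lemma rV_cons0 n (p : measurableTypeR R * 'rV[R]_n) : rV_cons p 0 ord0 = p.1.
Proof.
rewrite /rV_cons mxE; case: splitP => [j _|j]; last by [].
by rewrite ord1 mxE eqxx.
Qed.

Lemma rV_consS n (p : measurableTypeR R * 'rV[R]_n) j :
  rV_cons p 0 (lift ord0 j) = p.2 0 j.
Proof.
rewrite /rV_cons mxE; case: splitP => [k|k /=]; first by rewrite ord1.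
by rewrite /bump/= => -[jk]; congr (p.2 0 _); apply/val_inj.
Qed.

Lemma rV_consK n : cancel (@rV_cons n) (@rV_uncons n).
Proof.
move=> [a x]; rewrite /rV_uncons rV_cons0; congr pair.
by apply/rowP => j; rewrite mxE rV_consS.
Qed.

Lemma measurable_rV_cons n : measurable_fun setT (@rV_cons n).
Proof.
apply: measurable_rV_coordP => i.
have [j ->|->] := unliftP ord0 i.
  rewrite (_ : _ \o _ = rV_coord j \o snd); last first.
    by apply/funext => p /=; rewrite /rV_coord rV_consS.
  by apply: measurableT_comp => //; exact: measurable_rV_coord.
rewrite (_ : _ \o _ = fst) //; apply/funext => p /=.
by rewrite /rV_coord rV_cons0.
Qed.

Lemma measurable_rV_uncons n : measurable_fun setT (@rV_uncons n).
Proof.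
apply/measurable_fun_pairP; split; first exact: measurable_rV_coord.
apply: measurable_rV_coordP => j.
rewrite (_ : _ \o _ = rV_coord (lift ord0 j)) //; first exact: measurable_rV_coord.
by apply/funext => x /=; rewrite /rV_coord/= mxE.
Qed.

Section step.
Variables (n : nat) (nu : {sigma_finite_measure set 'rV[R]_n -> \bar R}).

Definition lebesgue_rV_succ : set 'rV[R]_n.+1 -> \bar R :=
  pushforward (leb1 \x nu)%E (@rV_cons n).

Let succ0 : lebesgue_rV_succ set0 = 0%E.
Proof. by rewrite /lebesgue_rV_succ /pushforward preimage_set0 measure0. Qed.

Let succ_ge0 A : (0 <= lebesgue_rV_succ A)%E.
Proof. by rewrite /lebesgue_rV_succ /pushforward measure_ge0. Qed.

Let succ_sigma_additive : semi_sigma_additive lebesgue_rV_succ.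
Proof.
have mc := @measurable_rV_cons n.
move=> F mF tF mUF; rewrite /lebesgue_rV_succ /pushforward preimage_bigcup.
apply: measure_semi_sigma_additive.
- by move=> k; rewrite -[X in measurable X]setTI; exact: mc.
- apply/trivIsetP => /= i j _ _ ij; rewrite -preimage_setI.
  by move/trivIsetP : tF => /(_ _ _ _ _ ij) ->//; rewrite preimage_set0.
- by rewrite -preimage_bigcup -[X in measurable X]setTI; exact: mc.
Qed.

HB.instance Definition _ := isMeasure.Build _ _ _ lebesgue_rV_succ
  succ0 succ_ge0 succ_sigma_additive.

Let succ_sigma_finite : sigma_finite setT lebesgue_rV_succ.
Proof.
have /sigma_finiteP[F [FT ndF Foo]] := sigma_finiteT leb1.
have /sigma_finiteP[G [GT ndG Goo]] := sigma_finiteT nu.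
exists (fun k => @rV_uncons n @^-1` (F k `*` G k)).
  apply/esym; rewrite -subTset => x _.
  have [i _ Fi] : (\bigcup_k F k) (x 0 ord0) by rewrite -FT.
  have [j _ Gj] : (\bigcup_k G k) (rV_uncons x).2 by rewrite -GT.
  exists (maxn i j) => //; split => /=.
  - by move: Fi; exact/subsetPset/ndF/leq_maxl.
  - by move: Gj; exact/subsetPset/ndG/leq_maxr.
move=> k; have [mF Fk] := Foo k; have [mG Gk] := Goo k.
have mFG : measurable (F k `*` G k) by exact: measurableX.
split; first by rewrite -[X in measurable X]setTI; exact: measurable_rV_uncons.
rewrite /lebesgue_rV_succ /pushforward -comp_preimage.
rewrite (_ : _ \o _ = id); last by apply/funext => p; exact: rV_consK.
by rewrite preimage_id product_measure1E// lte_mul_pinfty// ge0_fin_numE.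
Qed.

HB.instance Definition _ := Measure_isSigmaFinite.Build _ _ _
  lebesgue_rV_succ succ_sigma_finite.

End step.

Definition lebesgue_rV0 : {sigma_finite_measure set 'rV[R]_0 -> \bar R} :=
  \d_(0 : 'rV[R]_0).

Fixpoint lebesgue_rV n : {sigma_finite_measure set 'rV[R]_n -> \bar R} :=
  match n with
  | 0 => lebesgue_rV0
  | m.+1 => lebesgue_rV_succ (lebesgue_rV m)
  end.

Lemma lebesgue_rV_box n (A : 'I_n -> set (measurableTypeR R)) :
  (forall i, measurable (A i)) ->
  lebesgue_rV n [set x | forall i, A i (x 0 i)] = (\prod_(i < n) leb1 (A i))%E.
Proof.
elim: n => [|n IH] in A * => mA.
  by rewrite big_ord0 /= diracE mem_set// => -[].
rewrite big_ord_recl /= /lebesgue_rV_succ /pushforward -IH//.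
rewrite -product_measure1E//; last first.
  rewrite [X in measurable X](_ : _ =
      \bigcap_(i in [set: 'I_n]) (rV_coord i @^-1` A (lift ord0 i))); last first.
    by apply/seteqP; split => x /= Ax i; [move=> _|]; exact: Ax.
  apply: fin_bigcap_measurable => // i _.
  by rewrite -[X in measurable X]setTI; exact: measurable_rV_coord.
congr ((_ \x _)%E _); apply/seteqP; split => p /=.
  move=> Ap; split; first by have := Ap ord0; rewrite rV_cons0.
  by move=> i; have := Ap (lift ord0 i); rewrite rV_consS.
move=> [A0 AS] i; have [j ->|->] := unliftP ord0 i; first by rewrite rV_consS.
by rewrite rV_cons0.
Qed.

End lebesgue_rV.

Section test_functions.
Context {R : realType} {N : nat}.
Implicit Types (f : 'rV[R]_N -> R) (i : 'I_N).

Definition enorm (x : 'rV[R]_N) : R := Num.sqrt (\sum_i x 0 i ^+ 2).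

Definition partial i f : 'rV[R]_N -> R := fun x => 'D_(delta_mx 0 i) f x.

(* C^oo: every iterated partial derivative is Frechet differentiable. *)
Definition smooth f : Prop :=
  forall (l : seq 'I_N) x, differentiable (foldr partial f l) x.

Definition test_function f : Prop :=
  smooth f /\ compact (closure [set x | f x != 0]).

End test_functions.

Section weak_derivatives.
Context {R : realType} {N : nat}.
Implicit Types (u g : 'rV[R]_N -> R) (i : 'I_N).
Local Notation leb := (lebesgue_rV N).

Definition loc_integrable u : Prop :=
  forall K : set 'rV[R]_N, compact K -> leb.-integrable K (EFin \o u).

Definition is_weak_partial i u g : Prop :=
  [/\ loc_integrable u, loc_integrable g &
   forall psi, test_function psi ->
    \int[leb]_x (u x * partial i psi x) = - \int[leb]_x (g x * psi x)].

Definition weakly_differentiable u : Prop :=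
  forall i, exists g, is_weak_partial i u g.

(* A choice of the weak derivative, which is unique almost everywhere when it
   exists; the junk value is the zero function. *)
Definition weak_partial i u : 'rV[R]_N -> R :=
  xget (fun=> 0) [set g | is_weak_partial i u g].

End weak_derivatives.

Section energy.
Context {R : realType}.

Definition Gamma (z : R) : R :=
  \int[lebesgue_measure]_(t in `]0, +oo[) (t `^ (z - 1) * expR (- t)).

Definition C_frac (N : nat) (s : R) : R :=
  2 `^ (2 * s - 1) * s * Gamma ((N%:R + 2 * s) / 2)
  / (pi `^ (N%:R / 2) * Gamma (1 - s)).

Context {N : nat}.
Implicit Types (u w : 'rV[R]_N -> R) (s : R).
Local Notation leb := (lebesgue_rV N).
Local Open Scope ereal_scope.

(* B_s(u, w).  The library integral of an extended real function f is
   \int f^+ - \int f^-, so the values lie in ]-oo, +oo] as soon as the negative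
   part is integrable.  The case s = 1 is meaningful for weakly differentiable
   arguments only. *)
Definition Bform s u w : \bar R :=
  if s == 0%R then \int[leb]_x (u x * w x)%:E
  else if s == 1%R then
    \int[leb]_x (\sum_(i < N) weak_partial i u x * weak_partial i w x)%:E
  else (C_frac N s)%:E *
    \int[leb \x leb]_z ((u z.1 - u z.2) * (w z.1 - w z.2)
                        / enorm (z.1 - z.2) `^ (N%:R + 2 * s))%:E.

(* [u]_s^2 = B_s(u, u), with [u]_1 = +oo when u has no weak gradient. *)
Definition seminorm_sq s u : \bar R :=
  if (s == 1%R) && ~~ `[< weakly_differentiable u >] then +oo else Bform s u u.

Variable mu : {measure set (measurableTypeR R) -> \bar R}.

Definition norm_mu u : \bar R :=
  (\int[mu]_(s in `[0%R, 1%R]) seminorm_sq s u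
   + \int[leb]_x (u x ^+ 2)%:E) `^ (2^-1)%R.

(* H^mu as a set of representatives: the Borel functions that are limits of
   test functions for the norm. *)
Definition Hmu u : Prop :=
  measurable_fun setT u /\
  forall eps : R, (0 < eps)%R ->
    exists2 f, test_function f & norm_mu (u \- f)%R < eps%:E.

End energy.

Definition smoothR {R : realType} (phi : R -> R) : Prop :=
  forall n t, derivable (derive1n n phi) t 1.

(* Main.v *)
Require Import Defs.
From HB Require Import structures.
From mathcomp Require Import all_boot all_order all_algebra.
From mathcomp Require Import all_classical all_reals all_analysis.
From mathcomp Require Import measurable_realfun ring lra.
Import Order.TTheory GRing.Theory Num.Theory.
Import numFieldNormedType.Exports.
Local Open Scope classical_set_scope.
Local Open Scope ring_scope.

(* By convexity [phi a - phi b <= phi' a * (a - b)] for all [a], [b].  Applied to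
   the pair (v(x), v(y)) and to its mirror image, with the weights w(x), w(y) >= 0,
   this bounds the integrand of B_s(phi(v), w) by that of B_s(v, phi'(v) w) when
   0 < s < 1; for s = 0 take b = 0, and for s = 1 the difference of the integrands
   is phi''(v) |grad v|^2 w >= 0.  So the inequality holds for each s, except that
   s = 1 requires weak gradients, which v and w have when mu({1}) > 0; otherwise
   {1} is a null set.

   That phi(v) belongs to H^mu follows by approximation: if test functions f_n tend
   to v for the norm and almost everywhere, then phi(f_n) tends to phi(v).  For
   s = 1 this is the chain rule in H^1.  For 0 < s < 1 the difference quotients of
   phi(v) - phi(f_n) are at most 2 L^2 times those of v - f_n plus 8 L^2 times
   those of v, and dominated convergence applies to the second part, in (x, y)
   and then in s, because the form B_s(v, v) is mu-integrable on ]0, 1[.  The latter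
   reduces to test functions, whose form B_s is bounded in s since C_{N,s} is
   O(s (1 - s)). *)

Set Implicit Arguments.
Unset Strict Implicit.
Unset Printing Implicit Defensive.

(** * Smooth functions and test functions *)

(** The quotients of phi(v) - phi(f_n) have no evident majorant independent of n, since their bound
    contains those of v - f_n. They are therefore bounded by this varying part, which tends to 0 in
    the mean, plus the minimum of themselves and the fixed part; that minimum tends to 0 almost
    everywhere and is dominated. The f_n have squared distance at most 2^-n to v, a summable rate,
    so almost everywhere convergence holds without extracting a subsequence.

    For s = 1 the form is built on chosen weak derivatives, and each chain or product rule has to be
    transferred to the chosen representative. This rests on uniqueness almost everywhere, the reason
    for the bumps made from exp(-1/t) and for the Dynkin argument on boxes.

    The bound on C_{N,s} takes the factor s from its definition and the factor 1 - s from 1 /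
    Gamma(1 - s) <= 2 e (1 - s).

    The forms in the conclusion may be infinite, and their measurability in s is not established:
    the integrands are compared, and the inequality passes to the integral because it is monotone on
    arbitrary functions. *)

Section smooth_functions.
Context {R : realType} {N : nat}.
Implicit Types (f g : 'rV[R]_N -> R) (p : R -> R).

(** Bounding the order makes smoothness accessible to induction: the product and chain rules express
    the first derivatives through functions that have one derivative less to spare. *)
Definition smooth_upto k f :=
  forall l : seq 'I_N, (size l <= k)%N ->
  forall x, differentiable (foldr partial f l) x.

Lemma smoothP f : smooth f <-> forall k, smooth_upto k f.
Proof. by split=> [sf k l _|sf l]; [exact: sf|exact: (sf (size l))]. Qed.

(** The derivative split off is the innermost one, the last entry of the list, so that an induction
    on [k] can replace [f] by [partial i f]. *)
Lemma smooth_uptoS k f : smooth_upto k.+1 f <->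
  (forall x, differentiable f x) /\ forall i, smooth_upto k (partial i f).
Proof.
split=> [sf|[df sf] l].
  split=> [x|i l lk x]; first exact: (sf [::]).
  by have := sf (rcons l i); rewrite foldr_rcons size_rcons; apply.
case/lastP: l => [_|l i]; first exact: df.
by rewrite size_rcons foldr_rcons => lk; exact: sf.
Qed.

Lemma smooth_uptoW k f : smooth_upto k.+1 f -> smooth_upto k f.
Proof. by move=> sf l lk; apply: sf; exact: leqW. Qed.

Lemma partialE i f x : differentiable f x ->
  partial i f x = 'd f x (delta_mx 0 i).
Proof. exact: deriveE. Qed.

Lemma partialD i f g x : differentiable f x -> differentiable g x ->
  partial i (f \+ g) x = partial i f x + partial i g x.
Proof. by move=> df dg; apply: deriveD; exact: diff_derivable. Qed.

Lemma partialM i f g x : differentiable f x -> differentiable g x ->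
  partial i (f \* g) x = f x * partial i g x + g x * partial i f x.
Proof. by move=> df dg; apply: deriveM; exact: diff_derivable. Qed.

Lemma partial_comp i p f x : differentiable f x -> derivable p (f x) 1 ->
  partial i (p \o f) x = derive1 p (f x) * partial i f x.
Proof.
move=> df /derivable1_diffP dp; rewrite !partialE//; last exact: differentiable_comp.
by rewrite diff_comp//= diff1E// mulrC.
Qed.

Lemma smooth_cst a : smooth (cst a : 'rV[R]_N -> R).
Proof.
apply/smoothP => k; elim: k a => [|k IH] a.
  by case=> // _ x; exact: differentiable_cst.
apply/smooth_uptoS; split=> [x|i]; first exact: differentiable_cst.
rewrite (_ : partial i _ = cst 0); first exact: IH.
by apply/funext => x; exact: derive_cst.
Qed.

Lemma smooth_uptoD k f g :
  smooth_upto k f -> smooth_upto k g -> smooth_upto k (f \+ g).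
Proof.
elim: k f g => [|k IH] f g sf sg.
  by case=> // _ x; apply: differentiableD; [exact: (sf [::])|exact: (sg [::])].
have [df sf'] := (smooth_uptoS _ _).1 sf; have [dg sg'] := (smooth_uptoS _ _).1 sg.
apply/smooth_uptoS; split=> [x|i]; first exact: differentiableD.
rewrite (_ : partial i _ = partial i f \+ partial i g); first exact: IH.
by apply/funext => x; exact: partialD.
Qed.

Lemma smooth_uptoM k f g :
  smooth_upto k f -> smooth_upto k g -> smooth_upto k (f \* g).
Proof.
elim: k f g => [|k IH] f g sf sg.
  by case=> // _ x; apply: differentiableM; [exact: (sf [::])|exact: (sg [::])].
have [df sf'] := (smooth_uptoS _ _).1 sf; have [dg sg'] := (smooth_uptoS _ _).1 sg.
apply/smooth_uptoS; split=> [x|i]; first exact: differentiableM.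
rewrite (_ : partial i _ = (f \* partial i g) \+ (g \* partial i f)).
  by apply: smooth_uptoD; apply: IH => //; exact: smooth_uptoW.
by apply/funext => x; exact: partialM.
Qed.

(** The induction also varies [p], because the chain rule replaces it by [derive1 p]. *)
Lemma smooth_upto_comp k p f :
  smoothR p -> smooth_upto k f -> smooth_upto k (p \o f).
Proof.
elim: k p f => [|k IH] p f sp sf.
  case=> // _ x; apply: differentiable_comp; first exact: (sf [::]).
  by apply/derivable1_diffP; exact: (sp 0%N).
have [df sf'] := (smooth_uptoS _ _).1 sf.
apply/smooth_uptoS; split=> [x|i].
  by apply: differentiable_comp => //; apply/derivable1_diffP; exact: (sp 0%N).
rewrite (_ : partial i _ = (derive1 p \o f) \* partial i f).
  apply: smooth_uptoM => //; apply: IH; last exact: smooth_uptoW.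
  by move=> n t; have := sp n.+1 t; rewrite derive1Sn.
by apply/funext => x; apply: partial_comp => //; exact: (sp 0%N).
Qed.

Lemma smoothD f g : smooth f -> smooth g -> smooth (f \+ g).
Proof.
by move=> /smoothP sf /smoothP sg; apply/smoothP => k; exact: smooth_uptoD.
Qed.

Lemma smoothM f g : smooth f -> smooth g -> smooth (f \* g).
Proof.
by move=> /smoothP sf /smoothP sg; apply/smoothP => k; exact: smooth_uptoM.
Qed.

Lemma smooth_comp p f : smoothR p -> smooth f -> smooth (p \o f).
Proof. by move=> sp /smoothP sf; apply/smoothP => k; exact: smooth_upto_comp. Qed.

Lemma smooth_partial i f : smooth f -> smooth (partial i f).
Proof. by move=> sf l; have := sf (rcons l i); rewrite foldr_rcons. Qed.

Lemma smooth_differentiable f x : smooth f -> differentiable f x.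
Proof. by move/(_ [::]); exact. Qed.

Lemma smooth_continuous f : smooth f -> continuous f.
Proof. by move=> sf x; exact/differentiable_continuous/smooth_differentiable. Qed.

Lemma derive_coord (j : 'I_N) (w x : 'rV[R]_N) :
  'D_w (fun y : 'rV[R]_N => y 0 j) x = w 0 j.
Proof.
rewrite deriveE; last exact: differentiable_coord.
(* The coordinate is packaged as a linear map, which is its own differential. *)
have @f : {linear 'rV[R]_N -> R}.
  by exists (fun y : 'rV[R]_N => y 0 j); do 2![eexists]; do ?[constructor];
     rewrite ?mxE// => ? *; rewrite ?mxE//; move=> ?; rewrite !mxE.
rewrite (_ : (fun _ => _) = f) // diff_lin//; exact: coord_continuous.
Qed.

Lemma smooth_coord (j : 'I_N) : smooth (fun x : 'rV[R]_N => x 0 j).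
Proof.
apply/smoothP; case=> [|k].
  by case=> // _ x; exact: differentiable_coord.
apply/smooth_uptoS; split=> [x|i]; first exact: differentiable_coord.
rewrite (_ : partial i _ = cst ((delta_mx 0 i : 'rV[R]_N) 0 j)).
  exact: ((smoothP _).1 (smooth_cst _)).
by apply/funext => x; exact: derive_coord.
Qed.

Lemma smooth_prod (I : Type) (r : seq I) (F : I -> 'rV[R]_N -> R) :
  (forall i, smooth (F i)) -> smooth (fun x => \prod_(i <- r) F i x).
Proof.
move=> sF; elim: r => [|i r IH].
  rewrite (_ : (fun _ => _) = cst 1); first exact: smooth_cst.
  by apply/funext => x; rewrite big_nil.
rewrite (_ : (fun _ => _) = F i \* (fun x => \prod_(j <- r) F j x)).
  exact: smoothM.
by apply/funext => x; rewrite big_cons.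
Qed.

Lemma smoothB f g : smooth f -> smooth g -> smooth (f \- g).
Proof.
move=> sf sg; rewrite (_ : _ \- _ = f \+ (cst (-1) \* g)).
  by apply: smoothD => //; apply: smoothM => //; exact: smooth_cst.
by apply/funext => x /=; rewrite mulN1r.
Qed.

End smooth_functions.

Section test_functions.
Context {R : realType} {N : nat}.
Implicit Types (f g : 'rV[R]_N -> R) (p : R -> R).

Lemma rV_compact_closed (A : set 'rV[R]_N) : compact A -> closed A.
Proof. by apply: compact_closed; exact: norm_hausdorff. Qed.

Lemma test_function_sub f g : test_function f -> smooth g ->
  (forall x, f x = 0 -> g x = 0) -> test_function g.
Proof.
move=> [sf cf] sg fg; split=> //; apply: (subclosed_compact _ cf).
  exact: closed_closure.
apply: closure_subset => x /=; apply: contraNN => /eqP/fg ->; exact/eqP.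
Qed.

Lemma test_functionM f g : test_function f -> smooth g -> test_function (f \* g).
Proof.
move=> tf sg; apply: (test_function_sub tf); first exact: (smoothM tf.1 sg).
by move=> x /= ->; rewrite mul0r.
Qed.

Lemma test_function_comp p f : smoothR p -> p 0 = 0 -> test_function f ->
  test_function (p \o f).
Proof.
move=> sp p0 tf; apply: (test_function_sub tf); first exact: (smooth_comp sp tf.1).
by move=> x /= ->.
Qed.

Lemma partial_out i f x : ~ closure [set y | f y != 0] x -> partial i f x = 0.
Proof.
move=> nx; have : \forall z \near x, f z = (cst 0 : _ -> R) z.
  have : nbhs x (~` closure [set y | f y != 0]).
    by apply: open_nbhs_nbhs; split => //; apply: closed_openC; exact: closed_closure.
  apply: filterS => z fz; apply/eqP.
  by apply: contra_notT fz => fz; exact: subset_closure.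
by move=> x0; rewrite /partial (near_eq_derive _ x0) derive_cst.
Qed.

Lemma test_function_partial i f : test_function f -> test_function (partial i f).
Proof.
move=> [sf cf]; split; first exact: smooth_partial.
apply: (subclosed_compact _ cf); first exact: closed_closure.
rewrite closureE => x; apply; split; first exact: closed_closure.
move=> y /=; apply: contra_neqP; exact: partial_out.
Qed.

End test_functions.

(** * The flat function exp(-1/t) *)

Section bump.
Context {R : realType}.
Implicit Types (P : {poly R}) (x t : R).

(** The [n]-th power of [x / n <= exp (x / n)], which follows from [1 + y <= exp y]. *)
Lemma expn_le_expR n x : 0 <= x -> x ^+ n <= n%:R ^+ n * expR x.
Proof.
move=> x0; case: n => [|n]; first by rewrite !expr0 mul1r -expR0 ler_expR.
rewrite -[X in expR X](@mulVKf _ n.+1%:R) ?pnatr_eq0// -[X in expR (_ * X)]mulrC.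
rewrite expRM_natl -exprMn; apply: lerXn2r; rewrite ?nnegrE//.
rewrite -ler_pdivrMl// [n.+1%:R^-1 * x]mulrC; apply: le_trans (expR_ge1Dx _).
by rewrite lerDr.
Qed.

Lemma poly_expR_bounded P :
  exists2 C : R, 0 <= C & forall x, 0 <= x -> `|P.[x] * expR (- x)| <= C.
Proof.
exists (\sum_(i < size P) `|P`_i| * i%:R ^+ i).
  by apply: sumr_ge0 => i _; rewrite mulr_ge0// exprn_ge0.
move=> x x0; rewrite horner_coef mulr_suml; apply: le_trans (ler_norm_sum _ _ _) _.
apply: ler_sum => i _; rewrite !normrM -mulrA ler_wpM2l//.
rewrite ger0_norm ?exprn_ge0// ger0_norm ?expR_ge0// expRN.
by rewrite ler_pdivrMr ?expR_gt0//; exact: expn_le_expR.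
Qed.

(* The class of functions [P(1/t) exp(-1/t)], extended by [0] to [t <= 0], is
   closed under differentiation, hence consists of smooth functions. *)
Definition poly_flat P t := if 0 < t then P.[t^-1] * expR (- t^-1) else 0.

(** In the variable [x = 1/t] one has [d/dt = - x^2 d/dx], which sends [P(x) exp(-x)] to
    [x^2 (P - P')(x) exp(-x)]. Only [t = 0] needs an estimate. *)
Lemma poly_flat_is_derive P t :
  is_derive t 1 (poly_flat P) (poly_flat ('X ^+ 2 * (P - P^`())) t).
Proof.
have [t0|t0|->] := ltgtP t 0.
- rewrite {2}/poly_flat ltNge (ltW t0)/=.
  apply: (@near_eq_is_derive R R R (cst 0)).
  near=> u; rewrite /poly_flat ltNge (_ : u <= 0)//=.
  by near: u; exact: lt_le_nbhsl.
- have nE : \forall u \near t, P.[u^-1] * expR (- u^-1) = poly_flat P u.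
    near=> u; rewrite /poly_flat (_ : 0 < u)//.
    by near: u; exact: lt_nbhsr.
  apply: near_eq_is_derive nE _; rewrite /poly_flat t0.
  have di : is_derive t 1 (fun u : R => u^-1) (- t ^- 2).
    have := is_deriveV (lt0r_neq0 t0) (is_derive_id t 1).
    by rewrite /GRing.scale/= mulr1.
  have dp : is_derive t 1 (horner P \o (fun u : R => u^-1)) (P^`().[t^-1] * (- t ^- 2)).
    by apply: is_derive1_comp.
  have de : is_derive t 1 (fun u : R => expR (- u^-1)) (expR (- t^-1) * (t ^- 2)).
    have := @is_derive1_comp _ expR (fun u => - u^-1) t _ _ (is_derive_expR _) (is_deriveN di).
    by rewrite opprK.
  apply: is_derive_eq; rewrite !hornerE exprVn -[LHS]/(P.[t^-1] *
    (expR (- t^-1) / t ^+ 2) + expR (- t^-1) * (P^`().[t^-1] * - t ^- 2)).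
  ring.
rewrite {2}/poly_flat ltxx.
(* Boundedness of [x^2 P(x) exp(-x)] for [x = 1/h] makes [poly_flat P h] at most [C h^2], so the
   difference quotient at the origin is at most [C |h|]. *)
have [C C0 hC] := poly_expR_bounded (P * 'X ^+ 2).
have flat_le (h : R) : `|poly_flat P h| <= C * h ^+ 2.
  rewrite /poly_flat; case: ifPn => h0; last by rewrite normr0 mulr_ge0 ?sqr_ge0.
  have := hC h^-1; rewrite invr_ge0 hornerM hornerXn exprVn => /(_ (ltW h0)).
  rewrite mulrAC normrM [`|h ^- 2|]ger0_norm ?invr_ge0 ?sqr_ge0//.
  by rewrite ler_pdivrMr// exprn_gt0.
have cv : (fun h => h^-1 *: (poly_flat P (h *: 1 + 0) - poly_flat P 0)) @ 0^' --> (0:R).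
  apply/cvgr0Pnorm_le => e e0; near=> h.
  rewrite {2}/poly_flat ltxx subr0 addr0 [h *: 1]mulr1 normrZ normfV.
  have h0 : h != 0 by near: h; exact: nbhs_dnbhs_neq.
  rewrite ler_pdivrMl ?normr_gt0//; apply: le_trans (flat_le h) _.
  rewrite -real_normK ?num_real// expr2 mulrCA ler_wpM2l//.
  have : `|h| <= e / (C + 1).
    near: h; apply: dnbhs0_le; rewrite divr_gt0// ltr_wpDl//.
  rewrite ler_pdivlMr; last by rewrite ltr_wpDl.
  by apply: le_trans; rewrite mulrC ler_wpM2l// lerDl.
apply: DeriveDef; first by apply/cvg_ex; exists 0; exact: cv.
by apply: cvg_lim => //; exact: cv.
Unshelve. all: by end_near. Qed.

Lemma poly_flat_smooth P : smoothR (poly_flat P).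
Proof.
move=> n; suff [Q ->] : exists Q, derive1n n (poly_flat P) = poly_flat Q.
  by move=> t; have [] := poly_flat_is_derive Q t.
elim: n => [|n [Q IH]]; first by exists P.
exists ('X ^+ 2 * (Q - Q^`())); rewrite derive1nS IH.
by apply/funext => t; rewrite derive1E; have [_ ->] := poly_flat_is_derive Q t.
Qed.

Definition flat : R -> R := poly_flat 1.

Lemma flatE t : flat t = if 0 < t then expR (- t^-1) else 0.
Proof. by rewrite /flat /poly_flat hornerC mul1r. Qed.

Lemma flat_ge0 t : 0 <= flat t.
Proof. by rewrite flatE; case: ifP => // _; exact: expR_ge0. Qed.

Lemma flat_le1 t : flat t <= 1.
Proof.
rewrite flatE; case: ifP => // t0.
by rewrite -expR0 ler_expR oppr_le0 invr_ge0 ltW.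
Qed.

Lemma flat_eq0 t : t <= 0 -> flat t = 0.
Proof. by rewrite flatE leNgt => /negbTE ->. Qed.

Lemma flat_cvg t : 0 < t -> flat (n.+1%:R * t) @[n --> \oo] --> (1 : R).
Proof.
move=> t0; rewrite (_ : (fun _ => _) = fun n => expR (- (n.+1%:R^-1 * t^-1))).
  have h0 : n.+1%:R^-1 * t^-1 @[n --> \oo] --> (0 : R).
    by rewrite -[X in _ --> X](mul0r t^-1); apply: cvgMr_tmp; exact: cvg_harmonic.
  rewrite -[X in _ --> X]expR0 -[X in _ --> expR X]oppr0.
  by apply: (@continuous_cvg _ _ _ _ _ _ expR); [exact: continuous_expR|exact: cvgN].
by apply/funext => n; rewrite flatE mulr_gt0// invfM.
Qed.

End bump.

(** * Lebesgue measure on R^N *)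

Section rV_topology.
Context {R : realType} {N : nat}.
Implicit Types (x y : 'rV[R]_N) (A : set 'rV[R]_N).

Lemma rV_norm_ltP x e : 0 < e -> (`|x| < e) <-> (forall i, `|x 0 i| < e).
Proof.
move=> e0; rewrite [`|x|]/Num.norm/= mx_normrE; split=> [xe i|xe].
  by have /bigmax_ltP[_ /(_ (0, i) isT)] := xe.
by apply/bigmax_ltP; split=> // -[i j] _ /=; rewrite ord1.
Qed.

Lemma rV_norm_coord x i : `|x 0 i| <= `|x|.
Proof.
rewrite [leRHS]/Num.norm/= mx_normrE.
by apply/bigmax_geP; right; exists (0, i).
Qed.

Lemma rV_norm_leP x e : 0 <= e -> (`|x| <= e) <-> (forall i, `|x 0 i| <= e).
Proof.
move=> e0; split=> [xe i|xe]; first exact: le_trans (rV_norm_coord _ _) xe.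
rewrite [`|x|]/Num.norm/= mx_normrE.
by apply/bigmax_leP; split=> // -[i j] _ /=; rewrite ord1.
Qed.

(** The sup-norm ball, spelt out by coordinates so that the product formula for boxes gives its
    measure. *)
Definition cube x (r : R) : set 'rV[R]_N := [set y | forall i, `|y 0 i - x 0 i| < r].

Lemma cubeE x r : 0 < r -> cube x r = ball x r.
Proof.
move=> r0; rewrite -ball_normE; apply/seteqP; split => y /=.
  by move=> xy; rewrite distrC; apply/rV_norm_ltP => // i; rewrite !mxE; exact: xy.
by rewrite distrC => /(rV_norm_ltP _ r0) xy i; have := xy i; rewrite !mxE.
Qed.

Lemma measurable_box (F : 'I_N -> set (measurableTypeR R)) :
  (forall i, measurable (F i)) ->
  measurable [set x : 'rV[R]_N | forall i, F i (x 0 i)].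
Proof.
move=> mF; rewrite [X in measurable X](_ : _ =
    \bigcap_(i in [set: 'I_N]) (rV_coord i @^-1` F i)); last first.
  by apply/seteqP; split => x /= Ax i; [move=> _|]; exact: Ax.
apply: fin_bigcap_measurable => // i _.
by rewrite -[X in measurable X]setTI; exact: measurable_rV_coord.
Qed.

Lemma cube_itv x r : cube x r =
  [set y | forall i, (`]x 0 i - r, x 0 i + r[%classic : set R) (y 0 i)].
Proof.
by apply/seteqP; split => y xy i; have := xy i; rewrite /= in_itv/= ltr_distl.
Qed.

Lemma measurable_cube x r : measurable (cube x r).
Proof.
rewrite cube_itv; apply: (measurable_box (F := fun i => `]x 0 i - r, x 0 i + r[%classic)).
by move=> i; exact: measurable_itv.
Qed.

(** An open set is the countable union of the cubes with rational centre and radius [1/(n+1)] that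
    it contains; this links the sigma-algebra generated by the coordinates to the topology. *)
Lemma rV_open_measurable A : open A -> measurable A.
Proof.
move=> oA.
rewrite (_ : A = \bigcup_(z : nat * 'rV[rat]_N)
  [set y | cube (map_mx ratr z.2) z.1.+1%:R^-1 y /\
      (cube (map_mx ratr z.2) z.1.+1%:R^-1 `<=` A)]); last first.
  apply/seteqP; split => [x Ax|x [[n q] _ [qx]]]; last exact.
  have /nbhs_ballP[e /= e0 xA] : nbhs x A by exact: open_nbhs_nbhs.
  (* Half of [e]: the cube is centred at a rational point near [x], so two of its radii separate [x]
     from its other points. *)
  have [n ne] : exists n, n.+1%:R^-1 < e / 2.
    by have [n _ /(_ _ (leqnn _))] := near_infty_natSinv_lt (PosNum (divr_gt0 e0 (ltr0n R 2))); exists n.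
  have hq i : exists q : rat, `|x 0 i - ratr q| < n.+1%:R^-1.
    have [q] := @rat_in_itvoo R (x 0 i - n.+1%:R^-1) (x 0 i + n.+1%:R^-1) ltac:(rewrite ltrD2l gtrN// invr_gt0).
    by rewrite in_itv/= => qi; exists q; rewrite distrC ltr_distl.
  have [q qx] := choice hq.
  exists (n, \row_i q i) => //=; split=> [i|y qy]; first by rewrite !mxE; exact: qx.
  apply: xA; rewrite -cubeE// => i.
  have := qy i; have := qx i; rewrite !mxE => h1 h2.
  rewrite -[y 0 i - x 0 i](subrKA (ratr (q i))) (le_lt_trans (ler_normD _ _))//.
  by rewrite [ltRHS]splitr ltrD// ?(lt_trans h2)// distrC (lt_trans h1).
apply: countable_bigcupT_measurable; first exact: countableP.
move=> -[n q]; have [qA|qA] := pselect (cube (map_mx ratr q) n.+1%:R^-1 `<=` A).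
  rewrite [X in measurable X](_ : _ = cube (map_mx ratr q) n.+1%:R^-1).
    exact: measurable_cube.
  by apply/seteqP; split => y //= [].
rewrite [X in measurable X](_ : _ = set0); first exact: measurable0.
by apply/seteqP; split => y //= [].
Qed.

Lemma rV_closed_measurable A : closed A -> measurable A.
Proof.
by move=> /closed_openC/rV_open_measurable mA; rewrite -(setCK A); exact: measurableC.
Qed.

Lemma rV_compact_measurable A : compact A -> measurable A.
Proof. by move=> /rV_compact_closed; exact: rV_closed_measurable. Qed.

Lemma rV_continuous_measurable (f : 'rV[R]_N -> R) :
  continuous f -> measurable_fun setT f.
Proof.
move=> cf mD; apply: (measurability _ (measurable_realfun.RGenOInfty.measurableE R)) => //.
move=> /= _ [_ [a ->] <-]; apply: measurableI => //; apply: rV_open_measurable.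
by apply: open_comp => [x _|]; [exact: cf|rewrite set_itvoy; exact: open_gt].
Qed.

Lemma compact_sub_cube A : compact A -> exists n : nat, A `<=` cube 0 n.+1%:R.
Proof.
move=> /compact_bounded[M [Mr AM]].
exists (Num.truncn `|M + 1|) => x Ax i; rewrite mxE subr0.
apply: le_lt_trans (rV_norm_coord _ _) _; apply: le_lt_trans (truncnS_gt _).
by apply: le_trans (ler_norm _); apply: AM => //; rewrite ltrDl.
Qed.

End rV_topology.

Section lebesgue_rV_facts.
Context {R : realType} {N : nat}.
Local Notation leb := (lebesgue_rV N).

Lemma leb_cube (x : 'rV[R]_N) r : 0 <= r -> leb (cube x r) = ((2 * r) ^+ N)%:E.
Proof.
move=> r0; rewrite cube_itv.
rewrite (lebesgue_rV_box (A := fun i => `]x 0 i - r, x 0 i + r[%classic)); last first.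
  by move=> i; exact: measurable_itv.
under eq_bigr do rewrite lebesgue_measure_itv/= lte_fin -EFinD.
rewrite (eq_bigr (fun=> (2 * r)%:E)) => [|i _].
  by rewrite prodEFin prodr_const card_ord.
case: ltP => [_|h]; first by congr EFin; ring.
by congr EFin; lra.
Qed.

Lemma leb_compact_lty (K : set 'rV[R]_N) : compact K -> (leb K < +oo)%E.
Proof.
move=> cK; have [n Kn] := compact_sub_cube cK.
apply: le_lt_trans (le_measure _ _ _ Kn) _; rewrite ?inE.
- exact: rV_compact_measurable.
- exact: measurable_cube.
- by have := ltry ((2 * n.+1%:R : R) ^+ N); rewrite -(leb_cube 0 (ler0n _ _)).
Qed.

Lemma bounded_cube_integrable (f : 'rV[R]_N -> R) n C : measurable_fun setT f ->
  (forall x, `|f x| <= C) -> (forall x, ~ cube 0 n x -> f x = 0) -> 0 <= n ->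
  leb.-integrable setT (EFin \o f).
Proof.
move=> mf fC f0 n0.
have -> : EFin \o f = (EFin \o f) \_ (cube 0 n).
  by apply/funext => x; rewrite patchE; case: ifPn => // /negP; rewrite inE => /f0 /= ->.
apply: (integrable_mkcond _ (measurable_cube 0 n)).1.
apply: measurable_bounded_integrable.
- exact: measurable_cube.
- by have := ltry ((2 * n) ^+ N); rewrite -(leb_cube 0 n0).
- exact: measurable_funTS.
- exists C; split; first exact: num_real.
  by move=> M CM x _ /=; exact: le_trans (fC x) (ltW CM).
Qed.

Lemma continuous_cube_bounded (f : 'rV[R]_N -> R) n : continuous f -> 0 <= n ->
  (forall x, ~ cube 0 n x -> f x = 0) -> exists2 C : R, 0 <= C & forall x, `|f x| <= C.
Proof.
move=> cf n0 f0.
have cK : compact [set x : 'rV[R]_N | forall i, `[- n, n]%classic (x 0 i)].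
  by apply: (@rV_compact _ _ (fun=> `[- n, n]%classic)) => _; exact: segment_compact.
have /compact_bounded [M [Mr HM]] : compact (f @` [set x : 'rV[R]_N | forall i, `[- n, n]%classic (x 0 i)]).
  by apply: continuous_compact => //; exact/continuous_subspaceT.
exists (`|M| + 1) => [|x]; first by rewrite addr_ge0.
have [Kx|Kx] := pselect (cube 0 n x).
  apply: HM; first by rewrite ltr_pwDr// ler_norm.
  exists x => // i; rewrite /= in_itv/= -ler_norml.
  by have := Kx i; rewrite mxE subr0 => /ltW.
by rewrite f0// normr0 addr_ge0.
Qed.

Lemma rV_continuousP (T : topologicalType) (F : T -> 'rV[R]_N) :
  (forall i, continuous (fun t => F t 0 i)) -> continuous F.
Proof.
move=> cF t; apply/cvgrPdist_lt => e e0.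
have : \forall u \near t, forall i, `|F t 0 i - F u 0 i| < e.
  apply: filter_forall => i.
  by have /cvgrPdist_lt/(_ e e0) := cF i t.
by apply: filterS => u Hu; apply/(rV_norm_ltP _ e0) => i; rewrite !mxE; exact: Hu.
Qed.

End lebesgue_rV_facts.

(** * Partial derivatives of compactly supported functions integrate to zero *)

Section divergence.
Context {R : realType}.

Lemma integral_derive_eq0 (F f : R -> R) (M : R) : 0 < M -> continuous f ->
  (forall t : R, is_derive t 1 F (f t)) ->
  (forall t : R, M <= `|t| -> F t = 0) -> (forall t : R, M <= `|t| -> f t = 0) ->
  (\int[lebesgue_measure]_t (f t)%:E = 0)%E.
Proof.
move=> M0 cf dF F0 f0.
have -> : (\int[lebesgue_measure]_t (f t)%:E =
    \int[lebesgue_measure]_(t in `[(- M)%R, M]) (f t)%:E)%E.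
  rewrite [RHS]integral_mkcond; apply: eq_integral => x _; rewrite patchE.
  case: ifPn => // /negP; rewrite inE/= in_itv/= -ler_norml.
  by move=> /negP; rewrite -ltNge => /ltW/f0 ->.
have cF : continuous F.
  by move=> x; apply: differentiable_continuous; apply/derivable1_diffP; have [] := dF x.
rewrite (@continuous_FTC2 _ f F).
- by rewrite !F0 ?normrN ?ler_norm ?subee.
- by rewrite gtrN.
- exact: continuous_subspaceT.
- split=> [x _||]; first by have [] := dF x.
  + exact/cvg_at_right_filter/cF.
  + exact/cvg_at_left_filter/cF.
- by move=> x _; rewrite derive1E; have [_ ->] := dF x.
Qed.

(** Linearity of [rV_cons] turns an increment along a basis vector of R^(n+1) into an increment of
    one component of the pair, so that difference quotients can be read on slices. *)
Lemma rV_consD n (p q : measurableTypeR R * 'rV[R]_n) (a : R) :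
  a *: rV_cons p + rV_cons q = rV_cons ((a * p.1 + q.1 : R), a *: p.2 + q.2).
Proof.
have E (A B : 'rV[R]_n.+1) k : (a *: A + B) 0 k = a * A 0 k + B 0 k by rewrite !mxE.
apply/rowP => i; rewrite E; have [j ->|->] := unliftP ord0 i.
  by rewrite !rV_consS/= !mxE.
by rewrite !rV_cons0.
Qed.

Lemma delta_cons0 n : (delta_mx 0 ord0 : 'rV[R]_n.+1) = rV_cons (1, 0).
Proof.
apply/rowP => i; have [j ->|->] := unliftP ord0 i.
  by rewrite rV_consS !mxE.
by rewrite rV_cons0 !mxE.
Qed.

Lemma delta_consS n (j : 'I_n) :
  (delta_mx 0 (lift ord0 j) : 'rV[R]_n.+1) = rV_cons (0, delta_mx 0 j).
Proof.
apply/rowP => i; have [k ->|->] := unliftP ord0 i.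
  by rewrite rV_consS !mxE (inj_eq lift_inj).
by rewrite rV_cons0 !mxE.
Qed.

Lemma cube_cons n (p : measurableTypeR R * 'rV[R]_n) M :
  cube 0 M (rV_cons p) <-> `|p.1 : R| < M /\ cube 0 M p.2.
Proof.
split=> [Kp|[p1 p2] i].
  split; first by have := Kp ord0; rewrite rV_cons0 mxE subr0.
  by move=> i; have := Kp (lift ord0 i); rewrite rV_consS !mxE.
have [k ->|->] := unliftP ord0 i; last by rewrite rV_cons0 mxE subr0.
by rewrite rV_consS; have := p2 k; rewrite !mxE.
Qed.

(** Induction on the dimension with Fubini. For the first coordinate, the inner integral over it
    vanishes by the one-dimensional case; for another one, the inner integral over the remaining
    coordinates vanishes by induction. The hypotheses are stated for a single direction and a cube
    because in this form they pass to slices. *)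
Lemma integral_partial_eq0 n (i : 'I_n) (f : 'rV[R]_n -> R) (M : R) : 0 < M ->
  continuous f -> continuous (partial i f) ->
  (forall x, derivable f x (delta_mx 0 i)) ->
  (forall x, ~ cube 0 M x -> f x = 0) ->
  (forall x, ~ cube 0 M x -> partial i f x = 0) ->
  (\int[lebesgue_rV n]_x (partial i f x)%:E = 0)%E.
Proof.
move=> M0; elim: n i f => [[]//|n IH] i f cf cpf df f0 pf0.
have [C C0 HC] := continuous_cube_bounded cpf (ltW M0) pf0.
have mpf := rV_continuous_measurable cpf.
have ipf : (lebesgue_rV n.+1).-integrable setT (EFin \o partial i f).
  exact: (bounded_cube_integrable mpf HC pf0 (ltW M0)).
have mEpf : measurable_fun [set: 'rV[R]_n.+1] (EFin \o partial i f : 'rV[R]_n.+1 -> \bar R) by exact/measurable_EFinP.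
have mEpfc : measurable_fun setT ((EFin \o partial i f) \o @rV_cons R n).
  by apply: measurableT_comp => //; exact: measurable_rV_cons.
have ipfc : (lebesgue_measure \x lebesgue_rV n)%E.-integrable setT
    ((EFin \o partial i f) \o @rV_cons R n).
  apply/integrableP; split => //.
  have /integrableP[_] := ipf; apply: le_lt_trans.
  have := @ge0_integral_pushforward _ _ _ _ R _ (@measurable_rV_cons R n)
    (lebesgue_measure \x lebesgue_rV n)%E setT (fun x => `|(partial i f x)%:E|%E)
    measurableT.
  rewrite preimage_setT => <- //.
  by apply: measurableT_comp => //.
have -> : (\int[lebesgue_rV n.+1]_x (partial i f x)%:E =
   \int[lebesgue_measure \x lebesgue_rV n]_p ((EFin \o partial i f) \o @rV_cons R n) p)%E.
  have := @integral_pushforward _ _ _ _ R _ (@measurable_rV_cons R n)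
    (lebesgue_measure \x lebesgue_rV n)%E setT (EFin \o partial i f) mEpf.
  by rewrite preimage_setT; apply.
have [j ij|i0] := unliftP ord0 i.
  rewrite -integral12_prod_meas1//; apply: integral0_eq => a _.
  pose fa (y : 'rV[R]_n) := f (rV_cons (a, y)).
  have ca : continuous (fun y : 'rV[R]_n => rV_cons ((a, y) : measurableTypeR R * 'rV[R]_n)).
    apply: rV_continuousP => k; have [l ->|->] := unliftP ord0 k.
      rewrite (_ : (fun _ => _) = fun y : 'rV[R]_n => y 0 l); first exact: coord_continuous.
      by apply/funext => y; rewrite rV_consS.
    rewrite (_ : (fun _ => _) = cst a); first exact: cst_continuous.
    by apply/funext => y; rewrite rV_cons0.
  have qE y : (fun h : R => h^-1 *: (fa (h *: delta_mx 0 j + y) - fa y)) =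
      (fun h : R => h^-1 *: (f (h *: delta_mx 0 i + rV_cons (a, y)) - f (rV_cons (a, y)))).
    by apply/funext => h; rewrite /fa ij delta_consS rV_consD/= mulr0 add0r.
  have pE : partial i f \o (fun y => rV_cons (a, y)) = partial j fa.
    by apply/funext => y; rewrite /= /partial /derive qE.
  have pEx y : partial i f (rV_cons (a, y)) = partial j fa y by rewrite -pE.
  rewrite /fubini_F; under eq_integral do rewrite /= pEx.
  apply: IH.
  - by move=> t; apply: (@continuous_comp _ _ _ (fun y => rV_cons (a, y)) f); [exact: ca|exact: cf].
  - by rewrite -pE => t; apply: (@continuous_comp _ _ _ (fun y => rV_cons (a, y)) (partial i f)); [exact: ca|exact: cpf].
  - by move=> y; rewrite /derivable qE; exact: df.
  - by move=> y ny; apply: f0 => /cube_cons[].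
  - by move=> y ny; rewrite -pEx; apply: pf0 => /cube_cons[].
rewrite -integral21_prod_meas1//; apply: integral0_eq => y _.
have cy : continuous (fun a : R => rV_cons (a, y)).
  apply: rV_continuousP => k; have [l ->|->] := unliftP ord0 k.
    rewrite (_ : (fun _ => _) = cst (y 0 l)); first exact: cst_continuous.
    by apply/funext => a; rewrite rV_consS.
  rewrite (_ : (fun _ => _) = id); first by move=> a.
  by apply/funext => a; rewrite rV_cons0.
rewrite /fubini_G; apply: (@integral_derive_eq0 (fun a => f (rV_cons (a, y))) _ M) => //.
- by move=> t; apply: (@continuous_comp _ _ _ (fun a : R => rV_cons (a, y)) (partial i f)); [exact: cy|exact: cpf].
- move=> t.
  have qE : (fun h : R => h^-1 *: (f (rV_cons (h *: 1 + t, y)) - f (rV_cons (t, y)))) =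
      (fun h : R => h^-1 *: (f (h *: delta_mx 0 i + rV_cons (t, y)) - f (rV_cons (t, y)))).
    by apply/funext => h; rewrite i0 delta_cons0 rV_consD/= scaler0 add0r.
  by apply: DeriveDef; [rewrite /derivable qE; exact: df|rewrite /derive qE].
- by move=> t Mt; apply: f0 => /cube_cons[/=]; rewrite ltNge Mt.
- by move=> t Mt; apply: pf0 => /cube_cons[/=]; rewrite ltNge Mt.
Qed.

End divergence.

(** * A function orthogonal to all test functions vanishes almost everywhere *)

Section boxes.
Context {R : realType} {N : nat}.
Local Notation leb := (lebesgue_rV N).
Implicit Types (a b : 'I_N -> R).

Definition obox a b : set 'rV[R]_N := [set x | forall i, a i < x 0 i < b i].

Definition cbox a b : set 'rV[R]_N := [set x | forall i, a i <= x 0 i <= b i].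

Lemma oboxE a b :
  obox a b = [set x | forall i, (`]a i, b i[%classic : set R) (x 0 i)].
Proof. by apply/seteqP; split => x xab i; have := xab i; rewrite /= in_itv. Qed.

Lemma measurable_obox a b : measurable (obox a b).
Proof.
rewrite oboxE; apply: (measurable_box (F := fun i => `]a i, b i[%classic)).
by move=> i; exact: measurable_itv.
Qed.

Lemma compact_cbox a b : compact (cbox a b).
Proof.
rewrite (_ : cbox a b = [set x | forall i, `[a i, b i]%classic (x 0 i)]).
  by apply: (@rV_compact _ _ (fun i => `[a i, b i]%classic)) => i; exact: segment_compact.
by apply/seteqP; split => x xab i; have := xab i; rewrite /= in_itv.
Qed.

Lemma setI_obox a b c d :
  obox a b `&` obox c d = obox (fun i => Num.max (a i) (c i)) (fun i => Num.min (b i) (d i)).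
Proof.
apply/seteqP; split => [x [xab xcd] i|x H]; last split=> i.
- by rewrite gt_max lt_min; have /andP[-> ->] := xab i; have /andP[-> ->] := xcd i.
- by have := H i; rewrite gt_max lt_min => /andP[/andP[-> _] /andP[-> _]].
- by have := H i; rewrite gt_max lt_min => /andP[/andP[_ ->] /andP[_ ->]].
Qed.

Lemma cube_obox (x : 'rV[R]_N) r :
  cube x r = obox (fun i => x 0 i - r) (fun i => x 0 i + r).
Proof. by apply/seteqP; split => y xy i; have := xy i; rewrite ltr_distl. Qed.

Definition oboxes : set (set 'rV[R]_N) := [set A | exists a b, A = obox a b].

(** Half-spaces [t < x_i] are countable unions of boxes, so the boxes generate; being stable under
    intersection, they can start a Dynkin argument. *)
Lemma measurable_oboxes : @measurable _ 'rV[R]_N = <<s oboxes >>.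
Proof.
apply/seteqP; split; last first.
  apply: smallest_sub; first exact: sigma_algebra_measurable.
  by move=> _ [a [b ->]]; exact: measurable_obox.
apply: smallest_sub; first exact: smallest_sigma_algebra.
move=> A; rewrite -bigcup_seq => -[i _ [B mB <-]]; rewrite setTI.
pose C := [set B : set R | <<s oboxes >> (rV_coord i @^-1` B)].
have sC : sigma_algebra setT C.
  split => [|D CD|F CF]; rewrite /C/=.
  - by rewrite preimage_set0; exact: sigma_algebra0.
  - by rewrite setTD preimage_setC -setTD; exact: sigma_algebraCD.
  - by rewrite preimage_bigcup; exact: sigma_algebra_bigcup.
have mB' : <<s @measurable_realfun.RGenOInfty.G R >> B.
  by move: mB; rewrite [X in X B -> _](measurable_realfun.RGenOInfty.measurableE R).
apply: (mB' C); split => //.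
move=> _ [t ->]; rewrite /C/=.
rewrite (_ : _ @^-1` _ = \bigcup_k obox (fun j => if j == i then t else - k%:R) (fun=> k%:R)).
  apply: sigma_algebra_bigcup => k; apply: sub_sigma_algebra; by do 2 eexists.
apply/seteqP; split => [x|x [k _ xk]]; last first.
  by have := xk i; rewrite eqxx /= in_itv/= andbT => /andP[].
rewrite /= in_itv/= andbT => tx; exists (Num.truncn `|x|).+1 => // j.
have xj : `|x 0 j| < (Num.truncn `|x|).+1%:R.
  by apply: le_lt_trans (truncnS_gt _); exact: rV_norm_coord.
move: xj; rewrite ltr_norml => /andP[x1 ->]; rewrite andbT.
by case: eqP => // ->.
Qed.

(* Converges pointwise to the indicator function of [obox a b]. *)
Definition bump a b n (x : 'rV[R]_N) : R :=
  \prod_(i < N) (flat (n.+1%:R * (x 0 i - a i)) * flat (n.+1%:R * (b i - x 0 i))).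

Lemma smooth_bump a b n : smooth (bump a b n).
Proof.
have sl (i : 'I_N) (c d : R) : smooth (fun x : 'rV[R]_N => c * (d * x 0 i + - (d * a i))).
  apply: smoothM; first exact: smooth_cst.
  apply: smoothD; last exact: smooth_cst.
  by apply: smoothM; [exact: smooth_cst|exact: smooth_coord].
apply: smooth_prod => i; apply: smoothM.
  apply: smooth_comp; first exact: poly_flat_smooth.
  apply: smoothM; first exact: smooth_cst.
  by apply: smoothB; [exact: smooth_coord|exact: smooth_cst].
apply: smooth_comp; first exact: poly_flat_smooth.
apply: smoothM; first exact: smooth_cst.
by apply: smoothB; [exact: smooth_cst|exact: smooth_coord].
Qed.

Lemma bump_ge0 a b n x : 0 <= bump a b n x.
Proof. by apply: prodr_ge0 => i _; rewrite mulr_ge0 ?flat_ge0. Qed.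

Lemma bump_le1 a b n x : bump a b n x <= 1.
Proof.
by apply: prodr_ile1 => i _; rewrite mulr_ge0 ?flat_ge0//= mulr_ile1 ?flat_ge0 ?flat_le1.
Qed.

Lemma bump_out a b n x : ~ obox a b x -> bump a b n x = 0.
Proof.
move=> /existsNP[i /negP]; rewrite negb_and => xi.
apply/eqP/prodf_eq0; exists i => //; apply/eqP.
have n0 : 0 <= n.+1%:R :> R by [].
case/orP: xi; rewrite -leNgt => xi.
  by rewrite flat_eq0 ?mul0r// mulr_ge0_le0// subr_le0.
by rewrite [flat (_ * (b i - _))]flat_eq0 ?mulr0// mulr_ge0_le0// subr_le0.
Qed.

Lemma bump_in a b x : obox a b x -> bump a b n x @[n --> \oo] --> (1 : R).
Proof.
move=> xab; rewrite (_ : 1 = \prod_(i < N) (1 * 1)); last first.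
  by rewrite big1// => i _; rewrite mul1r.
apply: cvg_big; first exact: mul_continuous.
move=> i _; have /andP[axi xbi] := xab i.
by apply: cvgM; apply: flat_cvg; rewrite subr_gt0.
Qed.

Lemma bump_test a b n : test_function (bump a b n).
Proof.
split; first exact: smooth_bump.
have cc := @compact_cbox a b.
apply: (subclosed_compact _ cc); first exact: closed_closure.
rewrite closureE => x; apply; split; first exact: rV_compact_closed.
move=> y /= y0; have : obox a b y by apply: contrapT => /(bump_out n); apply/eqP.
by move=> yab i; have /andP[y1 y2] := yab i; rewrite !ltW.
Qed.

(** The bumps are test functions with values in [[0, 1]] that converge to the indicator of the open
    box, and [|g|] is an integrable majorant on the closed box, which is compact. *)
Lemma integral_obox_eq0 (g : 'rV[R]_N -> R) a b : loc_integrable g ->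
  (forall psi, test_function psi -> \int[leb]_x (g x * psi x) = 0) ->
  (\int[leb]_(x in obox a b) (g x)%:E = 0)%E.
Proof.
move=> lg g0; have ig : leb.-integrable (cbox a b) (EFin \o g) by exact/lg/compact_cbox.
have mc : measurable (cbox a b) by apply: rV_compact_measurable; exact: compact_cbox.
have mo := measurable_obox a b.
have oc : obox a b `<=` cbox a b.
  by move=> y yab i; have /andP[y1 y2] := yab i; rewrite !ltW.
have mg := measurable_int _ ig.
have mgb n : measurable_fun (cbox a b) (fun x => (g x * bump a b n x)%:E).
  apply/measurable_EFinP; apply: measurable_funM; first exact/measurable_EFinP.
  apply: measurable_funTS; apply: rV_continuous_measurable; apply: smooth_continuous.
  exact: smooth_bump.
have ib n : leb.-integrable (cbox a b) (fun x => (g x * bump a b n x)%:E).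
  apply: (le_integrable mc (mgb n) _ ig) => x _ /=; rewrite lee_fin normrM ler_piMr//.
  by rewrite ger0_norm ?bump_ge0// bump_le1.
have int0 n : (\int[leb]_(x in cbox a b) (g x * bump a b n x)%:E = 0)%E.
  have cE : (\int[leb]_(x in cbox a b) (g x * bump a b n x)%:E =
      \int[leb]_x (g x * bump a b n x)%:E)%E.
    rewrite integral_mkcond; apply: eq_integral => x _; rewrite patchE.
    case: ifPn => // /negP; rewrite inE => nx.
    by rewrite bump_out ?mulr0// => /oc.
  (* The hypothesis concerns a real-valued integral, which is 0 also when the extended one is
     infinite; integrability rules this out. *)
  rewrite -[LHS]fineK; last by apply: integrable_fin_num => //; exact: ib.
  by rewrite cE; congr EFin; exact: g0 (bump_test a b n).
have [||||ii _ cv] := @dominated_convergence _ _ _ leb (cbox a b) mc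
  (fun n x => (g x * bump a b n x)%:E) ((EFin \o g) \_ (obox a b)) (abse \o (EFin \o g)) mgb.
- apply/measurable_restrict => //.
  by rewrite setIC (setIidl oc); exact: measurable_funS mg.
- apply: aeW => x _; rewrite patchE; case: ifPn => [|/negP]; rewrite inE => xab.
    apply: cvg_EFin; first exact: nearW.
    rewrite -[X in _ --> X]mulr1; apply: cvgMl_tmp; exact: bump_in.
  by apply: cvg_near_cst; apply: nearW => n; rewrite bump_out// mulr0.
- exact: integrable_abse.
- apply: aeW => x n _ /=; rewrite lee_fin normrM ler_piMr//.
  by rewrite ger0_norm ?bump_ge0// bump_le1.
have cv0 : (\int[leb]_(x in cbox a b) ((EFin \o g) \_ (obox a b)) x = 0)%E.
  apply: (cvg_unique _ cv) => //; apply: cvg_near_cst; apply: nearW => n; exact: int0.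

by rewrite -integral_mkcondr (setIidr oc) in cv0.
Qed.

(** The measurable sets on which [g] integrates to 0 form a Dynkin system that contains the boxes,
    hence contain everything. Intersecting with a cube keeps [g] integrable; the cubes then exhaust
    the space. *)
Lemma integral_eq0_ae (g : 'rV[R]_N -> R) : loc_integrable g ->
  (forall psi, test_function psi -> \int[leb]_x (g x * psi x) = 0) ->
  {ae leb, forall x, g x = 0}.
Proof.
move=> lg g0.
have mQ n := measurable_cube (0 : 'rV[R]_N) n%:R.
have iQ n : leb.-integrable (cube 0 n%:R) (EFin \o g).
  have [K cK QK] : exists2 K, compact K & cube (0 : 'rV[R]_N) n%:R `<=` K.
    exists (cbox (fun i => - n%:R) (fun=> n%:R)); first exact: compact_cbox.
    by rewrite cube_obox => y yab i; have /andP[] := yab i; rewrite !mxE !add0r => /ltW-> /ltW->.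
  by apply: integrableS QK (lg _ cK) => //; exact: rV_compact_measurable.
have iA n A : measurable A -> (\int[leb]_(x in cube 0 n%:R `&` A) (g x)%:E = 0)%E.
  rewrite [X in X -> _](_ : _ = <<s oboxes >> A); last by rewrite -measurable_oboxes.
  have iI B : measurable B -> leb.-integrable (cube 0 n%:R `&` B) (EFin \o g).
    by move=> mB; apply: integrableS (iQ n) => //; exact: measurableI.
  have ob a b : (\int[leb]_(x in obox a b) (g x)%:E = 0)%E by exact: integral_obox_eq0.
  apply: (@dynkin_induction _ _ oboxes (fun A => (\int[leb]_(x in cube 0 n%:R `&` A) (g x)%:E = 0)%E)).
  - exact: measurable_oboxes.
  - by move=> _ _ [a [b ->]] [c [d ->]]; rewrite setI_obox; do 2 eexists.
  - by rewrite setIT cube_obox.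
  - by move=> _ [a [b ->]]; rewrite /= cube_obox setI_obox.
  - move=> S mS S0.
    have := @integral_setU _ _ _ leb (cube 0 n%:R `&` S) (cube 0 n%:R `&` ~` S) (EFin \o g).
    rewrite -setIUr setUv setIT S0 add0e => <-.
    + by rewrite cube_obox.
    + exact: measurableI.
    + by apply: measurableI => //; exact: measurableC.
    + exact: measurable_int (iQ n).
    + by apply/disj_setPS => y [[_ Sy] [_ /= nSy]].
  - move=> F mF tF F0; rewrite setI_bigcupr integral_bigcup.
    + by rewrite eseries0// => k _ _; exact: F0.
    + exact: trivIset_setIl.
    + by move=> k; exact: measurableI.
    + by rewrite -setI_bigcupr; apply: iI; exact: bigcupT_measurable.
have aeQ n : ae_eq leb (cube 0 n%:R) (EFin \o g) (cst 0%E).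
  apply: integral_ae_eq => //.
  move=> E EQ mE; have := iA n E mE; rewrite setIidr// => E0.
  by rewrite integral0.
have : {ae leb, forall x (n : nat), cube 0 n%:R x -> (EFin \o g) x = cst 0%E x}.
  exact/ae_foralln.
apply: filterS => x xn; apply/EFin_inj; apply: (xn (Num.truncn `|x|).+1) => i.
rewrite mxE subr0; apply: le_lt_trans (truncnS_gt _); exact: rV_norm_coord.
Qed.

End boxes.

(** * Convergence in mean *)

Section null_sequences.
Context {R : realType}.
Implicit Types (a b : nat -> \bar R).
Local Open Scope ereal_scope.

Lemma cvge0P a : (forall n, 0 <= a n) ->
  (a @ \oo --> 0) <-> (forall e : R, (0 < e)%R -> \forall n \near \oo, a n <= e%:E).
Proof.
move=> a0; split=> [a0c e e0|H].
  move/fine_cvgP : a0c => [afin /cvgrPdist_le/(_ e e0)] ae.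
  near=> n; rewrite -[a n]fineK; last by near: n.
  have : (`|0 - fine (a n)| <= e)%R by near: n.
  by rewrite sub0r normrN ger0_norm ?fine_ge0.
have an : \forall n \near \oo, a n \is a fin_num.
  have := H _ ltr01; apply: filterS => n an1.
  by rewrite ge0_fin_numE//; exact: le_lt_trans an1 (ltry _).
apply/fine_cvgP; split => //; apply/cvgr0Pnorm_le => e e0.
near=> n; have afin : a n \is a fin_num by near: n.
rewrite /= ger0_norm ?fine_ge0// -lee_fin fineK//; near: n; exact: H.
Unshelve. all: by end_near. Qed.

Lemma cvge0_le a b : (forall n, 0 <= a n) -> (\forall n \near \oo, a n <= b n) ->
  b @ \oo --> 0 -> a @ \oo --> 0.
Proof.
move=> a0 ab; apply: squeeze_cvge; last exact: cvg_cst.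
by near=> n; rewrite a0/=; near: n.
Unshelve. all: by end_near. Qed.

Lemma cvge0D a b : a @ \oo --> 0 -> b @ \oo --> 0 -> (a n + b n) @[n --> \oo] --> 0.
Proof. by move=> a0 b0; rewrite -[X in _ --> X]adde0; apply: cvgeD. Qed.

Lemma cvge0Z (k : R) a : a @ \oo --> 0 -> (k%:E * a n) @[n --> \oo] --> 0.
Proof. by move=> a0; rewrite -(mule0 k%:E); apply: cvgeZl. Qed.

Lemma cvge0_sum (I : Type) (r : seq I) (a : I -> nat -> \bar R) :
  (forall i, a i @ \oo --> 0) -> (\sum_(i <- r) a i n) @[n --> \oo] --> 0.
Proof.
move=> a0; elim: r => [|i r IH].
  by apply: cvg_near_cst; apply: nearW => n; rewrite big_nil.
under eq_cvg do rewrite big_cons.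
exact: cvge0D.
Qed.

End null_sequences.

Section mean_convergence.
Context d (T : measurableType d) (R : realType).
Variables (mu : {measure set T -> \bar R}) (D : set T) (mD : measurable D).
Local Open Scope ereal_scope.
Implicit Types (f g : T -> R) (F G : nat -> T -> R).

Lemma integral_sqrD_le f g : measurable_fun D f -> measurable_fun D g ->
  \int[mu]_(x in D) ((f x + g x) ^+ 2)%:E <=
  2%:E * (\int[mu]_(x in D) (f x ^+ 2)%:E) + 2%:E * \int[mu]_(x in D) (g x ^+ 2)%:E.
Proof.
move=> mf mg.
have mf2 : measurable_fun D (fun x => (f x ^+ 2)%:E).
  by apply/measurable_EFinP; exact: measurable_funX.
have mg2 : measurable_fun D (fun x => (g x ^+ 2)%:E).
  by apply/measurable_EFinP; exact: measurable_funX.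
rewrite -!ge0_integralZl//; try by move=> x _; rewrite lee_fin sqr_ge0.
rewrite -ge0_integralD//; last 4 first.
- by move=> x _; rewrite mule_ge0// lee_fin sqr_ge0.
- exact: measurable_funeM.
- by move=> x _; rewrite mule_ge0// lee_fin sqr_ge0.
- exact: measurable_funeM.
apply: ge0_le_integral => //.
- by move=> x _; rewrite lee_fin sqr_ge0.
- by apply/measurable_EFinP/measurable_funX; exact: measurable_funD.
- by apply: emeasurable_funD; exact: measurable_funeM.
- move=> x _; rewrite -!EFinM -EFinD lee_fin.
  have := sqr_ge0 (f x - g x)%R; nra.
Qed.

(** A weighted Young inequality, the expansion of [(|f| - e |g|)^2 >= 0]. It takes the place of
    Cauchy-Schwarz and involves no root of an extended real; the weight is fixed by each
    application. *)
Lemma integral_mul_le f g (e : R) : (0 < e)%R -> measurable_fun D f -> measurable_fun D g ->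
  \int[mu]_(x in D) `|f x * g x|%:E <=
  e^-1%:E * (\int[mu]_(x in D) (f x ^+ 2)%:E) + e%:E * \int[mu]_(x in D) (g x ^+ 2)%:E.
Proof.
move=> e0 mf mg.
have mf2 : measurable_fun D (fun x => (f x ^+ 2)%:E).
  by apply/measurable_EFinP; exact: measurable_funX.
have mg2 : measurable_fun D (fun x => (g x ^+ 2)%:E).
  by apply/measurable_EFinP; exact: measurable_funX.
have ei0 : (0 <= e^-1)%R by rewrite invr_ge0 ltW.
rewrite -!ge0_integralZl//; try (by move=> x _; rewrite lee_fin sqr_ge0);
  try (by rewrite lee_fin ?ltW).
rewrite -ge0_integralD//; last 4 first.
- by move=> x _; rewrite mule_ge0// lee_fin ?sqr_ge0.
- exact: measurable_funeM.
- by move=> x _; rewrite mule_ge0// lee_fin ?sqr_ge0// ltW.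
- exact: measurable_funeM.
apply: ge0_le_integral => //.
- by apply/measurable_EFinP; apply: measurableT_comp => //; exact: measurable_funM.
- by apply: emeasurable_funD; exact: measurable_funeM.
- move=> x _; rewrite -!EFinM -EFinD lee_fin normrM.
  have e1 : (e^-1 * e = 1)%R by rewrite mulVf// gt_eqF.
  rewrite -(real_normK (num_real (f x))) -(real_normK (num_real (g x))).
  have h : (0 <= e^-1 * (`|f x| - e * `|g x|) ^+ 2)%R by rewrite mulr_ge0// sqr_ge0.
  have hE : (e^-1 * (`|f x| - e * `|g x|) ^+ 2 =
      e^-1 * `|f x| ^+ 2 + e * `|g x| ^+ 2 - 2 * (`|f x| * `|g x|))%R.
    by field; rewrite gt_eqF.
  have : (0 <= `|f x| * `|g x|)%R by [].
  move: h; rewrite hE; lra.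
Qed.

Lemma cvg_integral_mul F G (M : R) :
  (forall n, measurable_fun D (F n)) -> (forall n, measurable_fun D (G n)) ->
  \int[mu]_(x in D) (F n x ^+ 2)%:E @[n --> \oo] --> 0 ->
  (\forall n \near \oo, \int[mu]_(x in D) (G n x ^+ 2)%:E <= M%:E) ->
  \int[mu]_(x in D) `|F n x * G n x|%:E @[n --> \oo] --> 0.
Proof.
move=> mF mG F0 GM.
have {}F0 : forall e : R, (0 < e)%R ->
    \forall n \near \oo, \int[mu]_(x in D) (F n x ^+ 2)%:E <= e%:E.
  by apply/cvge0P => // n; apply: integral_ge0 => x _; rewrite lee_fin sqr_ge0.
apply/cvge0P => [n|e e0]; first by apply: integral_ge0 => x _; rewrite lee_fin.
pose M1 := (`|M| + 1)%R; have M10 : (0 < M1)%R by rewrite /M1 ltr_wpDl.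
(* With this weight the part with [G n] is at most [e / 2]; the part with [F n] falls below [e / 2]
   for large [n]. *)
pose k := (e / 2 / M1)%R; have k0 : (0 < k)%R by rewrite /k !divr_gt0.
near=> n; apply: (le_trans (integral_mul_le k0 (mF n) (mG n))).
rewrite [e]splitr EFinD; apply: leeD.
  rewrite -lee_pdivlMl ?invr_gt0// invrK -EFinM; near: n; apply: F0.
  by rewrite mulr_gt0// divr_gt0.
have : \int[mu]_(x in D) (G n x ^+ 2)%:E <= M1%:E.
  apply: (@le_trans _ _ M%:E); first by near: n.
  by rewrite lee_fin /M1 (le_trans (ler_norm M))// lerDl.
rewrite -(@lee_pmul2l _ k%:E) ?lte_fin// => /le_trans; apply.
by rewrite -EFinM lee_fin /k mulfVK ?gt_eqF.
Unshelve. all: by end_near. Qed.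

(** Write [m_n F_n - m_0 f = m_n (F_n - f) + (m_n - m_0) f]: the bound [C] handles the first term
    and dominated convergence the second. *)
Lemma cvg_integral_bounded_mul (m : nat -> T -> R) (m0 : T -> R) F f (C : R) :
  (forall n, measurable_fun D (m n)) -> measurable_fun D m0 ->
  (forall n, measurable_fun D (F n)) -> mu.-integrable D (EFin \o f) ->
  (forall n x, `|m n x| <= C)%R -> (forall x, `|m0 x| <= C)%R ->
  {ae mu, forall x, D x -> m n x @[n --> \oo] --> m0 x} ->
  \int[mu]_(x in D) `|F n x - f x|%:E @[n --> \oo] --> 0 ->
  \int[mu]_(x in D) `|m n x * F n x - m0 x * f x|%:E @[n --> \oo] --> 0.
Proof.
move=> mm mm0 mF iF mC m0C mcv Fcv.
have mf : measurable_fun D f by apply/measurable_EFinP; exact: measurable_int iF.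
have C0 : (0 <= C)%R by apply: le_trans (m0C point).
have mFf n : measurable_fun D (fun x => `|F n x - f x|%:E).
  by apply/measurable_EFinP; apply: measurableT_comp => //; exact: measurable_funB.
have mmf n : measurable_fun D (fun x => (m n x * f x)%:E).
  by apply/measurable_EFinP; exact: measurable_funM.
have mm0f : measurable_fun D (fun x => (m0 x * f x)%:E).
  by apply/measurable_EFinP; exact: measurable_funM.
have [|||_ cv _] := @dominated_convergence _ _ _ mu D mD
    (fun n x => (m n x * f x)%:E) (fun x => (m0 x * f x)%:E)
    (fun x => C%:E * `|(f x)%:E|) mmf mm0f.
- apply: filterS mcv => x mx Dx; apply: cvg_EFin; first exact: nearW.
  by apply: cvgM; [exact: mx|exact: cvg_cst].
- by apply: integrableZl => //; exact: integrable_abse iF.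
- by apply: aeW => x n _; rewrite /= -EFinM lee_fin normrM ler_wpM2r.
apply: (@cvge0_le _ _ (fun n => C%:E * (\int[mu]_(x in D) `|F n x - f x|%:E) +
    \int[mu]_(x in D) `|(m n x * f x)%:E - (m0 x * f x)%:E|)).
- by move=> n; apply: integral_ge0 => x _; rewrite lee_fin.
- apply: nearW => n; rewrite -ge0_integralZl//.
  have mB : measurable_fun D (fun x => `|(m n x * f x)%:E - (m0 x * f x)%:E|).
    by apply: measurableT_comp => //; exact: emeasurable_funB.
  rewrite -ge0_integralD//; last first.
  + exact: measurable_funeM.
  + by move=> x _; rewrite mule_ge0// lee_fin.
  apply: ge0_le_integral => //.
  + apply/measurable_EFinP; apply: measurableT_comp => //.
    by apply: measurable_funB; exact: measurable_funM.
  + by apply: emeasurable_funD => //; exact: measurable_funeM.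
  + move=> x _; rewrite -EFinB/= -EFinM -EFinD lee_fin.
    rewrite (_ : _ - _ = m n x * (F n x - f x) + (m n x * f x - m0 x * f x))%R; last by ring.
    apply: le_trans (ler_normD _ _) _; rewrite lerD2r normrM ler_wpM2r//.
- by apply: cvge0D; [exact: cvge0Z|exact: cv].
Qed.

Lemma cvg_integral_absD F G : (forall n, measurable_fun D (F n)) ->
  (forall n, measurable_fun D (G n)) ->
  \int[mu]_(x in D) `|F n x|%:E @[n --> \oo] --> 0 ->
  \int[mu]_(x in D) `|G n x|%:E @[n --> \oo] --> 0 ->
  \int[mu]_(x in D) `|F n x + G n x|%:E @[n --> \oo] --> 0.
Proof.
move=> mF mG F0 G0; apply: cvge0_le (cvge0D F0 G0).
  by move=> n; apply: integral_ge0 => x _; rewrite lee_fin.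
apply: nearW => n.
have m1 : measurable_fun D (fun x => `|F n x|%:E).
  by apply/measurable_EFinP; exact: measurableT_comp.
have m2 : measurable_fun D (fun x => `|G n x|%:E).
  by apply/measurable_EFinP; exact: measurableT_comp.
rewrite -ge0_integralD//; apply: ge0_le_integral => //.
- apply/measurable_EFinP; apply: measurableT_comp => //.
  exact: measurable_funD.
- exact: emeasurable_funD.
- by move=> x _; rewrite -EFinD lee_fin ler_normD.
Qed.

Lemma cvg_integral_meanD F G f g : (forall n, measurable_fun D (F n)) ->
  (forall n, measurable_fun D (G n)) -> measurable_fun D f -> measurable_fun D g ->
  \int[mu]_(x in D) `|F n x - f x|%:E @[n --> \oo] --> 0 ->
  \int[mu]_(x in D) `|G n x - g x|%:E @[n --> \oo] --> 0 ->
  \int[mu]_(x in D) `|(F n x + G n x) - (f x + g x)|%:E @[n --> \oo] --> 0.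
Proof.
move=> mF mG mf mg F0 G0.
have E n x : ((F n x + G n x) - (f x + g x) = (F n x - f x) + (G n x - g x))%R by ring.
under eq_cvg do under eq_integral do rewrite E.
apply: (@cvg_integral_absD (fun n x => F n x - f x)%R
    (fun n x => G n x - g x)%R) => // n; exact: measurable_funB.
Qed.

(** The difference of products is [(F - f)(G - g) + (F - f) g + (G - g) f]; in each product one
    factor tends to 0 in L^2 and the other stays bounded there. *)
Lemma cvg_integral_sqr_mul F G f g : (forall n, measurable_fun D (F n)) ->
  (forall n, measurable_fun D (G n)) -> measurable_fun D f -> measurable_fun D g ->
  \int[mu]_(x in D) (f x ^+ 2)%:E < +oo -> \int[mu]_(x in D) (g x ^+ 2)%:E < +oo ->
  \int[mu]_(x in D) ((F n x - f x) ^+ 2)%:E @[n --> \oo] --> 0 ->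
  \int[mu]_(x in D) ((G n x - g x) ^+ 2)%:E @[n --> \oo] --> 0 ->
  \int[mu]_(x in D) `|F n x * G n x - f x * g x|%:E @[n --> \oo] --> 0.
Proof.
move=> mF mG mf mg f2 g2 F0 G0.
have {}f2 : \int[mu]_(x in D) (f x ^+ 2)%:E <= (fine (\int[mu]_(x in D) (f x ^+ 2)%:E))%:E.
  by rewrite fineK// ge0_fin_numE//; apply: integral_ge0 => x _; rewrite lee_fin sqr_ge0.
have {}g2 : \int[mu]_(x in D) (g x ^+ 2)%:E <= (fine (\int[mu]_(x in D) (g x ^+ 2)%:E))%:E.
  by rewrite fineK// ge0_fin_numE//; apply: integral_ge0 => x _; rewrite lee_fin sqr_ge0.
have mFf n : measurable_fun D (fun x => F n x - f x)%R by exact: measurable_funB.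
have mGg n : measurable_fun D (fun x => G n x - g x)%R by exact: measurable_funB.
have G1 : \forall n \near \oo, \int[mu]_(x in D) ((G n x - g x) ^+ 2)%:E <= 1%:E.
  by apply: ((cvge0P _).1 G0) => // n; apply: integral_ge0 => x _; rewrite lee_fin sqr_ge0.
have c1 := @cvg_integral_mul (fun n x => F n x - f x)%R (fun n x => G n x - g x)%R _ mFf mGg F0 G1.
have c2 := @cvg_integral_mul (fun n x => F n x - f x)%R (fun n => g) _ mFf (fun=> mg) F0 (nearW _ (fun=> g2)).
have c3 := @cvg_integral_mul (fun n x => G n x - g x)%R (fun n => f) _ mGg (fun=> mf) G0 (nearW _ (fun=> f2)).
have mFG n : measurable_fun D (fun x => (F n x - f x) * (G n x - g x))%R by exact: measurable_funM.
have mFg n : measurable_fun D (fun x => (F n x - f x) * g x)%R by exact: measurable_funM.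
have mGf n : measurable_fun D (fun x => (G n x - g x) * f x)%R by exact: measurable_funM.
have c12 := cvg_integral_absD mFG mFg c1 (c2 _).
have := cvg_integral_absD (fun n => measurable_funD (mFG n) (mFg n)) mGf (c12 _) (c3 _).
have E n x : (F n x * G n x - f x * g x = (F n x - f x) * (G n x - g x) +
    (F n x - f x) * g x + (G n x - g x) * f x)%R by ring.
under [X in _ -> X]eq_cvg do under eq_integral do rewrite E.
by apply.
Qed.

Lemma cvg_Rintegral_mean F f :
  (forall n, mu.-integrable D (EFin \o F n)) -> mu.-integrable D (EFin \o f) ->
  \int[mu]_(x in D) `|F n x - f x|%:E @[n --> \oo] --> 0 ->
  (Rintegral mu D (F n) @[n --> \oo] --> Rintegral mu D f)%R.
Proof.
move=> iF iF0 cv; apply/cvgrPdist_le => e e0.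
have {}cv : forall e : R, (0 < e)%R ->
    \forall n \near \oo, \int[mu]_(x in D) `|F n x - f x|%:E <= e%:E.
  by apply/cvge0P => // n; apply: integral_ge0 => x _; rewrite lee_fin.
near=> n; rewrite distrC -RintegralB//.
have iB : mu.-integrable D (EFin \o (fun x => F n x - f x)%R).
  by apply: eq_integrable (integrableB mD (iF n) iF0).
apply: le_trans (le_normr_Rintegral mD iB) _.
rewrite -lee_fin /Rintegral fineK.
  by near: n; exact: cv.
by apply: integrable_fin_num => //; exact: integrable_norm.
Unshelve. all: by end_near. Qed.

End mean_convergence.

(** * Weak derivatives and the chain rule in H^1 *)

Section local_integrability.
Context {R : realType} {N : nat}.
Local Notation leb := (lebesgue_rV N).
Implicit Types (u w g h : 'rV[R]_N -> R) (K : set 'rV[R]_N).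

Lemma loc_integrable_measurable u : loc_integrable u -> measurable_fun setT u.
Proof.
move=> lu; rewrite (_ : setT = \bigcup_k (cbox (fun=> - k%:R) (fun=> k%:R) : set 'rV[R]_N)).
  apply/measurable_fun_bigcup => k.
    by apply: rV_compact_measurable; exact: compact_cbox.
  by apply/measurable_EFinP; apply: measurable_int (lu _ _); exact: compact_cbox.
apply/esym; rewrite -subTset => x _; exists (Num.truncn `|x|).+1 => // i.
rewrite -ler_norml; apply: le_trans (rV_norm_coord _ _) _.
exact/ltW/truncnS_gt.
Qed.

Lemma loc_integrable_dom u w : measurable_fun setT u -> loc_integrable w ->
  (forall x, `|u x| <= `|w x|) -> loc_integrable u.
Proof.
move=> mu lw uw K cK; have mK := rV_compact_measurable cK.
apply: (le_integrable mK _ _ (lw K cK)).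
  by apply/measurable_EFinP; exact: measurable_funTS.
by move=> x _ /=; rewrite lee_fin.
Qed.

Lemma loc_integrable_bounded u (C : R) : measurable_fun setT u ->
  (forall x, `|u x| <= C) -> loc_integrable u.
Proof.
move=> mu uC K cK; apply: measurable_bounded_integrable.
- exact: rV_compact_measurable.
- exact: leb_compact_lty.
- exact: measurable_funTS.
- by exists C; split; [exact: num_real|move=> M CM x _ /=; exact: le_trans (uC x) (ltW CM)].
Qed.

Lemma loc_integrableD u w :
  loc_integrable u -> loc_integrable w -> loc_integrable (u \+ w).
Proof.
move=> lu lw K cK; have mK := rV_compact_measurable cK.
by apply: eq_integrable (integrableD mK (lu K cK) (lw K cK)).
Qed.

Lemma loc_integrableZ u (a : R) : loc_integrable u -> loc_integrable (fun x => a * u x).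
Proof.
move=> lu K cK; have mK := rV_compact_measurable cK.
by apply: eq_integrable (integrableZl mK a (lu K cK)).
Qed.

Lemma loc_integrableB u w :
  loc_integrable u -> loc_integrable w -> loc_integrable (u \- w).
Proof.
move=> lu lw K cK; have mK := rV_compact_measurable cK.
by apply: eq_integrable (integrableB mK (lu K cK) (lw K cK)).
Qed.

Lemma loc_integrableM u (m : 'rV[R]_N -> R) C : measurable_fun setT m ->
  (forall x, `|m x| <= C) -> loc_integrable u -> loc_integrable (m \* u).
Proof.
move=> mm mC lu; have C0 : 0 <= C by apply: le_trans (mC 0).
apply: (@loc_integrable_dom _ (fun x => C * u x)).
- by apply: measurable_funM => //; exact: loc_integrable_measurable.
- exact: loc_integrableZ.
- by move=> x /=; rewrite !normrM (ger0_norm C0) ler_wpM2r.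
Qed.

Lemma integrable_L2M u w : measurable_fun setT u -> measurable_fun setT w ->
  (\int[leb]_x (u x ^+ 2)%:E < +oo)%E -> (\int[leb]_x (w x ^+ 2)%:E < +oo)%E ->
  leb.-integrable setT (EFin \o (u \* w)).
Proof.
move=> mu mw u2 w2; apply/integrableP; split.
  by apply/measurable_EFinP; exact: measurable_funM.
apply: le_lt_trans (integral_mul_le _ measurableT ltr01 mu mw) _.
by rewrite invr1 !mul1e lte_add_pinfty.
Qed.

Lemma integrable_loc u : leb.-integrable setT (EFin \o u) -> loc_integrable u.
Proof.
move=> iu K cK; apply: integrableS iu => //; exact: rV_compact_measurable.
Qed.

Lemma loc_integrable_sqr u : measurable_fun setT u ->
  (\int[leb]_x (u x ^+ 2)%:E < +oo)%E -> loc_integrable u.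
Proof.
move=> mu u2.
have iu2 : leb.-integrable setT (EFin \o (u \* u)) by exact: integrable_L2M.
apply: (@loc_integrable_dom _ (fun x => 1 + u x * u x)) => //.
  apply: (loc_integrableD _ (integrable_loc iu2)).
  by apply: (@loc_integrable_bounded _ 1) => // x; rewrite normr1.
move=> x; rewrite [leRHS]ger0_norm; last by rewrite addr_ge0// -expr2 sqr_ge0.
rewrite -expr2 -(real_normK (num_real (u x))).
have := sqr_ge0 (`|u x| - 1); nra.
Qed.

Lemma test_function_bounded u : test_function u -> exists2 C : R, 0 <= C & forall x, `|u x| <= C.
Proof.
move=> [su cu]; have [n Kn] := compact_sub_cube cu.
apply: (@continuous_cube_bounded _ _ _ n.+1%:R) => //; first exact: smooth_continuous.
move=> x nx; apply/eqP; apply: contra_notT nx => ux.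
by apply: Kn; exact: subset_closure.
Qed.

Lemma test_function_measurable u : test_function u -> measurable_fun setT u.
Proof. by move=> [su _]; apply: rV_continuous_measurable; exact: smooth_continuous. Qed.

Lemma test_function_integrable u : test_function u -> leb.-integrable setT (EFin \o u).
Proof.
move=> tu; have [C C0 uC] := test_function_bounded tu.
have [n Kn] := compact_sub_cube tu.2.
apply: (bounded_cube_integrable (test_function_measurable tu) uC (n := n.+1%:R)) => //.
move=> x nx; apply/eqP; apply: contra_notT nx => ux.
by apply: Kn; exact: subset_closure.
Qed.

Lemma test_function_L2 u : test_function u -> (\int[leb]_x (u x ^+ 2)%:E < +oo)%E.
Proof.
move=> tu; have /integrableP[_] := test_function_integrable (test_functionM tu tu.1).
apply: le_lt_trans; rewrite le_eqVlt; apply/orP; left; apply/eqP.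
by apply: eq_integral => x _ /=; rewrite expr2 ger0_norm// -expr2 sqr_ge0.
Qed.

Lemma test_function_loc u : test_function u -> loc_integrable u.
Proof. by move=> tu; apply: integrable_loc; exact: test_function_integrable. Qed.

Lemma integrable_mul_test u psi : loc_integrable u -> test_function psi ->
  leb.-integrable setT (EFin \o (u \* psi)).
Proof.
move=> lu tp; pose K := closure [set x | psi x != 0].
have mK : measurable K by apply: rV_compact_measurable; exact: tp.2.
have [C C0 pC] := test_function_bounded tp.
have -> : EFin \o (u \* psi) = (EFin \o (u \* psi)) \_ K.
  apply/funext => x; rewrite patchE; case: ifPn => // /negP; rewrite inE => nx.
  rewrite /= (_ : psi x = 0) ?mulr0//; apply/eqP.
  by apply: contra_notT nx => ux; exact: subset_closure.
apply: (integrable_mkcond _ mK).1.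
have := loc_integrableM (test_function_measurable tp) pC lu tp.2.
by apply: eq_integrable => // x _; rewrite /= mulrC.
Qed.

(** The factors are swapped to make the test function the bounded multiplier in
    [cvg_integral_bounded_mul]. *)
Lemma Rintegral_mul_test K u psi : compact K -> (forall x, ~ K x -> psi x = 0) ->
  \int[leb]_x (u x * psi x) = \int[leb]_(x in K) (psi x * u x).
Proof.
move=> cK psi0; rewrite [RHS]Rintegral_mkcond; apply: eq_Rintegral => x _.
rewrite patchE; case: ifPn => [_|/negP]; first by rewrite mulrC.
by rewrite inE => /psi0 ->; rewrite mulr0.
Qed.

End local_integrability.

(** * Weak derivatives: uniqueness and passage to the limit *)

Section weak_partials.
Context {R : realType} {N : nat}.
Local Notation leb := (lebesgue_rV N).
Implicit Types (u w g h : 'rV[R]_N -> R) (K : set 'rV[R]_N) (i : 'I_N).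

Lemma Rintegral_partial_eq0 i u : test_function u -> \int[leb]_x partial i u x = 0.
Proof.
move=> tu; have [n Kn] := compact_sub_cube tu.2.
rewrite /Rintegral (@integral_partial_eq0 _ _ _ _ n.+1%:R)//.
- exact/smooth_continuous/tu.1.
- exact/smooth_continuous/(test_function_partial i tu).1.
- by move=> x; apply: diff_derivable; exact/smooth_differentiable/tu.1.
- move=> x nx; apply/eqP; apply: contra_notT nx => ux.
  by apply: Kn; exact: subset_closure.
- by move=> x nx; apply: partial_out => /Kn.
Qed.

(** Integration by parts: the derivative of the test function [u psi] integrates to 0. *)
Lemma test_weak_partial i u : test_function u -> is_weak_partial i u (partial i u).
Proof.
move=> tu; have tdu := test_function_partial i tu.
split; [exact: test_function_loc|exact: test_function_loc|move=> psi tp].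
have tdp := test_function_partial i tp.
have := Rintegral_partial_eq0 i (test_functionM tu tp.1).
rewrite (_ : (fun x => partial i (u \* psi) x) = fun x => u x * partial i psi x + partial i u x * psi x).
  rewrite RintegralD//; first by move/eqP; rewrite addr_eq0 => /eqP.
  - exact: integrable_mul_test (test_function_loc tu) tdp.
  - exact: integrable_mul_test (test_function_loc tdu) tp.
apply/funext => x; rewrite partialM; [|exact/smooth_differentiable/tu.1|exact/smooth_differentiable/tp.1].
by rewrite [psi x * _]mulrC.
Qed.

Lemma is_weak_partialD i u w g h : is_weak_partial i u g -> is_weak_partial i w h ->
  is_weak_partial i (u \+ w) (g \+ h).
Proof.
move=> [lu lg ug] [lw lh wh]; split; [exact: loc_integrableD..|move=> psi tp].
have tdp := test_function_partial i tp.
under eq_Rintegral do rewrite /= mulrDl.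
rewrite RintegralD//; [|exact: integrable_mul_test lu tdp|exact: integrable_mul_test lw tdp].
under [in RHS]eq_Rintegral do rewrite /= mulrDl.
rewrite RintegralD//; [|exact: integrable_mul_test lg tp|exact: integrable_mul_test lh tp].
by rewrite ug// wh// opprD.
Qed.

Lemma is_weak_partialB i u w g h : is_weak_partial i u g -> is_weak_partial i w h ->
  is_weak_partial i (u \- w) (g \- h).
Proof.
move=> [lu lg ug] [lw lh wh]; split; [exact: loc_integrableB..|move=> psi tp].
have tdp := test_function_partial i tp.
under eq_Rintegral do rewrite /= mulrBl.
rewrite RintegralB//; [|exact: integrable_mul_test lu tdp|exact: integrable_mul_test lw tdp].
under [in RHS]eq_Rintegral do rewrite /= mulrBl.
rewrite RintegralB//; [|exact: integrable_mul_test lg tp|exact: integrable_mul_test lh tp].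
by rewrite ug// wh// opprB opprK addrC.
Qed.

(** The difference [g - h] is a weak derivative of [u - u = 0], hence orthogonal to every test
    function. *)
Lemma weak_partial_unique i u g h : is_weak_partial i u g -> is_weak_partial i u h ->
  {ae leb, forall x, g x = h x}.
Proof.
move=> ug uh; have [_ lgh gh] := is_weak_partialB ug uh.
have : {ae leb, forall x, (g \- h) x = 0}.
  apply: integral_eq0_ae => // psi tp; apply/eqP; rewrite -oppr_eq0 -gh//.
  rewrite (_ : (fun x => _) = cst 0); first by rewrite /Rintegral integral0.
  by apply/funext => x; rewrite /= subrr mul0r.
by apply: filterS => x /= /eqP; rewrite subr_eq0 => /eqP.
Qed.

Lemma weak_partialP i u g : is_weak_partial i u g -> is_weak_partial i u (weak_partial i u).
Proof. by move=> ug; rewrite /weak_partial; apply: (xgetPex (fun=> 0)); exists g. Qed.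

Lemma weak_partial_ae i u g : is_weak_partial i u g ->
  {ae leb, forall x, weak_partial i u x = g x}.
Proof. by move=> ug; apply: weak_partial_unique (weak_partialP ug) ug. Qed.

(** Both sides of the defining identity integrate a bounded function over the compact support of
    [psi], so they are continuous for local convergence in L^1. *)
Lemma is_weak_partial_cvg i (u_ g_ : nat -> 'rV[R]_N -> R) u g :
  (forall n, is_weak_partial i (u_ n) (g_ n)) -> loc_integrable u -> loc_integrable g ->
  (forall K, compact K -> (\int[leb]_(x in K) `|u_ n x - u x|%:E @[n --> \oo] --> 0)%E) ->
  (forall K, compact K -> (\int[leb]_(x in K) `|g_ n x - g x|%:E @[n --> \oo] --> 0)%E) ->
  is_weak_partial i u g.
Proof.
move=> ug lu lg uK gK; split => // psi tp; pose K := closure [set x | psi x != 0].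
have cK : compact K by exact: tp.2.
have mK := rV_compact_measurable cK.
have tdp := test_function_partial i tp.
have p0 x : ~ K x -> psi x = 0.
  by move=> nx; apply/eqP; apply: contra_notT nx => px; exact: subset_closure.
have dp0 x : ~ K x -> partial i psi x = 0 by exact: partial_out.
have cvgK (q : 'rV[R]_N -> R) (w_ : nat -> 'rV[R]_N -> R) w : test_function q ->
    (forall n, loc_integrable (w_ n)) -> loc_integrable w ->
    (\int[leb]_(x in K) `|w_ n x - w x|%:E @[n --> \oo] --> 0)%E ->
    \int[leb]_(x in K) (q x * w_ n x) @[n --> \oo] --> \int[leb]_(x in K) (q x * w x).
  move=> tq lw_ lw wK; have [C C0 qC] := test_function_bounded tq.
  have mq := test_function_measurable tq.
  apply: cvg_Rintegral_mean => //.
  - by move=> n; exact: (loc_integrableM mq qC (lw_ n) cK).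
  - exact: (loc_integrableM mq qC lw cK).
  - apply: (@cvg_integral_bounded_mul _ _ _ _ _ mK (fun=> q) q _ _ C) => //.
    + by move=> n; exact: measurable_funTS.
    + exact: measurable_funTS.
    + by move=> n; apply: measurable_funTS; exact: loc_integrable_measurable.
    + exact: lw.
    + by apply: aeW => x _; exact: cvg_cst.
rewrite (Rintegral_mul_test _ cK dp0) (Rintegral_mul_test _ cK p0).
have cu := cvgK _ _ _ tdp (fun n => let: And3 a _ _ := ug n in a) lu (uK _ cK).
have cg := cvgN (cvgK _ _ _ tp (fun n => let: And3 _ a _ := ug n in a) lg (gK _ cK)).
have E : (fun n => \int[leb]_(x in K) (partial i psi x * u_ n x)) =
    - (fun n => \int[leb]_(x in K) (psi x * g_ n x)).
  apply/funext => n; rewrite fctE -(Rintegral_mul_test _ cK dp0) -(Rintegral_mul_test _ cK p0).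
  by have [_ _ ->] := ug n.
by move: cu; rewrite E => cu; apply: (cvg_unique _ cu (cg _)).
Qed.

End weak_partials.

Section smooth_real_functions.
Context {R : realType}.
Implicit Types (p : R -> R).

Lemma smoothR_derivable p t : smoothR p -> derivable p t 1.
Proof. by move=> sp; exact: (sp 0%N). Qed.

Lemma smoothR_derive1 p : smoothR p -> smoothR (derive1 p).
Proof. by move=> sp n t; have := sp n.+1 t; rewrite derive1Sn. Qed.

Lemma smoothR_continuous p : smoothR p -> continuous p.
Proof.
move=> sp t; apply: differentiable_continuous; apply/derivable1_diffP.
exact: smoothR_derivable.
Qed.

Lemma smoothR_lipschitz p (L : R) : smoothR p -> (forall t, `|derive1 p t| <= L) ->
  forall a b, `|p a - p b| <= L * `|a - b|.
Proof.
move=> sp pL; have H a b : a <= b -> `|p b - p a| <= L * `|b - a|.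
  move=> ab; have [||c _ ->] := @MVT_segment R p (derive1 p) a b ab.
  - move=> x _; rewrite derive1E; apply: derivableP; exact: smoothR_derivable.
  - by apply: continuous_subspaceT; exact: smoothR_continuous.
  - by rewrite normrM ler_wpM2r.
move=> a b; have [ab|/ltW ba] := leP a b; last exact: H.
by rewrite distrC [`|a - b|]distrC; exact: H.
Qed.

End smooth_real_functions.

Section sobolev.
Context {R : realType} {N : nat}.
Local Notation leb := (lebesgue_rV N).
Implicit Types (u v w : 'rV[R]_N -> R) (g h : 'I_N -> 'rV[R]_N -> R)
  (f k : nat -> 'rV[R]_N -> R) (i : 'I_N).

Lemma L2_limit_lty u f :
  measurable_fun setT u -> (forall n, test_function (f n)) ->
  (\int[leb]_x ((f n x - u x) ^+ 2)%:E @[n --> \oo] --> 0)%E ->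
  (\int[leb]_x (u x ^+ 2)%:E < +oo)%E.
Proof.
move=> mu tf cv.
have [n cvn] : exists n, (\int[leb]_x ((f n x - u x) ^+ 2)%:E <= 1%:E)%E.
  have : \forall n \near \oo, (\int[leb]_x ((f n x - u x) ^+ 2)%:E <= 1%:E)%E.
    apply: ((cvge0P _).1 cv) => // n.
    by apply: integral_ge0 => x _; rewrite lee_fin sqr_ge0.
  by move=> [n _ /(_ _ (leqnn _))] ?; exists n.
have mf := test_function_measurable (tf n).
have := integral_sqrD_le leb measurableT mf (measurable_funB mu mf).
under eq_integral do rewrite addrC subrK.
move=> /le_lt_trans; apply; rewrite lte_add_pinfty//.
  by rewrite lte_mul_pinfty// ?lee_fin// test_function_L2.
rewrite lte_mul_pinfty// ?lee_fin//; apply: le_lt_trans (ltry 1); apply: le_trans cvn.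
rewrite le_eqVlt; apply/orP; left; apply/eqP; apply: eq_integral => x _ /=.
by rewrite -sqrrN opprB.
Qed.

(** The difference is multiplied by the constant 1, which is square integrable over a compact
    set. *)
Lemma L2_cvg_L1loc u f K : compact K ->
  measurable_fun setT u -> (forall n, measurable_fun setT (f n)) ->
  (\int[leb]_x ((f n x - u x) ^+ 2)%:E @[n --> \oo] --> 0)%E ->
  (\int[leb]_(x in K) `|f n x - u x|%:E @[n --> \oo] --> 0)%E.
Proof.
move=> cK mu mf cv; have mK := rV_compact_measurable cK.
have mfu n : measurable_fun setT (fun x => f n x - u x) by exact: measurable_funB.
under eq_cvg do under eq_integral do rewrite -[_ - _]mulr1.
apply: (@cvg_integral_mul _ _ _ _ _ mK (fun n x => f n x - u x) (fun _ _ => 1) (fine (leb K))).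
- by move=> n; exact: measurable_funTS.
- by move=> n; exact: measurable_cst.
- apply: cvge0_le cv; first by move=> n; apply: integral_ge0 => x _; rewrite lee_fin sqr_ge0.
  apply: nearW => n; apply: ge0_subset_integral => //.
    by apply/measurable_EFinP; exact: measurable_funX.
  by move=> x _; rewrite lee_fin sqr_ge0.
- apply: nearW => n; rewrite expr1n integral_cst// mul1e fineK//.
  by rewrite ge0_fin_numE//; exact: leb_compact_lty.
Qed.

(* [v] is an H^1 function with gradient [g], as witnessed by test functions [f]. *)
Definition H1_approx v g f : Prop :=
  [/\ measurable_fun setT v /\ (forall i, measurable_fun setT (g i)),
    forall n, test_function (f n),
    (\int[leb]_x ((f n x - v x) ^+ 2)%:E @[n --> \oo] --> 0)%E,
    forall i, (\int[leb]_x ((partial i (f n) x - g i x) ^+ 2)%:E @[n --> \oo] --> 0)%E &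
    {ae leb, forall x, f n x @[n --> \oo] --> v x}].

Lemma H1_approx_L2 v g f : H1_approx v g f ->
  (\int[leb]_x (v x ^+ 2)%:E < +oo)%E /\ forall i, (\int[leb]_x (g i x ^+ 2)%:E < +oo)%E.
Proof.
move=> [[mv mg] tf fv fg _]; split=> [|i]; first exact: L2_limit_lty fv.
apply: (@L2_limit_lty _ (fun n => partial i (f n))) => // n.
exact: test_function_partial.
Qed.

Variables (p : R -> R) (L : R).
Hypotheses (sp : smoothR p) (p1L : forall t, `|derive1 p t| <= L)
  (p2L : forall t, `|derive1 (derive1 p) t| <= L).

Let L0 : 0 <= L. Proof. exact: le_trans (p1L 0). Qed.

Let sp1 : smoothR (derive1 p). Proof. exact: smoothR_derive1. Qed.

Let sp2 : smoothR (derive1 (derive1 p)). Proof. exact: smoothR_derive1. Qed.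

Lemma measurable_smoothR_comp (q : R -> R) u :
  smoothR q -> measurable_fun setT u -> measurable_fun setT (q \o u).
Proof.
move=> sq mu; apply: measurableT_comp => //; apply: continuous_measurable_fun.
exact: smoothR_continuous.
Qed.

Lemma ae_cvg_smoothR_comp (q : R -> R) v f (D : set 'rV[R]_N) : smoothR q ->
  {ae leb, forall x, f n x @[n --> \oo] --> v x} ->
  {ae leb, forall x, D x -> (q \o f n) x @[n --> \oo] --> (q \o v) x}.
Proof.
move=> sq; apply: filterS => x fx _; apply: (@continuous_cvg _ _ _ _ _ _ q) => //.
exact: smoothR_continuous.
Qed.

(** The classical chain rule for [p \o f n] passes to the limit: the factors [derive1 p (f n)] are
    bounded by [L] and converge almost everywhere, the gradients converge locally in L^1. The
    condition [p 0 = 0] keeps the support of [p \o f n] compact. *)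
Lemma weak_partial_chain v g f i : p 0 = 0 -> H1_approx v g f ->
  is_weak_partial i (p \o v) (fun x => derive1 p (v x) * g i x).
Proof.
move=> p0 hv; have [v2 g2] := H1_approx_L2 hv.
have [[mv mg] tf fv fg fae] := hv.
have mpf n := measurable_smoothR_comp sp1 (test_function_measurable (tf n)).
have mpv := measurable_smoothR_comp sp1 mv.
have lv := loc_integrable_sqr mv v2.
have lg := loc_integrable_sqr (mg i) (g2 i).
have mdf n := test_function_measurable (test_function_partial i (tf n)).
have pE n : partial i (p \o f n) = fun x => derive1 p (f n x) * partial i (f n) x.
  apply/funext => x; apply: partial_comp; last exact: smoothR_derivable.
  exact: smooth_differentiable (tf n).1.
apply: (@is_weak_partial_cvg _ _ _ (fun n => p \o f n)
    (fun n x => derive1 p (f n x) * partial i (f n) x)).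
- by move=> n; rewrite -pE; apply: test_weak_partial; exact: test_function_comp.
- apply: (@loc_integrable_dom _ _ _ (fun x => L * v x)).
  + exact: measurable_smoothR_comp.
  + exact: loc_integrableZ.
  + move=> x; have := smoothR_lipschitz sp p1L (v x) 0.
    by rewrite p0 !subr0 normrM (ger0_norm L0).
- exact: (loc_integrableM mpv (fun x => p1L (v x)) lg).
- move=> K cK; have mK := rV_compact_measurable cK.
  have := cvge0Z L (L2_cvg_L1loc cK mv (fun n => test_function_measurable (tf n)) fv).
  apply: cvge0_le; first by move=> n; apply: integral_ge0 => x _; rewrite lee_fin.
  apply: nearW => n; have mfv : measurable_fun K (fun x => `|f n x - v x|%:E).
    apply/measurable_EFinP; apply: measurable_funTS; apply: measurableT_comp => //.
    by apply: measurable_funB => //; exact: test_function_measurable.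
  rewrite -ge0_integralZl//.
  apply: ge0_le_integral => //.
  + apply/measurable_EFinP; apply: measurable_funTS; apply: measurableT_comp => //.
    by apply: measurable_funB => //; apply: measurable_smoothR_comp => //; exact: test_function_measurable.
  + exact: measurable_funeM.
  + by move=> x _; rewrite lee_fin; exact: smoothR_lipschitz.
- move=> K cK; have mK := rV_compact_measurable cK.
  apply: (@cvg_integral_bounded_mul _ _ _ _ _ mK (fun n => derive1 p \o f n) (derive1 p \o v) (fun n => partial i (f n)) (g i) L).
  + by move=> n; exact: (measurable_funTS (mpf n)).
  + exact: (measurable_funTS mpv).
  + by move=> n; exact: measurable_funTS.
  + exact: lg.
  + by move=> n x; exact: p1L.
  + by move=> x; exact: p1L.
  + exact: (ae_cvg_smoothR_comp K sp1 fae).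
  + exact: (L2_cvg_L1loc cK (mg i) mdf (fg i)).
Qed.

Lemma partial_derive1_compM (q : R -> R) u w i x : smoothR q -> smooth u -> smooth w ->
  partial i ((q \o u) \* w) x = q (u x) * partial i w x +
    derive1 q (u x) * (partial i u x * w x).
Proof.
move=> sq su sw; have squ := smooth_comp sq su.
rewrite partialM; [|exact: smooth_differentiable..].
rewrite partial_comp; [|exact: smooth_differentiable|exact: smoothR_derivable].
by rewrite /=; congr (_ + _); ring.
Qed.

(** The product of [g i] and [w], both in L^2, is only known to be in L^1, so the limit is taken
    locally in L^1 rather than in L^2. Here the compact support of the approximations comes from the
    factor [k n]. *)
Lemma weak_partial_derive1M v g f w h k i : H1_approx v g f -> H1_approx w h k ->
  is_weak_partial i (fun x => derive1 p (v x) * w x)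
    (fun x => derive1 p (v x) * h i x + derive1 (derive1 p) (v x) * (g i x * w x)).
Proof.
move=> hv hw; have [v2 g2] := H1_approx_L2 hv; have [w2 h2] := H1_approx_L2 hw.
have [[mv mg] tf fv fg fae] := hv; have [[mw mh] tk kw kh kae] := hw.
have mf n := test_function_measurable (tf n).
have mk n := test_function_measurable (tk n).
have mdf n := test_function_measurable (test_function_partial i (tf n)).
have mdk n := test_function_measurable (test_function_partial i (tk n)).
have mp1f n := measurable_smoothR_comp sp1 (mf n).
have mp1v := measurable_smoothR_comp sp1 mv.
have mp2f n := measurable_smoothR_comp sp2 (mf n).
have mp2v := measurable_smoothR_comp sp2 mv.
have lw := loc_integrable_sqr mw w2.
have lh := loc_integrable_sqr (mh i) (h2 i).
have lgw : loc_integrable (g i \* w) by apply: integrable_loc; exact: integrable_L2M.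
have lp1h := loc_integrableM mp1v (fun x => p1L (v x)) lh.
have lp2gw := loc_integrableM mp2v (fun x => p2L (v x)) lgw.
apply: (@is_weak_partial_cvg _ _ _ (fun n => (derive1 p \o f n) \* k n)
    (fun n x => derive1 p (f n x) * partial i (k n) x +
                derive1 (derive1 p) (f n x) * (partial i (f n) x * k n x))).
- move=> n; have sf := smooth_comp sp1 (tf n).1.
  rewrite (_ : (fun x => _) = partial i ((derive1 p \o f n) \* k n)).
    apply: test_weak_partial.
    rewrite (_ : _ \* _ = k n \* (derive1 p \o f n)); first exact: test_functionM.
    by apply/funext => x /=; rewrite mulrC.
  apply/funext => x; rewrite partial_derive1_compM//; [exact: (tf n).1|exact: (tk n).1].
- exact: (loc_integrableM mp1v (fun x => p1L (v x)) lw).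
- exact: loc_integrableD.
- move=> K cK; have mK := rV_compact_measurable cK.
  apply: (@cvg_integral_bounded_mul _ _ _ _ _ mK (fun n => derive1 p \o f n) (derive1 p \o v) k w L).
  + by move=> n; exact: (measurable_funTS (mp1f n)).
  + exact: (measurable_funTS mp1v).
  + by move=> n; exact: measurable_funTS.
  + exact: lw.
  + by move=> n x; exact: p1L.
  + by move=> x; exact: p1L.
  + exact: (ae_cvg_smoothR_comp K sp1 fae).
  + exact: (L2_cvg_L1loc cK mw mk kw).
- move=> K cK; have mK := rV_compact_measurable cK.
  have c1 : (\int[leb]_(x in K) `|derive1 p (f n x) * partial i (k n) x -
      derive1 p (v x) * h i x|%:E @[n --> \oo] --> 0)%E.
    apply: (@cvg_integral_bounded_mul _ _ _ _ _ mK (fun n => derive1 p \o f n) (derive1 p \o v) (fun n => partial i (k n)) (h i) L).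
    + by move=> n; exact: (measurable_funTS (mp1f n)).
    + exact: (measurable_funTS mp1v).
    + by move=> n; exact: measurable_funTS.
    + exact: lh.
    + by move=> n x; exact: p1L.
    + by move=> x; exact: p1L.
    + exact: (ae_cvg_smoothR_comp K sp1 fae).
    + exact: (L2_cvg_L1loc cK (mh i) mdk (kh i)).
  have c2 : (\int[leb]_(x in K) `|derive1 (derive1 p) (f n x) * (partial i (f n) x * k n x) -
      derive1 (derive1 p) (v x) * (g i x * w x)|%:E @[n --> \oo] --> 0)%E.
    apply: (@cvg_integral_bounded_mul _ _ _ _ _ mK (fun n => derive1 (derive1 p) \o f n)
      (derive1 (derive1 p) \o v) (fun n x => partial i (f n) x * k n x) (fun x => g i x * w x) L).
    + by move=> n; exact: (measurable_funTS (mp2f n)).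
    + exact: (measurable_funTS mp2v).
    + by move=> n; apply: measurable_funTS; exact: measurable_funM.
    + exact: lgw.
    + by move=> n x; exact: p2L.
    + by move=> x; exact: p2L.
    + exact: (ae_cvg_smoothR_comp K sp2 fae).
    + have mE n : measurable_fun setT (fun x => partial i (f n) x * k n x - g i x * w x).
        by apply: measurable_funB; exact: measurable_funM.
      have := cvg_integral_sqr_mul measurableT mdf mk (mg i) mw (g2 i) w2 (fg i) kw.
      apply: cvge0_le; first by move=> n; apply: integral_ge0 => x _; rewrite lee_fin.
      apply: nearW => n; apply: ge0_subset_integral => //.
      by apply/measurable_EFinP; exact: measurableT_comp.
  apply: (@cvg_integral_meanD _ _ _ _ _ mK _
    (fun n x => derive1 (derive1 p) (f n x) * (partial i (f n) x * k n x)) _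
    (fun x => derive1 (derive1 p) (v x) * (g i x * w x)) _ _ _ _ c1 c2).
  + by move=> n; exact: (measurable_funTS (measurable_funM (mp1f n) (mdk n))).
  + move=> n; apply: measurable_funTS.
    exact: (measurable_funM (mp2f n) (measurable_funM (mdf n) (mk n))).
  + exact: (measurable_funTS (measurable_funM mp1v (mh i))).
  + exact: (measurable_funTS (measurable_funM mp2v (measurable_funM (mg i) mw))).
Qed.

(** The energy at s = 1 requires L^2 convergence, which identifying the weak derivative did not. The
    difference splits into [p'(f_n) (D f_n - g)], bounded through [L], and [(p'(f_n) - p'(v)) g]. *)
Lemma cvg_grad_chain v g f i : H1_approx v g f ->
  (\int[leb]_x ((derive1 p (f n x) * partial i (f n) x - derive1 p (v x) * g i x) ^+ 2)%:E
    @[n --> \oo] --> 0)%E.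
Proof.
move=> hv; have [v2 g2] := H1_approx_L2 hv.
have [[mv mg] tf fv fg fae] := hv.
have mf n := test_function_measurable (tf n).
have mdf n := test_function_measurable (test_function_partial i (tf n)).
have mp1f n := measurable_smoothR_comp sp1 (mf n).
have mp1v := measurable_smoothR_comp sp1 mv.
have mA n : measurable_fun setT (fun x => derive1 p (f n x) * (partial i (f n) x - g i x)).
  exact: (measurable_funM (mp1f n) (measurable_funB (mdf n) (mg i))).
have mm n : measurable_fun setT (fun x => (derive1 p (f n x) - derive1 p (v x)) ^+ 2).
  exact: (measurable_funX _ (measurable_funB (mp1f n) mp1v)).
have mB n : measurable_fun setT (fun x => (derive1 p (f n x) - derive1 p (v x)) * g i x).
  exact: (measurable_funM (measurable_funB (mp1f n) mp1v) (mg i)).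
have mgg : measurable_fun setT (fun x => g i x * g i x) by exact: measurable_funM.
have igg : leb.-integrable setT (EFin \o (fun x => g i x * g i x)) by exact: integrable_L2M.
(* The squared difference of the factors is a multiplier bounded by [(2 L)^2] and tending to 0; it
   acts on the fixed integrable function [g^2]. *)
have c2 : (\int[leb]_x `|(derive1 p (f n x) - derive1 p (v x)) ^+ 2 * (g i x * g i x) - 0 * (g i x * g i x)|%:E @[n --> \oo] --> 0)%E.
  apply: (@cvg_integral_bounded_mul _ _ _ leb _ measurableT
    (fun n x => (derive1 p (f n x) - derive1 p (v x)) ^+ 2) (fun=> 0)
    (fun _ x => g i x * g i x) (fun x => g i x * g i x) (4 * L ^+ 2)) => //.
  - move=> n x; rewrite ger0_norm ?sqr_ge0// -real_normK ?num_real//.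
    have : `|derive1 p (f n x) - derive1 p (v x)| <= 2 * L.
      by rewrite mulr_natl mulr2n; apply: le_trans (ler_normB _ _) _; exact: lerD.
    have := normr_ge0 (derive1 p (f n x) - derive1 p (v x)); nra.
  - by move=> x; rewrite normr0 mulr_ge0// sqr_ge0.
  - apply: filterS (ae_cvg_smoothR_comp setT sp1 fae) => x /(_ I) cx _.
    have cB : derive1 p (f n x) - derive1 p (v x) @[n --> \oo] --> (0 : R).
      by rewrite -[X in _ --> X](subrr (derive1 p (v x))); apply: cvgB; [exact: cx|exact: cvg_cst].
    have := @cvgM _ _ _ _ _ _ _ _ cB cB; rewrite mulr0; exact.
  - apply: cvg_near_cst; apply: nearW => n.
    by apply: integral0_eq => x _; rewrite subrr normr0.
have c1 : (2%:E * ((L ^+ 2)%:E * \int[leb]_x ((partial i (f n) x - g i x) ^+ 2)%:E) @[n --> \oo] --> 0)%E.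
  by apply: cvge0Z; apply: cvge0Z; exact: fg.
apply: cvge0_le (cvge0D c1 (cvge0Z 2 c2)).
  by move=> n; apply: integral_ge0 => x _; rewrite lee_fin sqr_ge0.
apply: nearW => n.
have E x : derive1 p (f n x) * partial i (f n) x - derive1 p (v x) * g i x =
  derive1 p (f n x) * (partial i (f n) x - g i x) + (derive1 p (f n x) - derive1 p (v x)) * g i x.
  by ring.
under eq_integral do rewrite E.
apply: le_trans (integral_sqrD_le leb measurableT (mA n) (mB n)) _.
apply: leeD; rewrite lee_pmul2l ?lte_fin//.
  rewrite -ge0_integralZl//.
  - apply: ge0_le_integral => //.
    + by move=> x _; rewrite lee_fin sqr_ge0.
    + by apply/measurable_EFinP; exact: measurable_funX.
    + by apply: measurable_funeM; apply/measurable_EFinP; apply: measurable_funX; exact: measurable_funB.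
    + move=> x _; rewrite -EFinM lee_fin exprMn ler_wpM2r ?sqr_ge0//.
      by rewrite -real_normK ?num_real// lerXn2r ?nnegrE.
  - by apply/measurable_EFinP; apply: measurable_funX; exact: measurable_funB.
  - by move=> x _; rewrite lee_fin sqr_ge0.
  - by rewrite lee_fin sqr_ge0.
rewrite le_eqVlt; apply/orP; left; apply/eqP; apply: eq_integral => x _ /=.
by rewrite mul0r subr0 exprMn -expr2 ger0_norm// mulr_ge0 ?sqr_ge0.
Qed.

End sobolev.

(** * The fractional constant and the Gagliardo form of a test function *)

Section measurable_exp_ln.
Context d (T : measurableType d) (R : realType) (D : set T).
Implicit Types f : T -> R.

Lemma measurable_fun_expR f : measurable_fun D f -> measurable_fun D (fun x => expR (f x)).
Proof.
by move=> mf; apply: (@measurableT_comp _ _ _ _ _ _ (@expR R) D f).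
Qed.

Lemma measurable_fun_ln f : measurable_fun D f -> measurable_fun D (fun x => ln (f x)).
Proof.
by move=> mf; apply: (@measurableT_comp _ _ _ _ _ _ (@ln R) D f).
Qed.

Lemma measurable_fun_powR f r : measurable_fun D f -> measurable_fun D (fun x => f x `^ r).
Proof.
by move=> mf; apply: (@measurableT_comp _ _ _ _ _ _ (@powR R ^~ r) D f).
Qed.

End measurable_exp_ln.

Section gamma_bounds.
Context {R : realType}.
Local Notation leb1 := (@lebesgue_measure R).
Implicit Types (s z t : R).

Lemma gammaE z : (@Gamma R z = fine (\int[leb1]_(t in `]0%R, +oo[)
  (t `^ (z - 1) * expR (- t))%:E))%E.
Proof. by []. Qed.

Lemma gamma_ge0 z : 0 <= @Gamma R z.
Proof.
by apply: Rintegral_ge0 => t _; rewrite mulr_ge0 ?powR_ge0 ?expR_ge0.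
Qed.

(** For [t > 0] the power is [exp ((z - 1) ln t)], which makes joint measurability in [(z, t)]
    visible; Tonelli's theorem then gives measurability in [z]. *)
Lemma measurable_gamma : measurable_fun setT (@Gamma R).
Proof.
pose F (p : measurableTypeR R * measurableTypeR R) : \bar R :=
  (\1_(`]0%R, +oo[ : set R) (p.2 : R) * (expR ((p.1 - 1) * ln (p.2 : R)) * expR (- p.2 : R)))%:E.
have -> : @Gamma R = fun z => fine (fubini_F leb1 F z).
  apply/funext => z; rewrite gammaE; congr fine; rewrite integral_mkcond /fubini_F.
  apply: eq_integral => t _; rewrite patchE /F/= indicE; case: ifPn => [|_].
    rewrite inE/= in_itv/= andbT => t0; rewrite mul1r.
    by rewrite /powR gt_eqF.
  by rewrite mul0r.
apply: measurableT_comp => //; apply: measurable_fun_fubini_tonelli_F.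
  apply/measurable_EFinP; apply: measurable_funM.
    by apply: measurableT_comp => //.
  apply: measurable_funM.
    apply: measurable_fun_expR.
    apply: measurable_funM; first exact: measurable_funB.
    by apply: measurable_fun_ln.
  apply: measurable_fun_expR.
  by apply: measurableT_comp.
by move=> p; rewrite lee_fin !mulr_ge0 ?expR_ge0.
Qed.

(** Twice the total mass of the exponential law of rate 1/2. *)
Lemma integral_expR_half : (\int[leb1]_(t in `]0%R, +oo[) (expR (- (t / 2)))%:E <= 2%:E)%E.
Proof.
have h2 : 0 < 2^-1 :> R by rewrite invr_gt0.
have me := measurable_exponential_pdf (2^-1 : R).
have := integral_exponential_pdf h2.
move=> /(congr1 (fun x => 2%:E * x)%E); rewrite mule1 => <-.
rewrite -ge0_integralZl//; last 2 first.
- exact/measurable_EFinP.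
- by move=> t _; rewrite lee_fin exponential_pdf_ge0// ltW.
rewrite [X in (X <= _)%E]integral_mkcond; apply: ge0_le_integral => //.
- by move=> t _; rewrite patchE; case: ifP => // _; rewrite lee_fin expR_ge0.
- apply/(measurable_restrictT _ _).1 => //; apply: measurable_funTS.
  apply/measurable_EFinP; apply: measurable_fun_expR.
  by apply: measurableT_comp => //; exact: measurable_funM.
- by apply: measurable_funeM; exact/measurable_EFinP.
- move=> t _; rewrite patchE; case: ifPn => [|_]; last first.
    by rewrite mule_ge0// lee_fin exponential_pdf_ge0// ltW.
  rewrite inE/= in_itv/= andbT => t0; rewrite exponential_pdfE; last exact: ltW.
  by rewrite -EFinM lee_fin mulrA divff// mul1r mulNr [t / 2]mulrC.
Qed.

(** Half of the exponential absorbs the power: [t^(z-1)] is at most 1 for [t <= 1] and at most [t^m]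
    beyond, and [t^m <= (2 m)^m exp (t/2)]. *)
Lemma gamma_le (m : nat) z : 1 <= z <= m.+1%:R -> @Gamma R z <= 2 * (1 + (2 * m%:R) ^+ m).
Proof.
move=> /andP[z1 zm]; pose C : R := 1 + (2 * m%:R) ^+ m.
have C0 : 0 <= C by rewrite addr_ge0// exprn_ge0// mulr_ge0.
have le : (\int[leb1]_(t in `]0%R, +oo[) (t `^ (z - 1) * expR (- t))%:E <= (2 * C)%:E)%E.
  apply: (@le_trans _ _ (\int[leb1]_(t in `]0%R, +oo[) (C%:E * (expR (- (t / 2)))%:E))%E).
    apply: ge0_le_integral => //.
    - by move=> t _; rewrite lee_fin mulr_ge0 ?powR_ge0 ?expR_ge0.
    - apply/measurable_EFinP; apply: measurable_funM; first exact: measurable_funTS.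
      apply: measurable_funTS; by apply: measurable_fun_expR.
    - apply: measurable_funeM; apply/measurable_EFinP; apply: measurable_funTS.
      apply: measurable_fun_expR.
      by apply: measurableT_comp => //; exact: measurable_funM.
    - move=> t; rewrite /= in_itv/= andbT => t0; rewrite -EFinM lee_fin.
      have e2 : expR (- t) = expR (- (t / 2)) * expR (- (t / 2)).
        by rewrite -expRD -opprD -splitr.
      rewrite e2 mulrA ler_wpM2r ?expR_ge0// expRN ler_pdivrMr ?expR_gt0//.
      have e1 : 1 <= expR (t / 2) by rewrite -expR0 ler_expR divr_ge0// ltW.
      have tm : t ^+ m <= (2 * m%:R) ^+ m * expR (t / 2).
        have t20 : 0 <= t / 2 by rewrite divr_ge0// ltW.
        have := expn_le_expR m t20; rewrite exprMn exprVn ler_pdivrMr ?exprn_gt0// => /le_trans; apply.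
        by rewrite exprMn mulrAC [2 ^+ m * _]mulrC.
      rewrite mulrDl mul1r; have [t1|t1] := leP t 1.
        apply: le_trans (_ : 1 <= _).
          apply: (@le_trans _ _ (1 `^ (z - 1))); last by rewrite powR1.
          by apply: (@ge0_ler_powR R (z - 1)) => //; rewrite ?subr_ge0 ?nnegrE// ltW.
        by rewrite (le_trans e1)// lerDl mulr_ge0 ?expR_ge0// exprn_ge0// mulr_ge0.
      apply: (@le_trans _ _ (t ^+ m)).
        rewrite -powR_mulrn; last exact: ltW.
        apply: ler_powR; first exact: ltW.
        by rewrite lerBlDr natr1.
      by rewrite (le_trans tm)// lerDr expR_ge0.
  rewrite ge0_integralZl//; last first.
  - apply/measurable_EFinP; apply: measurable_funTS.
    apply: measurable_fun_expR.
    by apply: measurableT_comp => //; exact: measurable_funM.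
  rewrite mulrC EFinM; apply: lee_wpmul2l; first by rewrite lee_fin.
  exact: integral_expR_half.
rewrite gammaE -lee_fin fineK// ge0_fin_numE.
  exact: le_lt_trans le (ltry _).
by apply: integral_ge0 => t _; rewrite lee_fin mulr_ge0 ?powR_ge0 ?expR_ge0.
Qed.

(** The exact value is [1 / (1 - s)], but only its order matters. Cutting the singular end off at
    the [e] for which [e^(1-s) = 1/2] leaves half of it and a continuous integrand. *)
Lemma integral_powR_ge s : 0 < s < 1 ->
  ((2 * (1 - s))^-1%:E <= \int[leb1]_(t in `]0%R, 1%R]) (t `^ (- s))%:E)%E.
Proof.
move=> /andP[s0 s1]; have s10 : 0 < 1 - s by rewrite subr_gt0.
pose e : R := 2 `^ (- (1 - s)^-1).
have e0 : 0 < e by rewrite powR_gt0.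
have ee : e `^ (1 - s) = 2^-1 by rewrite /e -powRrM mulNr mulVf ?gt_eqF// powR_inv1.
have e1 : e < 1.
  rewrite ltNge; apply/negP => e1.
  have : 1 <= e `^ (1 - s).
    apply: (@le_trans _ _ (1 `^ (1 - s))); first by rewrite powR1.
    by apply: (@ge0_ler_powR R (1 - s)) => //; rewrite ?nnegrE// ltW.
  by rewrite ee; apply/negP; rewrite -ltNge invf_lt1// ltr1n.
apply: (@le_trans _ _ (\int[leb1]_(t in `[e, 1%R]) (t `^ (- s))%:E)%E); last first.
  apply: ge0_subset_integral => //.
  - by apply/measurable_EFinP; exact: measurable_funTS.
  - by move=> t _; rewrite lee_fin powR_ge0.
  - move=> t; rewrite /= !in_itv/= => /andP[et ->]; rewrite andbT.
    exact: lt_le_trans et.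
have dF (t : R) : 0 < t -> is_derive t 1 (fun t => (1 - s)^-1 * t `^ (1 - s)) (t `^ (- s)).
  move=> t0; have := @is_deriveZ _ _ _ (fun t => t `^ (1 - s)) (1 - s)^-1 t 1 _ (is_derive1_powR (1 - s) t0).
  by rewrite /GRing.scale/= mulrA mulVf ?gt_eqF// mul1r addrAC subrr add0r.
have cpow (t : R) q : 0 < t -> {for t, continuous (fun t => t `^ q)}.
  move=> t0; apply: differentiable_continuous; apply/derivable1_diffP.
  by have [] := is_derive1_powR q t0.
have cF (t : R) : 0 < t -> {for t, continuous (fun t => (1 - s)^-1 * t `^ (1 - s))}.
  move=> t0; apply: differentiable_continuous; apply/derivable1_diffP.
  by have [] := dF t t0.
rewrite (@continuous_FTC2 _ _ (fun t => (1 - s)^-1 * t `^ (1 - s)))//.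
- rewrite -EFinB lee_fin powR1 ee mulr1 invfM.
  have : 0 < (1 - s)^-1 by rewrite invr_gt0.
  lra.
- apply: continuous_in_subspaceT => t; rewrite inE/= in_itv/= => /andP[et _].
  by apply: cpow; exact: lt_le_trans et.
- split.
  + move=> t; rewrite in_itv/= => /andP[et _].
    by have [] := dF t (lt_trans e0 et).
  + by apply: cvg_at_right_filter; exact: cF.
  + by apply: cvg_at_left_filter; exact: cF.
- move=> t; rewrite in_itv/= => /andP[et _].
  by rewrite derive1E; have [_ ->] := dF t (lt_trans e0 et).
Qed.

(** On []0, 1]] the factor [exp (-t)] is at least [exp (-1)], which leaves the integral of
    [t^(-s)]. *)
Lemma gamma_inv_le s : 0 < s < 1 -> (@Gamma R (1 - s))^-1 <= 2 * expR 1 * (1 - s).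
Proof.
move=> /[dup] hs /andP[s0 s1]; have s10 : 0 < 1 - s by rewrite subr_gt0.
have B0 : 0 <= 2 * expR 1 * (1 - s) by rewrite !mulr_ge0 ?expR_ge0// ltW.
rewrite gammaE; set I := (\int[_]_(_ in _) _)%E.
(* For an infinite integral [fine] returns 0, whose inverse is 0 too, and the bound is trivial. *)
have [Ifin|] := boolP (I \is a fin_num); last first.
  rewrite fin_numE negb_and !negbK => /orP[] /eqP -> /=; by rewrite invr0.
have : ((2 * expR 1 * (1 - s))^-1%:E <= I)%E.
  apply: (@le_trans _ _ (\int[leb1]_(t in `]0%R, 1%R]) ((expR 1)^-1%:E * (t `^ (- s))%:E))%E).
    rewrite ge0_integralZl//; last first.
    - by move=> t _; rewrite lee_fin powR_ge0.
    - by apply/measurable_EFinP; exact: measurable_funTS.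
    rewrite mulrAC invfM mulrC EFinM; apply: lee_wpmul2l.
      by rewrite lee_fin invr_ge0 expR_ge0.
    exact: integral_powR_ge.
  apply: (@le_trans _ _ (\int[leb1]_(t in `]0%R, 1%R]) (t `^ (1 - s - 1) * expR (- t))%:E)%E).
    apply: ge0_le_integral => //.
    - by move=> t _; rewrite -EFinM lee_fin mulr_ge0 ?powR_ge0// invr_ge0 expR_ge0.
    - by apply: measurable_funeM; apply/measurable_EFinP; exact: measurable_funTS.
    - apply/measurable_EFinP; apply: measurable_funM; first exact: measurable_funTS.
      apply: measurable_funTS; by apply: measurable_fun_expR.
    - move=> t; rewrite /= in_itv/= => /andP[t0 t1].
      rewrite -EFinM lee_fin mulrC addrAC subrr add0r ler_wpM2l ?powR_ge0//.
      by rewrite -expRN ler_expR lerN2.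
  apply: ge0_subset_integral => //.
  - apply/measurable_EFinP; apply: measurable_funM; first exact: measurable_funTS.
    apply: measurable_funTS; by apply: measurable_fun_expR.
  - by move=> t _; rewrite lee_fin mulr_ge0 ?powR_ge0 ?expR_ge0.
  - by move=> t; rewrite /= !in_itv/= => /andP[-> _].
rewrite -[X in (_ <= X)%E](fineK Ifin) lee_fin => h.
rewrite -[leRHS]invrK lef_pV2// posrE.
  by apply: lt_le_trans h; rewrite invr_gt0 !mulr_gt0 ?expR_gt0.
by rewrite invr_gt0 !mulr_gt0 ?expR_gt0.
Qed.

Lemma C_frac_ge0 N s : 0 <= s -> 0 <= C_frac N s.
Proof.
by move=> s0; rewrite /C_frac !mulr_ge0 ?invr_ge0 ?mulr_ge0 ?powR_ge0 ?gamma_ge0.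
Qed.

(* The factors [s] and [1 - s] compensate the singularities of the Gagliardo
   integral of a test function, at infinity as [s -> 0] and on the diagonal as
   [s -> 1]. *)
Lemma C_frac_le N : (1 < N)%N ->
  exists2 C : R, 0 <= C & forall s, 0 < s < 1 -> C_frac N s <= C * (s * (1 - s)).
Proof.
(* [G] bounds [Gamma] on [[1, N + 1]], an interval that contains [(N + 2 s) / 2] because
   [N >= 2]. *)
move=> N1; pose G : R := 2 * (1 + (2 * N%:R) ^+ N).
have G0 : 0 <= G by rewrite mulr_ge0// addr_ge0// exprn_ge0// mulr_ge0.
exists (2 * G * (pi `^ (N%:R / 2))^-1 * (2 * expR 1)).
  by rewrite !mulr_ge0 ?invr_ge0 ?powR_ge0 ?expR_ge0.
move=> s /[dup] hs /andP[s0 s1]; rewrite /C_frac invfM.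
have h1 : 2 `^ (2 * s - 1) <= 2 :> R.
  rewrite -[leRHS]powRr1//; apply: ler_powR; first by rewrite ler1n.
  lra.
have N2 : 2 <= N%:R :> R by rewrite (ler_nat _ 2 N).
have h2 : @Gamma R ((N%:R + 2 * s) / 2) <= G.
  by apply: gamma_le; rewrite -[N.+1%:R]natr1; apply/andP; split; lra.
have h3 := gamma_inv_le hs.
have g1 := gamma_ge0 ((N%:R + 2 * s) / 2); have g2 := gamma_ge0 (1 - s).
rewrite (_ : 2 * G * _ * _ * _ = (2 * s * G) * ((pi `^ (N%:R / 2))^-1 * (2 * expR 1 * (1 - s)))); last by ring.
apply: ler_pM.
- by rewrite !mulr_ge0 ?powR_ge0// ltW.
- by rewrite mulr_ge0 ?invr_ge0 ?powR_ge0.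
- by apply: ler_pM => //; [rewrite mulr_ge0 ?powR_ge0// ltW|rewrite ler_wpM2r// ltW].
- by rewrite ler_wpM2l ?invr_ge0 ?powR_ge0.
Qed.

Lemma measurable_C_frac N : measurable_fun setT (@C_frac R N).
Proof.
rewrite (_ : @C_frac R N = fun s => 2 `^ (2 * s - 1) * s * Gamma ((N%:R + 2 * s) / 2) *
   ((pi `^ (N%:R / 2))^-1 * (@Gamma R (1 - s)) `^ (-1))); last first.
  by apply/funext => s; rewrite /C_frac powR_inv1 ?gamma_ge0// invfM.
have m2 : measurable_fun setT (fun s : R => 2 * s) by exact: measurable_funM.
apply: measurable_funM.
  apply: measurable_funM.
    apply: measurable_funM => //.
    by apply: (@measurableT_comp _ _ _ _ _ _ (@powR R 2) setT (fun s : R => 2 * s - 1));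
      [exact: measurable_powRr|exact: measurable_funB].
  apply: (@measurableT_comp _ _ _ _ _ _ (@Gamma R) setT (fun s : R => (N%:R + 2 * s) / 2)).
    exact: measurable_gamma.
  by apply: measurable_funM => //; exact: measurable_funD.
apply: measurable_funM => //; apply: measurable_fun_powR.
apply: (@measurableT_comp _ _ _ _ _ _ (@Gamma R) setT (fun s : R => 1 - s)).
  exact: measurable_gamma.
exact: measurable_funB.
Qed.

End gamma_bounds.

Section lipschitz.
Context {R : realType} {N : nat}.
Implicit Types (f : 'rV[R]_N -> R) (x y : 'rV[R]_N).

Lemma diff_partialE f x v : differentiable f x ->
  'd f x v = \sum_i v 0 i * partial i f x.
Proof.
move=> df; rewrite [in LHS](row_sum_delta v) linear_sum.
by apply: eq_bigr => i _; rewrite linearZ/= partialE.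
Qed.

(** Mean value theorem along the segment from [y] to [x]. Each coordinate of [x - y] is at most its
    sup norm, so the bounds of the partial derivatives add up to the constant. *)
Lemma test_function_lipschitz f : test_function f ->
  exists2 L : R, 0 <= L & forall x y, `|f x - f y| <= L * `|x - y|.
Proof.
move=> tf.
have /choice[C HC] i : exists C : R, 0 <= C /\ forall x, `|partial i f x| <= C.
  by have [C C0 HC] := test_function_bounded (test_function_partial i tf); exists C.
exists (\sum_i C i) => [|x y]; first by apply: sumr_ge0 => i _; have [] := HC i.
pose h (t : R) := f (t *: (x - y) + y).
have dh (t : R) : is_derive t 1 h ('D_(x - y) f (t *: (x - y) + y)).
  have E : (fun u : R => u^-1 *: (h (u *: 1 + t) - h t)) =
      (fun u => u^-1 *: (f (u *: (x - y) + (t *: (x - y) + y)) - f (t *: (x - y) + y))).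
    by apply/funext => u; rewrite /h addrA -scalerDl [u *: 1]mulr1.
  apply: DeriveDef; last by rewrite /derive E.
  by rewrite /derivable E; apply: diff_derivable; exact: smooth_differentiable tf.1.
have [|c _] := @MVT_segment R h (fun t => 'D_(x - y) f (t *: (x - y) + y)) 0 1 ler01 (fun t _ => dh t).
  apply: continuous_subspaceT => t; apply: differentiable_continuous.
  by apply/derivable1_diffP; have [] := dh t.
rewrite /h scale1r subrK scale0r add0r subr0 mulr1 => ->.
rewrite deriveE; last exact: smooth_differentiable tf.1.
rewrite diff_partialE; last exact: smooth_differentiable tf.1.
apply: le_trans (ler_norm_sum _ _ _) _; rewrite mulr_suml; apply: ler_sum => i _.
rewrite normrM mulrC; apply: ler_pM => //; first by have [_] := HC i; exact.
exact: rV_norm_coord.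
Qed.

Lemma norm_le_enorm x : `|x| <= enorm x.
Proof.
apply/rV_norm_leP => [|i]; first exact: sqrtr_ge0.
rewrite -sqrtr_sqr; apply: ler_wsqrtr.
by rewrite (bigD1 i)//= lerDl; apply: sumr_ge0 => j _; rewrite sqr_ge0.
Qed.

End lipschitz.

(** * Pairs of points at bounded distance *)

Section bands.
Context {R : realType} {N : nat}.
Local Notation leb := (lebesgue_rV N).
Local Notation T := ('rV[R]_N).
Local Notation leb2 := (leb \x leb)%E.

Definition band (r : R) : set (T * T) := [set z : (T * T)%type | forall i, `|z.2 0 i - z.1 0 i| < r].

Lemma measurable_rV_comp d (U : measurableType d) (g : U -> T) i :
  measurable_fun setT g -> measurable_fun setT (fun u => g u 0 i).
Proof.
move=> mg; apply: (@measurableT_comp _ _ _ _ _ _ (rV_coord i) setT g) => //.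
exact: measurable_rV_coord.
Qed.

Lemma measurable_band r : measurable (band r).
Proof.
rewrite (_ : band r = \bigcap_(i in [set: 'I_N])
    [set z : (T * T)%type | (`]-oo, r[%classic : set R) `|z.2 0 i - z.1 0 i|]); last first.
  by apply/seteqP; split => z zr i; have := zr i; rewrite /= in_itv/=; [|exact].
apply: fin_bigcap_measurable => // i _; rewrite -[X in measurable X]setTI.
have mi : measurable_fun setT (fun z : (T * T)%type => `|z.2 0 i - z.1 0 i|).
  apply: measurableT_comp => //; apply: measurable_funB.
    exact: (measurable_rV_comp i measurable_snd).
  exact: (measurable_rV_comp i measurable_fst).
by apply: mi => //; exact: measurable_itv.
Qed.

(** A majorant of the indicator of the close pairs with at least one point in [K], the only pairs
    seen by a function vanishing outside [K]. The sum of two indicators, instead of a union, makes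
    its integral a direct computation. *)
Definition band_weight (K : set T) (r : R) (z : T * T) : R :=
  (\1_K z.1 + \1_K z.2) * \1_(band r) z.

Lemma band_weight_ge0 K r z : 0 <= band_weight K r z.
Proof. by rewrite mulr_ge0// addr_ge0. Qed.

Lemma measurable_band_weight K r : measurable K -> measurable_fun setT (band_weight K r).
Proof.
move=> mK; apply: measurable_funM; last first.
  by apply: measurable_indic; exact: measurable_band.
have mi : measurable_fun setT (\1_K : T -> R) by exact: measurable_indic.
by apply: measurable_funD; [exact: (measurableT_comp mi measurable_fst)|exact: (measurableT_comp mi measurable_snd)].
Qed.

(** In each half, Tonelli integrates first over the point not tied to [K], which ranges over a cube
    of side [2 r]; the two halves are symmetric. *)
Lemma integral_band_weight K r : measurable K -> 0 <= r ->
  (\int[leb2]_z (band_weight K r z)%:E = 2%:E * ((2 * r) ^+ N)%:E * leb K)%E.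
Proof.
move=> mK r0.
have mi : measurable_fun setT (\1_K : T -> R) by exact: measurable_indic.
have mb : measurable_fun setT (\1_(band r) : T * T -> R).
  by apply: measurable_indic; exact: measurable_band.
have m1 : measurable_fun setT (fun z : (T * T)%type => \1_K z.1 * \1_(band r) z : R).
  by apply: measurable_funM => //; exact: (measurableT_comp mi measurable_fst).
have m2 : measurable_fun setT (fun z : (T * T)%type => \1_K z.2 * \1_(band r) z : R).
  by apply: measurable_funM => //; exact: (measurableT_comp mi measurable_snd).
have r2 : 0 <= (2 * r) ^+ N by rewrite exprn_ge0// mulr_ge0.
have sec (x : T) : (\int[leb]_y (\1_K x * \1_(cube x r) y)%:E = (\1_K x)%:E * ((2 * r) ^+ N)%:E)%E.
  under eq_integral do rewrite EFinM.
  rewrite ge0_integralZl//; last first.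
    by apply/measurable_EFinP; apply: measurable_indic; exact: measurable_cube.
  by rewrite integral_indic//; [rewrite setIT; congr (_ * _)%E; exact: leb_cube|exact: measurable_cube].
have fin : (\int[leb]_x ((\1_K x)%:E * ((2 * r) ^+ N)%:E) = ((2 * r) ^+ N)%:E * leb K)%E.
  under eq_integral do rewrite muleC.
  rewrite ge0_integralZl//; last first.
    exact/measurable_EFinP.
  by rewrite integral_indic// setIT.
under eq_integral do rewrite /band_weight mulrDl EFinD.
rewrite ge0_integralD//; [|exact/measurable_EFinP..].
rewrite [X in (X + _)%E]fubini_tonelli1//; last exact/measurable_EFinP.
rewrite [X in (_ + X)%E]fubini_tonelli2//; last exact/measurable_EFinP.
have -> : (\int[leb]_x fubini_F leb (fun z : (T * T)%type => (\1_K z.1 * \1_(band r) z : R)%:E) x =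
    ((2 * r) ^+ N)%:E * leb K)%E.
  rewrite -fin; apply: eq_integral => x _; rewrite /fubini_F -sec.
  by apply: eq_integral => y _; rewrite /= !indicE.
have -> : (\int[leb]_y fubini_G leb (fun z : (T * T)%type => (\1_K z.2 * \1_(band r) z : R)%:E) y =
    ((2 * r) ^+ N)%:E * leb K)%E.
  rewrite -fin; apply: eq_integral => y _; rewrite /fubini_G -sec.
  apply: eq_integral => x _; rewrite /= !indicE; congr (_ * _%:R)%:E.
  congr (nat_of_bool _); apply/asboolP/asboolP => /= H i; have := H i; by rewrite distrC.
by rewrite -muleA -mule2n mule_natl.
Qed.

End bands.

Section geometric.
Context {R : realType}.

(** With [q = exp (-2 t)] the sum is [A / (1 - q)], and [1 + 2 t <= exp (2 t)] yields
    [1 - q >= 2 t / (1 + 2 t) >= t / 2] for [t <= 1]. *)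
Lemma geometric_expR_le (A t : R) : 0 <= A -> 0 < t <= 1 ->
  (\sum_(0 <= k <oo) (A * expR (- (2 * t)) ^+ k)%:E <= (A * (2 / t))%:E)%E.
Proof.
move=> A0 /andP[t0 t1]; set q := expR (- (2 * t)).
have q0 : 0 < q by exact: expR_gt0.
have q1 : q * (1 + 2 * t) <= 1.
  by rewrite /q expRN ler_pdivrMl ?expR_gt0// mulr1; exact: expR_ge1Dx.
have qt : 1 <= (2 / t) * (1 - q).
  rewrite -(@ler_pM2l _ t)// mulr1 mulrA [t * _]mulrC divfK ?gt_eqF//.
  nra.
have q1' : 0 < 1 - q by nra.
apply: lime_le; first by apply: is_cvg_nneseries => k _ _; rewrite lee_fin mulr_ge0// exprn_ge0// ltW.
apply: nearW => n; rewrite sumEFin lee_fin -mulr_sumr ler_wpM2l//.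
have sE : (1 - q) * (\sum_(0 <= i < n) q ^+ i) = 1 - q ^+ n.
  by rewrite big_mkord -[1 - q ^+ n]opprB subrX1 -mulNr opprB.
rewrite -(@ler_pM2l _ (1 - q))// sE; apply: (@le_trans _ _ 1).
  by rewrite lerBlDr lerDl exprn_ge0// ltW.
by rewrite mulrC.
Qed.

End geometric.

Section gagliardo.
Context {R : realType} {N : nat}.
Local Notation leb := (lebesgue_rV N).
Local Notation T := ('rV[R]_N).
Local Notation leb2 := (leb \x leb)%E.
Implicit Types (f u w : T -> R) (s : R).

Definition frac_quot s u w (z : T * T) : R :=
  (u z.1 - u z.2) * (w z.1 - w z.2) / enorm (z.1 - z.2) `^ (N%:R + 2 * s).

Lemma BformE s u w : 0 < s < 1 ->
  (Bform s u w = (C_frac N s)%:E * \int[leb2]_z (frac_quot s u w z)%:E)%E.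
Proof. by move=> /andP[s0 s1]; rewrite /Bform gt_eqF// lt_eqF. Qed.

Lemma frac_quot_ge0 s u z : 0 <= frac_quot s u u z.
Proof. by rewrite mulr_ge0 ?invr_ge0 ?powR_ge0// -expr2 sqr_ge0. Qed.

(* The two series below decompose the pairs according to the exponential shell
   containing [|z.1 - z.2|], inside and outside the unit ball. *)
Lemma frac_quot_le_series f (K : set T) (M L s : R) z :
  (forall x, ~ K x -> f x = 0) -> 0 <= M -> (forall x, `|f x| <= M) ->
  0 <= L -> (forall x y, `|f x - f y| <= L * `|x - y|) -> 0 < s < 1 ->
  ((frac_quot s f f z)%:E <=
   \sum_(0 <= k <oo) (L ^+ 2 * expR (- k%:R) ^+ 2 * expR (k.+1%:R * (N%:R + 2 * s)) *
        band_weight K (2 * expR (- k%:R)) z)%:E +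
   \sum_(0 <= k <oo) (4 * M ^+ 2 * expR (- (k%:R * (N%:R + 2 * s))) *
        band_weight K (expR k.+1%:R) z)%:E)%E.
Proof.
move=> fK M0 fM L0 fL /andP[s0 s1].
have q0 : 0 < N%:R + 2 * s by rewrite ltr_wpDl// mulr_gt0.
set q := N%:R + 2 * s in q0 *.
have a0 k : 0 <= L ^+ 2 * expR (- k%:R) ^+ 2 * expR (k.+1%:R * q) *
    band_weight K (2 * expR (- k%:R)) z.
  by rewrite !mulr_ge0 ?sqr_ge0 ?expR_ge0// band_weight_ge0.
have b0 k : 0 <= 4 * M ^+ 2 * expR (- (k%:R * q)) * band_weight K (expR k.+1%:R) z.
  by rewrite !mulr_ge0 ?sqr_ge0 ?expR_ge0// band_weight_ge0.
have S10 : (0 <= \sum_(0 <= k <oo) (L ^+ 2 * expR (- k%:R) ^+ 2 * expR (k.+1%:R * q) *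
        band_weight K (2 * expR (- k%:R)) z)%:E)%E.
  by apply: nneseries_ge0 => k _ _; rewrite lee_fin.
have S20 : (0 <= \sum_(0 <= k <oo) (4 * M ^+ 2 * expR (- (k%:R * q)) *
        band_weight K (expR k.+1%:R) z)%:E)%E.
  by apply: nneseries_ge0 => k _ _; rewrite lee_fin.
have term (F : nat -> R) k : (forall n, 0 <= F n) -> ((F k)%:E <= \sum_(0 <= n <oo) (F n)%:E)%E.
  move=> F0; apply: le_trans (nneseries_lim_ge k.+1 _) => [|n _ _]; last by rewrite lee_fin.
  by rewrite big_nat_recr//= leeDr// sume_ge0// => i _; rewrite lee_fin.
have zero : f z.1 = f z.2 -> frac_quot s f f z = 0.
  by move=> e; rewrite /frac_quot e subrr !mul0r.
have [e|ne] := eqVneq (f z.1) (f z.2).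
  by rewrite zero// adde_ge0.
have nz : z.1 - z.2 != 0 by apply: contra_neq ne => /eqP; rewrite subr_eq0 => /eqP ->.
have d0 : 0 < `|z.1 - z.2| by rewrite normr_gt0.
set d := `|z.1 - z.2| in d0 *.
have zK : 1 <= \1_K z.1 + \1_K z.2 :> R.
  rewrite !indicE; have [k1|k1] := boolP (z.1 \in K); first by rewrite lerDl.
  have [k2|k2] := boolP (z.2 \in K); first by rewrite lerDr.
  have nk1 : ~ K z.1 by move=> Kz; move: k1; rewrite mem_set.
  have nk2 : ~ K z.2 by move=> Kz; move: k2; rewrite mem_set.
  by move: ne; rewrite (fK _ nk1) (fK _ nk2) eqxx.
have inband r : d < r -> 1 <= band_weight K r z.
  move=> dr; rewrite /band_weight (_ : \1_(band r) z = 1 :> R) ?mulr1//.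
  rewrite indicE mem_set// => i; rewrite distrC.
  by apply: le_lt_trans dr; have := rV_norm_coord (z.1 - z.2) i; rewrite !mxE.
(* The denominator uses the Euclidean distance, which dominates the sup distance [d]. *)
have quot (A B : R) : (f z.1 - f z.2) ^+ 2 <= A -> 0 < B -> B <= d `^ q ->
    frac_quot s f f z <= A * B^-1.
  move=> hA B0 hB; rewrite /frac_quot -expr2; apply: ler_pM.
  - exact: sqr_ge0.
  - by rewrite invr_ge0 powR_ge0.
  - exact: hA.
  have le0 : 0 < enorm (z.1 - z.2) by apply: lt_le_trans d0 _; exact: norm_le_enorm.
  rewrite lef_pV2 ?posrE ?powR_gt0//; apply: le_trans hB _.
  apply: (@ge0_ler_powR R q); rewrite ?nnegrE.
  - exact: ltW.
  - exact: ltW.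
  - exact: ltW.
  - exact: norm_le_enorm.
have dE : d = expR (ln d) by rewrite lnK.
have dq : d `^ q = expR (q * ln d) by rewrite /powR gt_eqF.
have [d1|d1] := leP d 1.
  (* Here [exp (-(k+1)) < d <= exp (-k)], and the Lipschitz bound gives [|f x - f y| <= L exp (-k)].
     The factor 2 in the radius of the band turns the second inequality into a strict one. *)
  pose k := Num.truncn (- ln d).
  have ln0 : 0 <= - ln d by rewrite oppr_ge0 ln_le0.
  have /andP[k1 k2] : k%:R <= - ln d < k.+1%:R by exact: truncn_itv.
  have dk : d <= expR (- k%:R) by rewrite dE ler_expR; lra.
  apply: le_trans (leeDl _ S20); apply: le_trans (term _ k a0); rewrite lee_fin.
  apply: le_trans (ler_peMr _ (inband (2 * expR (- k%:R)) _)).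
  - rewrite -[expR (k.+1%:R * q)]invrK -expRN; apply: quot.
    + rewrite -real_normK ?num_real// -exprMn lerXn2r ?nnegrE ?mulr_ge0 ?expR_ge0//.
      by apply: le_trans (fL _ _) _; rewrite ler_wpM2l.
    + exact: expR_gt0.
    + by rewrite dq ler_expR; nra.
  - by rewrite !mulr_ge0 ?sqr_ge0 ?expR_ge0.
  - apply: le_lt_trans dk _; rewrite ltr_pMl ?expR_gt0//; lra.
(* Here [exp k <= d < exp (k+1)], and the increment is bounded by [2 M], hence the factor
   [4 M^2]. *)
pose k := Num.truncn (ln d).
have ln0 : 0 <= ln d by rewrite ln_ge0// ltW.
have /andP[k1 k2] : k%:R <= ln d < k.+1%:R by exact: truncn_itv.
apply: le_trans (leeDr _ S10); apply: le_trans (term _ k b0); rewrite lee_fin.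
apply: le_trans (ler_peMr _ (inband (expR k.+1%:R) _)).
- rewrite expRN; apply: quot.
  + rewrite -real_normK ?num_real//.
    have : `|f z.1 - f z.2| <= M + M by apply: le_trans (ler_normB _ _) _; exact: lerD.
    have := normr_ge0 (f z.1 - f z.2); nra.
  + exact: expR_gt0.
  + by rewrite dq ler_expR; nra.
- by rewrite !mulr_ge0 ?sqr_ge0 ?expR_ge0.
- by rewrite dE ltr_expR.
Qed.

Lemma measurable_enorm : measurable_fun setT (@enorm R N).
Proof.
rewrite /enorm; apply: (@measurableT_comp _ _ _ _ _ _ (@Num.sqrt R)).
  by apply: continuous_measurable_fun; exact: sqrt_continuous.
apply: measurable_sum => i; apply: measurable_funX.
exact: measurable_rV_coord.
Qed.

Lemma measurable_frac_quot s u w : measurable_fun setT u -> measurable_fun setT w ->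
  measurable_fun setT (frac_quot s u w).
Proof.
move=> mu mw.
have m1 : measurable_fun setT (fun z : (T * T)%type => u z.1 - u z.2).
  by apply: measurable_funB; [exact: (measurableT_comp mu measurable_fst)|exact: (measurableT_comp mu measurable_snd)].
have m2 : measurable_fun setT (fun z : (T * T)%type => w z.1 - w z.2).
  by apply: measurable_funB; [exact: (measurableT_comp mw measurable_fst)|exact: (measurableT_comp mw measurable_snd)].
have mB : measurable_fun setT (fun z : (T * T)%type => z.1 - z.2).
  apply: measurable_rV_coordP => i; rewrite (_ : _ \o _ = fun z : (T * T)%type => z.1 0 i - z.2 0 i).
    by apply: measurable_funB; [exact: (measurable_rV_comp i measurable_fst)|exact: (measurable_rV_comp i measurable_snd)].
  by apply/funext => z; rewrite /rV_coord/= !mxE.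
have me := measurableT_comp measurable_enorm mB.
apply: measurable_funM; first exact: measurable_funM.
rewrite (_ : (fun z => _) = fun z : (T * T)%type => enorm (z.1 - z.2) `^ (- (N%:R + 2 * s))).
  exact: measurable_fun_powR.
by apply/funext => z; rewrite powRN.
Qed.

(** Both series integrate to geometric ones. In the near shells the band measure, of order
    [exp (-k N)], the squared increment [exp (-2 k)] and the kernel leave the ratio
    [exp (-2 (1 - s))]; in the far shells the ratio is [exp (-2 s)]. Hence the poles at [s = 1] and
    at [s = 0]. *)
Lemma integral_frac_quot_le f : test_function f ->
  exists A B : R, [/\ 0 <= A, 0 <= B & forall s, 0 < s < 1 ->
    (\int[leb2]_z (frac_quot s f f z)%:E <= (A / (1 - s) + B / s)%:E)%E].
Proof.
move=> tf; have [n Kn] := compact_sub_cube tf.2.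
pose K : set T := cube 0 n.+1%:R.
have [M M0 fM] := test_function_bounded tf.
have [L L0 fL] := test_function_lipschitz tf.
have fK x : ~ K x -> f x = 0.
  move=> nx; apply/eqP; apply: contra_notT nx => fx.
  by apply: Kn; exact: subset_closure.
have mf := test_function_measurable tf.
have mK : measurable K := measurable_cube _ _.
pose V : R := (2 * n.+1%:R) ^+ N.
have V0 : 0 <= V by rewrite exprn_ge0// mulr_ge0.
have lebK : leb K = V%:E by exact: leb_cube.
pose A1 : R := L ^+ 2 * 2 * 4 ^+ N * V.
pose B1 : R := 4 * M ^+ 2 * 2 * 2 ^+ N * V * expR N%:R.
have A10 : 0 <= A1 by rewrite /A1 !mulr_ge0 ?sqr_ge0 ?exprn_ge0.
have B10 : 0 <= B1 by rewrite /B1 !mulr_ge0 ?sqr_ge0 ?exprn_ge0 ?expR_ge0.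
(* [exp (N + 2)] bounds [exp (N + 2 s)] uniformly in [s]; the factors 2 come from the geometric
   sums. *)
exists (A1 * expR (N%:R + 2) * 2), (B1 * 2); split.
- by rewrite !mulr_ge0 ?expR_ge0.
- by rewrite mulr_ge0.
move=> s /[dup] hs /andP[s0 s1]; set q := N%:R + 2 * s.
have sE1 k : L ^+ 2 * expR (- k%:R) ^+ 2 * expR (k.+1%:R * q) * (2 * (2 * (2 * expR (- k%:R))) ^+ N * V) =
    A1 * expR q * expR (- (2 * (1 - s))) ^+ k.
  have e1 : expR (- k%:R) ^+ 2 * expR (k.+1%:R * q) * expR (- k%:R) ^+ N = expR q * expR (- (2 * (1 - s))) ^+ k.
    by rewrite -!expRM_natl -!expRD; congr expR; rewrite /q -natr1; ring.
  rewrite (_ : 2 * (2 * expR (- k%:R)) = 4 * expR (- k%:R)); last by ring.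
  rewrite exprMn /A1 -[RHS]mulrA -e1; ring.
have sE2 k : 4 * M ^+ 2 * expR (- (k%:R * q)) * (2 * (2 * expR k.+1%:R) ^+ N * V) =
    B1 * expR (- (2 * s)) ^+ k.
  have e2 : expR (- (k%:R * q)) * expR k.+1%:R ^+ N = expR N%:R * expR (- (2 * s)) ^+ k.
    by rewrite -!expRM_natl -!expRD; congr expR; rewrite /q -natr1; ring.
  rewrite exprMn /B1 -[RHS]mulrA -e2; ring.
pose S1 z := (\sum_(0 <= k <oo) (L ^+ 2 * expR (- k%:R) ^+ 2 * expR (k.+1%:R * q) *
        band_weight K (2 * expR (- k%:R)) z)%:E)%E.
pose S2 z := (\sum_(0 <= k <oo) (4 * M ^+ 2 * expR (- (k%:R * q)) *
        band_weight K (expR k.+1%:R) z)%:E)%E.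
have c1 k : 0 <= L ^+ 2 * expR (- k%:R) ^+ 2 * expR (k.+1%:R * q).
  by rewrite !mulr_ge0 ?sqr_ge0 ?expR_ge0.
have c2 k : 0 <= 4 * M ^+ 2 * expR (- (k%:R * q)).
  by rewrite !mulr_ge0 ?sqr_ge0 ?expR_ge0.
have m1 k : measurable_fun setT (fun z : (T * T)%type => (L ^+ 2 * expR (- k%:R) ^+ 2 * expR (k.+1%:R * q) *
        band_weight K (2 * expR (- k%:R)) z)%:E).
  by apply/measurable_EFinP; apply: measurable_funM => //; exact: measurable_band_weight.
have m2 k : measurable_fun setT (fun z : (T * T)%type => (4 * M ^+ 2 * expR (- (k%:R * q)) *
        band_weight K (expR k.+1%:R) z)%:E).
  by apply/measurable_EFinP; apply: measurable_funM => //; exact: measurable_band_weight.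
have p1 k z : (0 <= (L ^+ 2 * expR (- k%:R) ^+ 2 * expR (k.+1%:R * q) *
        band_weight K (2 * expR (- k%:R)) z)%:E)%E.
  by rewrite lee_fin mulr_ge0// band_weight_ge0.
have p2 k z : (0 <= (4 * M ^+ 2 * expR (- (k%:R * q)) * band_weight K (expR k.+1%:R) z)%:E)%E.
  by rewrite lee_fin mulr_ge0// band_weight_ge0.
have mS1 : measurable_fun setT S1 by exact: ge0_emeasurable_sum.
have mS2 : measurable_fun setT S2 by exact: ge0_emeasurable_sum.
apply: (@le_trans _ _ (\int[leb2]_z (S1 z + S2 z))%E).
  apply: ge0_le_integral => //.
  - by move=> z _; rewrite lee_fin frac_quot_ge0.
  - by apply/measurable_EFinP; exact: measurable_frac_quot.
  - exact: emeasurable_funD.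
  - by move=> z _; exact: frac_quot_le_series.
rewrite ge0_integralD//; last 2 first.
- by move=> z _; exact: nneseries_ge0.
- by move=> z _; exact: nneseries_ge0.
rewrite /S1 /S2 !integral_nneseries//.
have I (c r : R) : 0 <= c -> 0 <= r -> (\int[leb2]_z (c * band_weight K r z)%:E =
    (c * (2 * (2 * r) ^+ N * V))%:E)%E.
  move=> c0 r0; under eq_integral do rewrite EFinM.
  rewrite ge0_integralZl//.
  - by rewrite integral_band_weight// lebK -!EFinM.
  - by apply/measurable_EFinP; exact: measurable_band_weight.
  - by move=> z _; rewrite lee_fin band_weight_ge0.
rewrite EFinD; apply: leeD.
  under eq_eseriesr do rewrite I ?mulr_ge0 ?expR_ge0// sE1.
  apply: le_trans (geometric_expR_le _ _) _.
  - by rewrite mulr_ge0// expR_ge0.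
  - by apply/andP; split; lra.
  - rewrite lee_fin mulrA; apply: ler_wpM2r; first by rewrite invr_ge0 subr_ge0 ltW.
    by rewrite ler_wpM2r// ler_wpM2l// ler_expR /q; lra.
under eq_eseriesr do rewrite I ?expR_ge0// sE2.
apply: le_trans (geometric_expR_le _ _) _ => //.
- by apply/andP; split; lra.
- by rewrite lee_fin mulrA.
Qed.

Lemma test_function_Bform_bounded f : (1 < N)%N -> test_function f ->
  exists2 D : R, 0 <= D & forall s, 0 < s < 1 -> (Bform s f f <= D%:E)%E.
Proof.
move=> N1 tf; have [A [B [A0 B0 AB]]] := integral_frac_quot_le tf.
have [C C0 HC] := @C_frac_le R N N1.
exists (C * (A + B)) => [|s /[dup] hs /andP[s0 s1]]; first by rewrite mulr_ge0// addr_ge0.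
rewrite BformE//; have Cs0 : 0 <= C_frac N s by apply: C_frac_ge0; exact: ltW.
apply: (@le_trans _ _ ((C_frac N s)%:E * (A / (1 - s) + B / s)%:E)%E).
  by apply: lee_wpmul2l; [rewrite lee_fin|exact: AB].
have s10 : 0 < 1 - s by rewrite subr_gt0.
rewrite -EFinM lee_fin; apply: (@le_trans _ _ (C * (s * (1 - s)) * (A / (1 - s) + B / s))).
  apply: ler_wpM2r; last exact: HC.
  by rewrite addr_ge0// mulr_ge0// invr_ge0 ltW.
rewrite -mulrA ler_wpM2l// (_ : s * (1 - s) * _ = A * s + B * (1 - s)).
  by apply: lerD; rewrite ler_piMr//; lra.
by field; rewrite !gt_eqF.
Qed.

End gagliardo.

(** * Monotonicity of the integral and convexity *)

Section integral_monotone.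
Context d (T : measurableType d) (R : realType).
Variable mu : {measure set T -> \bar R}.
Local Open Scope ereal_scope.
Implicit Types (f g : T -> \bar R).

Import HBNNSimple.

Let nnint f := ereal_sup [set sintegral mu h |
  h in [set h : {nnsfun T >-> R} | forall x, (h x)%:E <= f x]].

(** A simple function below [f] is cut down to the complement of the null set [A]: it then lies
    below [g], and its integral is unchanged. *)
Let nnint_le (A : set T) f g : measurable A -> mu A = 0 ->
  (forall x, 0 <= g x) -> (forall x, ~ A x -> f x <= g x) -> nnint f <= nnint g.
Proof.
move=> mA A0 g0 fg; apply: ub_ereal_sup => _ [h hf <-].
have mAC : measurable (~` A) by exact: measurableC.
apply: ereal_sup_ubound; exists (proj_nnsfun h mAC).
  move=> x; rewrite -mrestrict /patch; case: ifPn => [|_ //].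
  by rewrite inE => nAx; apply: le_trans (hf x) (fg x nAx).
rewrite -!integralT_nnsfun; apply: ae_eq_integral => //.
- by apply/measurable_EFinP; exact: measurable_funP.
- by apply/measurable_EFinP; exact: measurable_funP.
exists A; split => // x; apply: contra_notP => nAx _.
by rewrite -mrestrict /patch mem_set.
Qed.

(* The library integral is a difference of suprema over simple functions, so
   it is monotone even on functions that are not measurable. *)
Lemma ae_le_integral (D : set T) f g :
  {ae mu, forall x, D x -> f x <= g x} ->
  \int[mu]_(x in D) f x <= \int[mu]_(x in D) g x.
Proof.
move=> [A [mA A0 fgA]].
have fg x : ~ A x -> (f \_ D) x <= (g \_ D) x.
  move=> nAx; rewrite !patchE; case: ifPn => // /[!inE] Dx.
  by apply: contrapT => nfg; apply: nAx; apply: fgA => /= /(_ Dx).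
rewrite /integral; apply: leeB.
  apply: (nnint_le mA A0) => [x|x nAx]; first exact: funepos_ge0.
  by rewrite !funeposE; apply: le_max2 => //; exact: fg.
apply: (nnint_le mA A0) => [x|x nAx]; first exact: funeneg_ge0.
by rewrite !funenegE; apply: le_max2 => //; rewrite leeN2; exact: fg.
Qed.

End integral_monotone.

Section product_ae.
Context d1 d2 (T1 : measurableType d1) (T2 : measurableType d2) (R : realType).
Variables (m1 : {sigma_finite_measure set T1 -> \bar R})
  (m2 : {sigma_finite_measure set T2 -> \bar R}).

Lemma ae_fst (P : T1 -> Prop) : {ae m1, forall x, P x} ->
  {ae (m1 \x m2)%E, forall z : T1 * T2, P z.1}.
Proof.
move=> [A [mA A0 PA]]; exists (A `*` setT); split.
- exact: measurableX.
- by rewrite product_measure1E//= [X in (X * _)%E]A0 mul0e.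
- by move=> z /= nP; split => //; exact: PA.
Qed.

Lemma ae_snd (P : T2 -> Prop) : {ae m2, forall x, P x} ->
  {ae (m1 \x m2)%E, forall z : T1 * T2, P z.2}.
Proof.
move=> [A [mA A0 PA]]; exists (setT `*` A); split.
- exact: measurableX.
- by rewrite product_measure1E//= [X in (_ * X)%E]A0 mule0.
- by move=> z /= nP; split => //; exact: PA.
Qed.

End product_ae.

(** * Convex functions and their derivatives *)

Section convex_tangent.
Context {R : realType}.
Implicit Types (phi : R -> R).

(** The left side is the limit of the right difference quotients at [a] in the direction [b - a],
    and convexity bounds each of them by [phi b - phi a]. *)
Lemma convex_tangent phi a b : convex_function (setT : set R^o) phi ->
  derivable phi a 1 -> derive1 phi a * (b - a) <= phi b - phi a.
Proof.
move=> cphi dphi; set h := b - a.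
have dh : is_derive a h phi (h * derive1 phi a).
  have dd : differentiable phi a by exact/derivable1_diffP.
  apply: DeriveDef; first exact: diff_derivable.
  by rewrite deriveE// diff1E// /GRing.scale/=.
have cv : (fun t : R => t^-1 *: (phi (t *: h + a) - phi a)) @ 0^'+ --> h * derive1 phi a.
  have [ex <-] := dh; apply: cvg_dnbhs_at_right; exact: ex.
rewrite mulrC; apply: (cvgr_to_le cv); near=> t.
have t0 : 0 < t by near: t; exact: nbhs_right_gt.
have t1 : t <= 1 by near: t; exact: nbhs_right_le.
have c : phi (t * b + (1 - t) * a) <= t * phi b + (1 - t) * phi a.
  have := cphi (Itv01 (ltW t0) t1) b a; rewrite !inE => /(_ I I); exact.
rewrite /GRing.scale/= ler_pdivrMl// (_ : t * h + a = t * b + (1 - t) * a); last first.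
  by rewrite /h; ring.
by move: c; lra.
Unshelve. all: by end_near. Qed.

Lemma convex_derive1_ndecr phi a b : convex_function (setT : set R^o) phi ->
  (forall t, derivable phi t 1) -> a <= b -> derive1 phi a <= derive1 phi b.
Proof.
move=> cphi dphi; rewrite le_eqVlt => /predU1P[->//|ab].
have h1 := convex_tangent b cphi (dphi a).
have h2 := convex_tangent a cphi (dphi b).
have ba : 0 < b - a by rewrite subr_gt0.
rewrite -(ler_pM2r ba); apply: le_trans h1 _; move: h2; rewrite -[a - b]opprB mulrN.
by rewrite lerNl opprB.
Qed.

Lemma convex_derive2_ge0 phi a : convex_function (setT : set R^o) phi ->
  smoothR phi -> 0 <= derive1 (derive1 phi) a.
Proof.
move=> cphi sphi.
have dphi t : derivable phi t 1 by exact: smoothR_derivable.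
have dphi1 : derivable (derive1 phi) a 1 by apply: smoothR_derivable; exact: smoothR_derive1.
have cv : (fun t : R => t^-1 *: (derive1 phi (t *: 1 + a) - derive1 phi a)) @ 0^'+ -->
    derive1 (derive1 phi) a.
  by rewrite [X in _ --> X]derive1E; apply: cvg_dnbhs_at_right; exact: dphi1.
apply: (cvgr_to_ge cv); near=> t.
have t0 : 0 < t by near: t; exact: nbhs_right_gt.
rewrite /GRing.scale/= mulr_ge0// ?invr_ge0 ?(ltW t0)// subr_ge0.
by apply: convex_derive1_ndecr => //; rewrite mulr1 lerDr ltW.
Unshelve. all: by end_near. Qed.

End convex_tangent.

(** * Splitting the endpoints off the unit interval *)

Section unit_interval.
Context {R : realType}.
Variable mu : {finite_measure set (measurableTypeR R) -> \bar R}.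
Implicit Types F : measurableTypeR R -> \bar R.
Local Notation Ioo := (`]0%R, 1%R[%classic : set (measurableTypeR R)).
Local Notation Icc := (`[0%R, 1%R]%classic : set (measurableTypeR R)).
Local Open Scope ereal_scope.

Lemma itv01E : `[0%R, 1%R]%classic = [set 0%R : R] `|` (`]0%R, 1%R[%classic `|` [set 1%R : R]).
Proof.
apply/seteqP; split => [t|t [->|[|->]]] /=; rewrite !in_itv/= ?lexx ?ler01//.
  move=> /andP[]; rewrite le_eqVlt => /predU1P[<- _|t0]; first by left.
  rewrite le_eqVlt => /predU1P[->|t1]; first by right; right.
  by right; left; rewrite t0.
by move=> /andP[/ltW-> /ltW->].
Qed.

Lemma integral_point F (t : R) : 0 <= F t ->
  \int[mu]_(s in [set t]) F s = F t * mu [set t].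
Proof.
move=> F0; rewrite -(integral_cst mu (measurable_set1 t)).
by apply: eq_integral => s; rewrite inE => ->.
Qed.

(** Every function is measurable on a singleton. This covers the endpoints, where [seminorm_sq]
    follows other formulas than inside. *)
Lemma measurable_fun_itv01 F : measurable_fun Ioo F -> measurable_fun Icc F.
Proof.
move=> mF; rewrite itv01E; apply/measurable_funU => //; first exact: measurableU.
split; first exact: measurable_fun_set1.
apply/measurable_funU => //; split => //; exact: measurable_fun_set1.
Qed.

Lemma integral_itv01 F : (forall t, (0 <= t <= 1)%R -> 0 <= F t) -> measurable_fun Ioo F ->
  \int[mu]_(s in `[0%R, 1%R]) F s =
  F 0%R * mu [set 0%R] + (\int[mu]_(s in `]0%R, 1%R[) F s + F 1%R * mu [set 1%R]).
Proof.
move=> F0 mF.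
have F01 t : Icc t -> 0 <= F t by rewrite /= in_itv/=; exact: F0.
have U1 : Ioo `|` [set 1%R] `<=` Icc by rewrite itv01E; exact: subsetUr.
rewrite -!integral_point; [|by apply: F0; rewrite ?lexx ?ler01..].
rewrite -ge0_integral_setU//; last 3 first.
- apply/measurable_funU => //; split => //; exact: measurable_fun_set1.
- by move=> t /U1; exact: F01.
- by apply/disj_setPS => t [] /=; rewrite in_itv/= => /andP[_ t1] /= t1'; move: t1; rewrite t1' ltxx.
rewrite -ge0_integral_setU -?itv01E//.
- exact: measurableU.
- exact: measurable_fun_itv01.
- apply/disj_setPS => t [-> /=] []; first by rewrite in_itv/= ltxx.
  by move/eqP; rewrite eq_sym oner_eq0.
Qed.

End unit_interval.

(** * The energy of H^mu *)

Section joint_measurability.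
Context {R : realType} {N : nat}.
Local Notation leb := (lebesgue_rV N).
Local Notation T := ('rV[R]_N).
Local Notation leb2 := (leb \x leb)%E.
Local Notation S := (measurableTypeR R).
Local Notation Ioo := (`]0%R, 1%R[%classic : set (measurableTypeR R)).
Implicit Types (f u w : T -> R) (s : R).

Lemma measurable_fun_powR2 d (X : measurableType d) (a b : X -> R) :
  measurable_fun setT a -> measurable_fun setT b ->
  measurable_fun setT (fun x => a x `^ b x).
Proof.
move=> ma mb; rewrite /powR; apply: measurable_fun_ifT.
- by apply: measurable_fun_eqr.
- apply: measurableT_comp => //.
  by apply: measurableT_comp => //; apply: measurable_fun_eqr.
- by apply: measurable_fun_expR; apply: measurable_funM => //; exact: measurable_fun_ln.
Qed.

Lemma measurable_frac_quot2 u w : measurable_fun setT u -> measurable_fun setT w ->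
  measurable_fun setT (fun p : (S * (T * T))%type => frac_quot p.1 u w p.2).
Proof.
move=> mu mw.
have m1 : measurable_fun setT (fun z : (T * T)%type => u z.1 - u z.2).
  by apply: measurable_funB; [exact: (measurableT_comp mu measurable_fst)|exact: (measurableT_comp mu measurable_snd)].
have m2 : measurable_fun setT (fun z : (T * T)%type => w z.1 - w z.2).
  by apply: measurable_funB; [exact: (measurableT_comp mw measurable_fst)|exact: (measurableT_comp mw measurable_snd)].
have mB : measurable_fun setT (fun z : (T * T)%type => z.1 - z.2).
  apply: measurable_rV_coordP => i; rewrite (_ : _ \o _ = fun z : (T * T)%type => z.1 0 i - z.2 0 i).
    by apply: measurable_funB; [exact: (measurable_rV_comp i measurable_fst)|exact: (measurable_rV_comp i measurable_snd)].
  by apply/funext => z; rewrite /rV_coord/= !mxE.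
have me := measurableT_comp (measurableT_comp measurable_enorm mB) (measurable_snd : measurable_fun setT (@snd S (T * T)%type)).
have m12 := measurableT_comp (measurable_funM m1 m2) (measurable_snd : measurable_fun setT (@snd S (T * T)%type)).
rewrite (_ : (fun p => _) = fun p : (S * (T * T))%type =>
    ((u p.2.1 - u p.2.2) * (w p.2.1 - w p.2.2)) * enorm (p.2.1 - p.2.2) `^ (- (N%:R + 2 * p.1))).
  apply: (measurable_funM m12); apply: (measurable_fun_powR2 me).
  have mq : measurable_fun setT (fun s : R => - (N%:R + 2 * s)).
    rewrite (_ : (fun s => _) = fun s : R => - N%:R - 2 * s).
      by apply: measurable_funB => //; exact: measurable_funM.
    by apply/funext => s; rewrite opprD.
  exact: (measurableT_comp mq (measurable_fst : measurable_fun setT (@fst S (T * T)%type))).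
by apply/funext => p; rewrite /frac_quot powRN.
Qed.

(** Reassociating [(s, (x, y))] as [((s, x), y)] reduces the claim to two applications of Tonelli's
    theorem with the measure [leb]. *)
Lemma measurable_fun_integral_prod (g : (S * (T * T))%type -> \bar R) :
  measurable_fun setT g -> (forall p, 0 <= g p)%E ->
  measurable_fun setT (fun s : S => \int[leb2]_z g (s, z))%E.
Proof.
move=> mg g0.
pose a (q : ((S * T) * T)%type) : (S * (T * T))%type := (q.1.1, (q.1.2, q.2)).
have ma : measurable_fun setT a.
  apply/measurable_fun_pairP; split => /=.
    exact: (measurableT_comp measurable_fst measurable_fst).
  apply/measurable_fun_pairP; split => /=.
    exact: (measurableT_comp measurable_snd measurable_fst).
  exact: measurable_snd.
have m1 := @measurable_fun_fubini_tonelli_F _ _ (S * T)%type T R leb (g \o a)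
  (measurableT_comp mg ma) (fun q => g0 (a q)).
have p1 q : (0 <= fubini_F leb (g \o a) q)%E by apply: integral_ge0 => y _; exact: g0.
have m2 := @measurable_fun_fubini_tonelli_F _ _ S T R leb _ m1 p1.
apply: eq_measurable_fun m2 => s _; rewrite fubini_tonelli1//.
by apply: (measurableT_comp mg); exact: measurable_pair1.
Qed.

Lemma measurable_Bform u : measurable_fun setT u ->
  measurable_fun Ioo (fun s : S => Bform s u u).
Proof.
move=> mu; pose g (p : (S * (T * T))%type) : \bar R := (frac_quot p.1 u u p.2)%:E.
have mg : measurable_fun setT g.
  by apply/measurable_EFinP; exact: measurable_frac_quot2.
have g0 p : (0 <= g p)%E by rewrite lee_fin frac_quot_ge0.
have mF := measurable_fun_integral_prod mg g0.
have mC : measurable_fun setT (fun s : S => (C_frac N s)%:E).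
  by apply/measurable_EFinP; exact: measurable_C_frac.
apply: eq_measurable_fun (measurable_funTS (emeasurable_funM mC mF)).
by move=> s; rewrite inE/= in_itv/= => s01; rewrite BformE.
Qed.

Lemma Bform_ge0 s u : 0 <= s <= 1 -> (0 <= Bform s u u)%E.
Proof.
move=> /andP[s0 s1]; rewrite /Bform; case: ifPn => _.
  by apply: integral_ge0 => x _; rewrite lee_fin -expr2 sqr_ge0.
case: ifPn => _.
  apply: integral_ge0 => x _; rewrite lee_fin; apply: sumr_ge0 => i _.
  by rewrite -expr2 sqr_ge0.
rewrite mule_ge0// ?lee_fin ?C_frac_ge0//.
by apply: integral_ge0 => z _; rewrite lee_fin; exact: frac_quot_ge0.
Qed.

Lemma seminorm_sq_ge0 s u : 0 <= s <= 1 -> (0 <= seminorm_sq s u)%E.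
Proof. by move=> s01; rewrite /seminorm_sq; case: ifP => // _; exact: Bform_ge0. Qed.

Lemma seminorm_sqE s u : s < 1 -> seminorm_sq s u = Bform s u u.
Proof. by move=> s1; rewrite /seminorm_sq lt_eqF. Qed.

End joint_measurability.

Section energy_space.
Context {R : realType} {N : nat}.
Local Notation leb := (lebesgue_rV N).
Local Notation T := ('rV[R]_N).
Local Notation S := (measurableTypeR R).
Local Notation Ioo := (`]0%R, 1%R[%classic : set (measurableTypeR R)).
Variable mu : {finite_measure set (measurableTypeR R) -> \bar R}.
Implicit Types (u v w : T -> R) (f : nat -> T -> R).
Local Open Scope ereal_scope.

(** The square of [norm_mu]: limits and estimates are carried out without the root. *)
Definition mu_energy u : \bar R :=
  \int[mu]_(s in `[0%R, 1%R]) seminorm_sq s u + \int[leb]_x (u x ^+ 2)%:E.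

Lemma mu_energy_ge0 u : 0 <= mu_energy u.
Proof.
apply: adde_ge0; apply: integral_ge0 => x; last by rewrite lee_fin sqr_ge0.
by rewrite /= in_itv/=; exact: seminorm_sq_ge0.
Qed.

Lemma norm_mu_lt u (e : R) : (0 < e)%R -> (norm_mu mu u < e%:E) <-> (mu_energy u < (e ^+ 2)%:E).
Proof.
move=> e0; rewrite /norm_mu -/(mu_energy u); have := mu_energy_ge0 u.
case: (mu_energy u) => [r|_|//]; last by rewrite poweRyr ?invr_eq0// !ltNge !leey.
rewrite lee_fin => r0; rewrite poweR_EFin !lte_fin powR12_sqrt//.
rewrite -[X in (_ < X)%R <-> _](ger0_norm (ltW e0)) -sqrtr_sqr.
by rewrite ltr_sqrt// exprn_gt0.
Qed.

(** The pieces need different arguments: the atoms at 0 and 1 carry an L^2 norm and a gradient norm,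
    the open interval the fractional forms. *)
Lemma mu_energyE u : measurable_fun setT u ->
  mu_energy u = (\int[leb]_x (u x ^+ 2)%:E) * mu [set 0%R] +
    (\int[mu]_(s in `]0%R, 1%R[) Bform s u u + seminorm_sq 1%R u * mu [set 1%R]) +
    \int[leb]_x (u x ^+ 2)%:E.
Proof.
move=> mu'; rewrite /mu_energy; congr (_ + _).
have E : {in Ioo, (fun s : S => Bform s u u) =1 (fun s : S => seminorm_sq s u)}.
  by move=> s; rewrite inE/= in_itv/= => /andP[_ s1]; rewrite seminorm_sqE.
rewrite integral_itv01; last 2 first.
- by move=> t t01; exact: seminorm_sq_ge0.
- by apply: eq_measurable_fun E _; exact: measurable_Bform.
congr (_ * _ + (_ + _)).
  rewrite seminorm_sqE// /Bform eqxx; apply: eq_integral => x _.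
  by rewrite expr2.
by apply: eq_integral => s /E.
Qed.

Lemma mu_energy_ge u : measurable_fun setT u ->
  [/\ \int[leb]_x (u x ^+ 2)%:E <= mu_energy u,
    \int[mu]_(s in `]0%R, 1%R[) Bform s u u <= mu_energy u &
    seminorm_sq 1%R u * mu [set 1%R] <= mu_energy u].
Proof.
move=> mu'; rewrite mu_energyE//.
have p0 : 0 <= \int[leb]_x (u x ^+ 2)%:E by apply: integral_ge0 => x _; rewrite lee_fin sqr_ge0.
have p1 : 0 <= \int[mu]_(s in `]0%R, 1%R[) Bform s u u.
  by apply: integral_ge0 => s; rewrite /= in_itv/= => /andP[s0 s1]; apply: Bform_ge0; rewrite !ltW.
have p2 : 0 <= seminorm_sq 1%R u * mu [set 1%R].
  by rewrite mule_ge0// seminorm_sq_ge0// lexx ler01.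
have p3 : 0 <= (\int[leb]_x (u x ^+ 2)%:E) * mu [set 0%R] by rewrite mule_ge0.
split.
- by apply: leeDr; apply: adde_ge0 => //; exact: adde_ge0.
- by apply: le_trans (leeDl _ p0); apply: le_trans (leeDr _ p3); rewrite leeDl.
- by apply: le_trans (leeDl _ p0); apply: le_trans (leeDr _ p3); rewrite leeDr.
Qed.

Lemma Hmu_sequence v : Hmu mu v -> exists f, (forall n, test_function (f n)) /\
  forall n, mu_energy (v \- f n)%R <= ((2^-1) ^+ n)%:E.
Proof.
move=> [mv Hv].
have H n : exists g, test_function g /\ mu_energy (v \- g)%R <= ((2^-1) ^+ n)%:E.
  have e0 : (0 < 2^-1 ^+ n :> R)%R by rewrite exprn_gt0// invr_gt0.
  have [g tg /(norm_mu_lt _ e0)/ltW gle] := Hv _ e0.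
  exists g; split => //; apply: le_trans gle _; rewrite lee_fin expr2; apply: ler_piMr; first exact: ltW.
  by rewrite exprn_ile1// invf_le1// ler1n.
have /choice[f Hf] := H; exists f; split => n; by have [] := Hf n.
Qed.

(** The series of the [h_n^2] has integral at most 2, so it is finite almost everywhere and its
    terms tend to 0 there. *)
Lemma ae_cvg0_of_sqr_le d (U : measurableType d) (m : {measure set U -> \bar R})
  (h : nat -> U -> R) : (forall n, measurable_fun setT (h n)) ->
  (forall n, \int[m]_x (h n x ^+ 2)%:E <= ((2^-1) ^+ n)%:E) ->
  {ae m, forall x, h n x @[n --> \oo] --> (0:R)%R}.
Proof.
move=> mh hle.
have mh2 n : measurable_fun setT (fun x => (h n x ^+ 2)%:E).
  by apply/measurable_EFinP; exact: measurable_funX.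
have h20 n x : 0 <= (h n x ^+ 2)%:E by rewrite lee_fin sqr_ge0.
have iS : m.-integrable setT (fun x => \sum_(0 <= n <oo) (h n x ^+ 2)%:E).
  apply/integrableP; split; first exact: ge0_emeasurable_sum.
  under eq_integral do rewrite gee0_abs ?nneseries_ge0//.
  rewrite integral_nneseries//.
  apply: (@le_lt_trans _ _ (\sum_(0 <= n <oo) ((2^-1) ^+ n)%:E)).
    by apply: lee_nneseries => [n _ _|n _]; [exact: integral_ge0|exact: hle].
  apply: (@le_lt_trans _ _ 2%:E); last exact: ltry.
  apply: lime_le; first by apply: is_cvg_nneseries => n _ _; rewrite lee_fin exprn_ge0// invr_ge0.
  apply: nearW => n; rewrite sumEFin lee_fin big_mkord.
  have := @subrX1 R (2^-1)%R n.
  have : (0 <= 2^-1 ^+ n :> R)%R by rewrite exprn_ge0// invr_ge0.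
  lra.
have [A [mA A0 hA]] := integrable_ae measurableT iS.
exists A; split => // x /= nx; apply: hA => /= /(_ I) fin; apply: nx.
have tail := nneseries_tail_cvg (P := xpredT) (f := fun n => (h n x ^+ 2)%:E).
have {}tail : \sum_(n <= k <oo) (h k x ^+ 2)%:E @[n --> \oo] --> 0.
  by apply: tail => // ; rewrite ltey_eq fin.
have {}tail : (h n x ^+ 2)%:E @[n --> \oo] --> 0.
  apply: (cvge0_le _ _ tail) => // ; apply: nearW => n.
  apply: le_trans (nneseries_lim_ge n.+1 _) => [|k _ _ //].
  by rewrite big_nat1.
apply/cvgr0Pnorm_le => e e0.
have e2 : (0 < e ^+ 2)%R by rewrite exprn_gt0.
have := (cvge0P (fun n => h20 n x)).1 tail _ e2.
apply: filterS => n; rewrite lee_fin => hn.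
by rewrite -(ler_pXn2r (ltn0Sn 1)) ?nnegrE// ?(ltW e0)// real_normK ?num_real.
Qed.

End energy_space.

Section fractional_convergence.
Context {R : realType} {N : nat}.
Local Notation leb := (lebesgue_rV N).
Local Notation T := ('rV[R]_N).
Local Notation leb2 := (leb \x leb)%E.
Local Notation S := (measurableTypeR R).
Local Notation Ioo := (`]0%R, 1%R[%classic : set (measurableTypeR R)).
Variable mu : {finite_measure set (measurableTypeR R) -> \bar R}.
Implicit Types (u v w : T -> R) (f : nat -> T -> R) (s : R).

Lemma cvg_half_expr : ((2^-1 : R) ^+ n)%:E @[n --> \oo] --> 0%E.
Proof.
apply: cvg_EFin; first exact: nearW.
apply: cvg_expr; rewrite ger0_norm ?invr_ge0// invf_lt1// ltr1n//.
Qed.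

Lemma Bform_le s u (F : T * T -> R) : 0 < s < 1 -> measurable_fun setT u ->
  measurable_fun setT F -> (forall z, frac_quot s u u z <= F z) ->
  (Bform s u u <= (C_frac N s)%:E * \int[leb2]_z (F z)%:E)%E.
Proof.
move=> /[dup] hs /andP[s0 s1] mu' mF uF; rewrite BformE//.
apply: lee_wpmul2l; first by rewrite lee_fin C_frac_ge0// ltW.
apply: ge0_le_integral => //.
- by move=> z _; rewrite lee_fin frac_quot_ge0.
- by apply/measurable_EFinP; exact: measurable_frac_quot.
- exact/measurable_EFinP.
- by move=> z _; rewrite lee_fin.
Qed.

Lemma Bform_le2 s u w (F : T * T -> R) (a : R) : 0 < s < 1 -> 0 <= a ->
  measurable_fun setT u -> measurable_fun setT w -> measurable_fun setT F ->
  (forall z, 0 <= F z) -> (forall z, frac_quot s u u z <= a * frac_quot s w w z + F z) ->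
  (Bform s u u <= a%:E * Bform s w w + (C_frac N s)%:E * \int[leb2]_z (F z)%:E)%E.
Proof.
move=> /[dup] hs /andP[s0 s1] a0 mu' mw mF F0 uF.
have mw2 := measurable_frac_quot s mw mw.
have maw : measurable_fun setT (fun z => a * frac_quot s w w z) by exact: measurable_funM.
apply: le_trans (Bform_le hs mu' (measurable_funD maw mF) uF) _.
under eq_integral do rewrite EFinD EFinM.
rewrite ge0_integralD//; last 4 first.
- by move=> z _; rewrite -EFinM lee_fin mulr_ge0// frac_quot_ge0.
- by apply: measurable_funeM; exact/measurable_EFinP.
- by move=> z _; rewrite lee_fin.
- exact/measurable_EFinP.
rewrite ge0_integralZl//; last 2 first.
- exact/measurable_EFinP.
- by move=> z _; rewrite lee_fin frac_quot_ge0.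
rewrite ge0_muleDr; last 2 first.
- by rewrite mule_ge0// ?lee_fin//; apply: integral_ge0 => z _; rewrite lee_fin frac_quot_ge0.
- by apply: integral_ge0 => z _; rewrite lee_fin.
by rewrite BformE// muleCA.
Qed.

(** The truncated summand is bounded by the fixed [b] and also by [x], so it inherits a majorant
    from the one and a limit from the other. *)
Lemma le_add_minr (a b x : R) : 0 <= a -> x <= a + b -> x <= a + Num.min x b.
Proof. by move=> a0 xab; rewrite /Num.min; case: ifP => _ //; rewrite lerDr. Qed.

Lemma frac_quot_add_le s u w z :
  frac_quot s (u \+ w) (u \+ w) z <= 2 * frac_quot s u u z + 2 * frac_quot s w w z.
Proof.
rewrite /frac_quot /= !mulrA -mulrDl ler_wpM2r ?invr_ge0 ?powR_ge0//.
set a := u z.1 - u z.2; set b := w z.1 - w z.2.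
rewrite (_ : u z.1 + w z.1 - (u z.2 + w z.2) = a + b); last by rewrite /a /b; ring.
have := sqr_ge0 (a - b); nra.
Qed.

(** Write [v = g + (v - g)]: the form of the test function [g] is bounded in [s] and [mu] is finite,
    while the form of [v - g] has finite integral by assumption. *)
Lemma Bform_fin_integrable v (g : T -> R) : (1 < N)%N -> measurable_fun setT v -> test_function g ->
  (\int[mu]_(s in `]0%R, 1%R[) Bform s (v \- g)%R (v \- g)%R < +oo)%E ->
  mu.-integrable Ioo (fun s : S => Bform s v v).
Proof.
move=> N1 mv tf fin; have mf := test_function_measurable tf.
have mh : measurable_fun setT (v \- g)%R by exact: measurable_funB.
have [D D0 HD] := test_function_Bform_bounded N1 tf.
have mIoo : measurable Ioo by exact: measurable_itv.
have B0 u (s : S) : Ioo s -> (0 <= Bform s u u)%E.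
  by rewrite /= in_itv/= => /andP[s0 s1]; apply: Bform_ge0; rewrite !ltW.
apply/integrableP; split; first exact: measurable_Bform.
under eq_integral => s /[!inE] hs do rewrite gee0_abs ?B0//.
apply: (@le_lt_trans _ _ (\int[mu]_(s in Ioo) ((2 * D)%:E + 2%:E * Bform s (v \- g)%R (v \- g)%R))%E).
  apply: ge0_le_integral => //.
  - by move=> s; exact: B0.
  - exact: measurable_Bform.
  - by apply: emeasurable_funD => //; apply: measurable_funeM; exact: measurable_Bform.
  - move=> s /[dup] hs; rewrite /= in_itv/= => s01.
    have mf2 := measurable_frac_quot s mf mf.
    have mF : measurable_fun setT (fun z => 2 * frac_quot s g g z) by exact: measurable_funM.
    have F0 z : 0 <= 2 * frac_quot s g g z by rewrite mulr_ge0// frac_quot_ge0.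
    have hle z : frac_quot s v v z <= 2 * frac_quot s (v \- g) (v \- g) z + 2 * frac_quot s g g z.
      rewrite addrC; have := frac_quot_add_le s g (v \- g) z.
      by rewrite (_ : g \+ (v \- g) = v)//; apply/funext => x /=; rewrite addrC subrK.
    apply: le_trans (Bform_le2 s01 (ler0n _ 2) mv mh mF F0 hle) _.
    rewrite addeC; apply: leeD => //; under eq_integral do rewrite EFinM.
    rewrite ge0_integralZl//; last 2 first.
    + exact/measurable_EFinP.
    + by move=> z _; rewrite lee_fin frac_quot_ge0.
    by rewrite muleCA -BformE// EFinM; apply: lee_wpmul2l => //; exact: HD.
rewrite ge0_integralD//; last 3 first.
- by move=> s _; rewrite lee_fin mulr_ge0.
- by move=> s hs; rewrite mule_ge0// B0.
- by apply: measurable_funeM; exact: measurable_Bform.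
rewrite integral_cst//= ge0_integralZl//; last 2 first.
- exact: measurable_Bform.
- by move=> s; exact: B0.
rewrite lte_add_pinfty//; apply: lte_mul_pinfty => //.
- by rewrite lee_fin mulr_ge0.
- by rewrite -ge0_fin_numE// fin_num_measure.
Qed.

End fractional_convergence.

(** * Stability of H^mu under smooth composition *)

Section fractional_composition.
Context {R : realType} {N : nat}.
Local Notation leb := (lebesgue_rV N).
Local Notation T := ('rV[R]_N).
Local Notation leb2 := (leb \x leb)%E.
Local Notation S := (measurableTypeR R).
Local Notation Ioo := (`]0%R, 1%R[%classic : set (measurableTypeR R)).
Variable mu : {finite_measure set (measurableTypeR R) -> \bar R}.
Variables (phi : R -> R) (L : R).
Hypotheses (phi_cont : continuous phi) (phi_lip : forall a b, `|phi a - phi b| <= L * `|a - b|).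
Variables (v : T -> R) (f : nat -> T -> R).
Hypotheses (mv : measurable_fun setT v) (mf : forall n, measurable_fun setT (f n)).
Hypothesis fv : {ae leb, forall x, f n x @[n --> \oo] --> v x}.

Let D n : T -> R := (phi \o v) \- (phi \o f n).
Let h n : T -> R := v \- f n.

Let mphi (u : T -> R) : measurable_fun setT u -> measurable_fun setT (phi \o u).
Proof. by move=> mu'; apply: measurableT_comp => //; exact: continuous_measurable_fun. Qed.

Let mD n : measurable_fun setT (D n).
Proof. by apply: measurable_funB; exact: mphi. Qed.

Let mh n : measurable_fun setT (h n). Proof. exact: measurable_funB. Qed.

(* Domination up to a vanishing term: together with the truncation [P n s]
   below, it replaces an integrable majorant of [frac_quot s (D n) (D n)]. *)
Lemma frac_quot_comp_le s n z : frac_quot s (D n) (D n) z <=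
  2 * L ^+ 2 * frac_quot s (h n) (h n) z + 8 * L ^+ 2 * frac_quot s v v z.
Proof.
rewrite /frac_quot !mulrA -mulrDl ler_wpM2r ?invr_ge0 ?powR_ge0//.
rewrite /D /h /= -!mulrA -!expr2.
set a := v z.1; set b := v z.2; set a' := f n z.1; set b' := f n z.2.
have h1 := phi_lip a b; have h2 := phi_lip a' b'.
have h3 : `|phi a - phi a' - (phi b - phi b')| <= `|phi a - phi b| + `|phi a' - phi b'|.
  rewrite (_ : _ - _ - _ = phi a - phi b - (phi a' - phi b')); last by ring.
  exact: ler_normB.
have h4 : `|a' - b'| <= `|a - b| + `|a - a' - (b - b')|.
  rewrite (_ : a' - b' = a - b - (a - a' - (b - b'))); last by ring.
  exact: ler_normB.
have L0 : 0 <= L.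
  have := phi_lip 1 0; rewrite subr0 normr1 mulr1; exact: le_trans.
rewrite -(real_normK (num_real (phi a - phi a' - (phi b - phi b')))).
rewrite -(real_normK (num_real (a - a' - (b - b')))) -(real_normK (num_real (a - b))).
set X := `|_ - _ - (_ - _)|; set Y := `|a - a' - _|; set Z := `|a - b|.
have X0 : 0 <= X := normr_ge0 _.
have Y0 : 0 <= Y := normr_ge0 _.
have Z0 : 0 <= Z := normr_ge0 _.
(* The increment of [f n] is at most [Z + Y] and that of [v] is [Z]. The constants 2 and 8 come from
   [(2 Z + Y)^2 <= 8 Z^2 + 2 Y^2]. *)
have XYZ : X <= L * (2 * Z + Y).
  rewrite /X; apply: le_trans h3 _; apply: le_trans (lerD h1 h2) _.
  by rewrite -mulrDr ler_wpM2l//; move: h4; rewrite -/Z -/Y; lra.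
have X2 : X ^+ 2 <= (L * (2 * Z + Y)) ^+ 2 by rewrite lerXn2r// nnegrE (le_trans X0).
apply: le_trans X2 _; rewrite exprMn.
have L2 : 0 <= L ^+ 2 by rewrite sqr_ge0.
rewrite [leRHS](_ : _ = L ^+ 2 * (2 * Y ^+ 2 + 8 * Z ^+ 2)); last by ring.
rewrite ler_wpM2l//.
have := sqr_ge0 (2 * Z - Y); nra.
Qed.

Let P n (s : S) (z : T * T) : R :=
  Num.min (frac_quot s (D n) (D n) z) (8 * L ^+ 2 * frac_quot s v v z).

Let P_ge0 n s z : 0 <= P n s z.
Proof. by rewrite /P le_min frac_quot_ge0 mulr_ge0 ?frac_quot_ge0// mulr_ge0// sqr_ge0. Qed.

Let mP n s : measurable_fun setT (P n s).
Proof.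
apply: measurable_minr; first exact: measurable_frac_quot.
by apply: measurable_funM => //; exact: measurable_frac_quot.
Qed.

Let mP2 n : measurable_fun setT (fun p : (S * (T * T))%type => P n p.1 p.2).
Proof.
apply: measurable_minr; first exact: measurable_frac_quot2.
by apply: measurable_funM => //; exact: measurable_frac_quot2.
Qed.

Let mJ n : measurable_fun setT (fun s : S => \int[leb2]_z (P n s z)%:E)%E.
Proof.
apply: (@measurable_fun_integral_prod R N (fun p => (P n p.1 p.2)%:E)).
  exact/measurable_EFinP.
by move=> p; rewrite lee_fin.
Qed.

Let P_cvg s : {ae leb2, forall z : T * T, setT z -> (P n s z)%:E @[n --> \oo] --> 0%E}.
Proof.
have Dx x : f n x @[n --> \oo] --> v x -> D n x @[n --> \oo] --> (0 : R).
  move=> fx; rewrite -[X in _ --> X](subrr (phi (v x))) /D.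
  apply: cvgB; first exact: cvg_cst.
  by apply: (@continuous_cvg _ _ _ _ _ _ phi) => //; exact: phi_cont.
have a1 : {ae leb2, forall z : T * T, f n z.1 @[n --> \oo] --> v z.1} := ae_fst leb fv.
have a2 : {ae leb2, forall z : T * T, f n z.2 @[n --> \oo] --> v z.2} := ae_snd leb fv.
apply: filterS2 a1 a2 => z /Dx D1 /Dx D2 _.
apply: cvg_EFin; first exact: nearW.
have c : frac_quot s (D n) (D n) z @[n --> \oo] --> (0 : R).
  have D12 : D n z.1 - D n z.2 @[n --> \oo] --> (0 : R).
    by rewrite -[X in _ --> X](subrr (0 : R)); exact: cvgB.
  have D1212 : (D n z.1 - D n z.2) * (D n z.1 - D n z.2) @[n --> \oo] --> (0 : R).
    by rewrite -[X in _ --> X](mulr0 (0 : R)); exact: cvgM.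
  by rewrite -[X in _ --> X](mul0r (enorm (z.1 - z.2) `^ (N%:R + 2 * s))^-1); exact: cvgM D1212 (cvg_cst _).
apply: squeeze_cvgr c; last exact: cvg_cst.
by apply: nearW => n; rewrite P_ge0 ge_min lexx.
Qed.

Let Jcvg s : 0 < s < 1 -> (Bform s v v < +oo)%E ->
  ((C_frac N s)%:E * \int[leb2]_z (P n s z)%:E @[n --> \oo] --> 0)%E.
Proof.
move=> /[dup] hs /andP[s0 s1]; rewrite BformE// => Bfin.
have C0 : 0 <= C_frac N s by rewrite C_frac_ge0// ltW.
(* With a zero constant, finiteness of the form would say nothing about the double integral, but
   then the product is 0 anyway. *)
have [->|Cn0] := eqVneq (C_frac N s) 0.
  by apply: cvg_near_cst; apply: nearW => n; rewrite mul0e.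
have Cp : 0 < C_frac N s by rewrite lt_neqAle eq_sym Cn0.
have I0 : (0 <= \int[leb2]_z (frac_quot s v v z)%:E)%E.
  by apply: integral_ge0 => z _; rewrite lee_fin frac_quot_ge0.
have Ifin : (\int[leb2]_z (frac_quot s v v z)%:E < +oo)%E.
  rewrite ltey; apply/eqP => Ioo; move: Bfin; rewrite Ioo gt0_muley ?lte_fin// ltxx//.
apply: cvge0Z.
have mg := measurable_frac_quot s mv mv.
have ig : leb2.-integrable setT (fun z => ((8 * L ^+ 2)%:E * (frac_quot s v v z)%:E)%E).
  apply: integrableZl => //; apply/integrableP; split; first exact/measurable_EFinP.
  under eq_integral do rewrite gee0_abs ?lee_fin ?frac_quot_ge0//.
  exact: Ifin.
have [|||_ _ cv] := @dominated_convergence _ _ _ leb2 setT measurableT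
  (fun n z => (P n s z)%:E) (cst 0%E) _ _ _ (P_cvg s) ig.
- by move=> n; exact/measurable_EFinP.
- exact: measurable_cst.
- apply: aeW => z n _; rewrite gee0_abs ?lee_fin//.
  by rewrite /P ge_min lexx orbT.
by rewrite integral0 in cv.
Qed.

Lemma cvg_frac_comp : mu.-integrable Ioo (fun s : S => Bform s v v) ->
  (\int[mu]_(s in `]0%R, 1%R[) Bform s (h n) (h n) @[n --> \oo] --> 0)%E ->
  (\int[mu]_(s in `]0%R, 1%R[) Bform s (D n) (D n) @[n --> \oo] --> 0)%E.
Proof.
move=> iv hcv.
have mIoo : measurable Ioo by exact: measurable_itv.
have B0 u (s : S) : Ioo s -> (0 <= Bform s u u)%E.
  by rewrite /= in_itv/= => /andP[s0 s1]; apply: Bform_ge0; rewrite !ltW.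
have L2 : 0 <= 2 * L ^+ 2 by rewrite mulr_ge0// sqr_ge0.
have L8 : 0 <= 8 * L ^+ 2 by rewrite mulr_ge0// sqr_ge0.
pose J n (s : S) := ((C_frac N s)%:E * \int[leb2]_z (P n s z)%:E)%E.
have mJn n : measurable_fun setT (J n).
  by apply: emeasurable_funM => //; apply/measurable_EFinP; exact: measurable_C_frac.
have J0 n s : Ioo s -> (0 <= J n s)%E.
  rewrite /= in_itv/= => /andP[s0 _]; rewrite mule_ge0// ?lee_fin ?(C_frac_ge0 _ (ltW s0))//.
  by apply: integral_ge0 => z _; rewrite lee_fin.
have Jle n s : Ioo s -> (J n s <= (8 * L ^+ 2)%:E * Bform s v v)%E.
  rewrite /= in_itv/= => /[dup] hs /andP[s0 _]; rewrite BformE// muleCA.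
  apply: lee_wpmul2l; first by rewrite lee_fin C_frac_ge0// ltW.
  rewrite -ge0_integralZl//; last 2 first.
  - by apply/measurable_EFinP; exact: measurable_frac_quot.
  - by move=> z _; rewrite lee_fin frac_quot_ge0.
  apply: ge0_le_integral => //.
  - by move=> z _; rewrite lee_fin.
  - exact/measurable_EFinP.
  - by apply: measurable_funeM; apply/measurable_EFinP; exact: measurable_frac_quot.
  - by move=> z _; rewrite -EFinM lee_fin /P ge_min lexx orbT.
(* Outer dominated convergence. Integrability of [Bform s v v] provides the majorant, and also its
   finiteness for almost every [s], which the inner limit [Jcvg] requires. *)
have [||||_ _ Jcv] := @dominated_convergence _ _ _ mu Ioo mIoo J (cst 0%E)
  (fun s : S => ((8 * L ^+ 2)%:E * Bform s v v)%E) (fun n => measurable_funTS (mJn n)).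
- exact: measurable_cst.
- have := integrable_ae mIoo iv; apply: filterS => s hs /[dup] Is; rewrite /= in_itv/= => s01.
  by apply: Jcvg => //; rewrite -ge0_fin_numE; [exact: hs|exact: B0].
- exact: integrableZl.
- by apply: aeW => s n Is; rewrite gee0_abs; [exact: Jle|exact: J0].
rewrite integral0 in Jcv.
apply: cvge0_le (cvge0D (cvge0Z (2 * L ^+ 2) hcv) Jcv).
  by move=> n; apply: integral_ge0 => s; exact: B0.
apply: nearW => n; rewrite -ge0_integralZl//; last 2 first.
- exact: measurable_Bform.
- by move=> s; exact: B0.
rewrite -ge0_integralD//; last 4 first.
- by move=> s Is; rewrite mule_ge0// B0.
- by apply: measurable_funeM; exact: measurable_Bform.
- exact: J0.
- exact: measurable_funTS.
apply: ge0_le_integral => //.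
- by move=> s; exact: B0.
- exact: measurable_Bform.
- apply: emeasurable_funD; last exact: measurable_funTS.
  by apply: measurable_funeM; exact: measurable_Bform.
- move=> s /=; rewrite in_itv/= => s01.
  apply: (Bform_le2 s01 L2 (mD n) (mh n) (mP n s) (P_ge0 n s)) => z.
  rewrite /P; apply: le_add_minr; last exact: frac_quot_comp_le.
  by rewrite mulr_ge0// frac_quot_ge0.
Qed.

End fractional_composition.

Section energy_convergence.
Context {R : realType} {N : nat}.
Local Notation leb := (lebesgue_rV N).
Local Notation T := ('rV[R]_N).
Variable mu : {finite_measure set (measurableTypeR R) -> \bar R}.
Implicit Types (u v w : T -> R).

Lemma weak_partial_sqr_le u (i : 'I_N) : (forall i, measurable_fun setT (weak_partial i u)) ->
  (\int[leb]_x (weak_partial i u x ^+ 2)%:E <= Bform 1 u u)%E.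
Proof.
move=> mw; rewrite /Bform oner_eq0 eqxx; apply: ge0_le_integral => //.
- by move=> x _; rewrite lee_fin sqr_ge0.
- by apply/measurable_EFinP; exact: measurable_funX.
- apply/measurable_EFinP; apply: measurable_sum => j; exact: measurable_funM.
- move=> x _; rewrite lee_fin [leRHS](bigD1 i)//= expr2 lerDl.
  by apply: sumr_ge0 => j _; rewrite -expr2 sqr_ge0.
Qed.

Variables (v : T -> R) (f : nat -> T -> R).
Hypotheses (mv : measurable_fun setT v) (tf : forall n, test_function (f n)).
Hypothesis vf : forall n, (mu_energy mu (v \- f n)%R <= ((2^-1) ^+ n)%:E)%E.

Let mf n : measurable_fun setT (f n). Proof. exact: test_function_measurable. Qed.
Let mh n : measurable_fun setT (v \- f n). Proof. exact: measurable_funB. Qed.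

Lemma energy_L2_cvg : (\int[leb]_x ((f n x - v x) ^+ 2)%:E @[n --> \oo] --> 0)%E.
Proof.
apply: cvge0_le (cvg_half_expr) ; first by move=> n; apply: integral_ge0 => x _; rewrite lee_fin sqr_ge0.
apply: nearW => n; have [h _ _] := mu_energy_ge mu (mh n).
apply: le_trans (vf n); apply: le_trans h.
by under eq_integral do rewrite -sqrrN opprB.
Qed.

Lemma energy_ae_cvg : {ae leb, forall x, f n x @[n --> \oo] --> v x}.
Proof.
have := @ae_cvg0_of_sqr_le _ _ _ leb (fun n => v \- f n) mh.
have h n : (\int[leb]_x ((v \- f n)%R x ^+ 2)%:E <= (2^-1 ^+ n)%:E)%E.
  by have [h _ _] := mu_energy_ge mu (mh n); exact: le_trans (vf n).
move=> /(_ h); apply: filterS => x c.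
rewrite (_ : (fun n => f n x) = fun n => v x - (v \- f n) x); last first.
  by apply/funext => n /=; rewrite opprB addrC subrK.
by rewrite -[X in _ --> X]subr0; apply: cvgB => //; exact: cvg_cst.
Qed.

Lemma energy_frac_cvg :
  (\int[mu]_(s in `]0%R, 1%R[) Bform s (v \- f n)%R (v \- f n)%R @[n --> \oo] --> 0)%E.
Proof.
apply: cvge0_le cvg_half_expr.
  by move=> n; apply: integral_ge0 => s; rewrite /= in_itv/= => /andP[s0 s1]; apply: Bform_ge0; rewrite !ltW.
by apply: nearW => n; have [_ h _] := mu_energy_ge mu (mh n); exact: le_trans (vf n).
Qed.

(** With an atom at 1, finite energy forces [v - f n] to have a weak gradient, since the seminorm
    would otherwise be infinite; adding the gradient of the test function gives one for [v]. *)
Lemma energy_H1_approx : (0 < mu [set 1%R])%E -> H1_approx v (weak_partial^~ v) f.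
Proof.
move=> m1; have m1fin : mu [set 1%R] \is a fin_num by exact: fin_num_measure.
have m1p : 0 < fine (mu [set 1%R]) by rewrite fine_gt0// m1 -ge0_fin_numE.
have sem n : (seminorm_sq 1 (v \- f n)%R <= ((fine (mu [set 1%R]))^-1)%:E * (2^-1 ^+ n)%:E)%E.
  have [_ _ h] := mu_energy_ge mu (mh n).
  rewrite lee_pdivlMl//; apply: le_trans (vf n); rewrite muleC fineK//.
have wd n i : exists g, is_weak_partial i (v \- f n) g.
  have : weakly_differentiable (v \- f n).
    apply: contrapT => nwd; have := sem n; rewrite /seminorm_sq eqxx.
    by case: asboolP => //= _; rewrite -EFinM leye_eq.
  exact.
have wpv i : is_weak_partial i v (weak_partial i v).
  have [g hg] := wd 0%N i; apply: weak_partialP.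
  have := is_weak_partialD hg (test_weak_partial i (tf 0%N)).
  by rewrite (_ : v \- f 0%N \+ f 0%N = v); [exact|apply/funext => x /=; rewrite subrK].
have mwp i : measurable_fun setT (weak_partial i v).
  by have [_ h _] := wpv i; exact: loc_integrable_measurable.
have mwh n i : measurable_fun setT (weak_partial i (v \- f n)).
  by have [g /weak_partialP[_ h _]] := wd n i; exact: loc_integrable_measurable.
split => //.
- exact: energy_L2_cvg.
- move=> i; apply: cvge0_le (cvge0Z (fine (mu [set 1%R]))^-1 cvg_half_expr).
    by move=> n; apply: integral_ge0 => x _; rewrite lee_fin sqr_ge0.
  apply: nearW => n; have df := test_function_measurable (test_function_partial i (tf n)).
  apply: le_trans (sem n); rewrite /seminorm_sq eqxx; case: asboolP => [_|_ /=]; last by rewrite leey.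
  apply: le_trans (weak_partial_sqr_le i (mwh n)).
  (* The derivative chosen for the difference agrees only almost everywhere with the difference of
     the derivatives. *)
  apply: ae_le_integral; have h := is_weak_partialB (wpv i) (test_weak_partial i (tf n)).
  by apply: filterS (weak_partial_ae h) => x -> _; rewrite /= -sqrrN opprB.
- exact: energy_ae_cvg.
Qed.

End energy_convergence.

Section smooth_composition.
Context {R : realType} {N : nat}.
Local Notation leb := (lebesgue_rV N).
Local Notation T := ('rV[R]_N).
Variable mu : {finite_measure set (measurableTypeR R) -> \bar R}.
Implicit Types (u v w : T -> R) (f : nat -> T -> R).

(** The chosen derivatives agree almost everywhere with any given ones, so the seminorm can be
    estimated through an explicit gradient. *)
Lemma seminorm_sq1_le u (g : 'I_N -> T -> R) : (forall i, is_weak_partial i u (g i)) ->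
  (seminorm_sq 1 u <= \sum_(i < N) \int[leb]_x (g i x ^+ 2)%:E)%E.
Proof.
move=> ug; have wd : weakly_differentiable u by move=> i; exists (g i).
have mw i : measurable_fun setT (weak_partial i u).
  by have [_ h _] := weak_partialP (ug i); exact: loc_integrable_measurable.
rewrite /seminorm_sq eqxx asboolT//= /Bform oner_eq0 eqxx.
rewrite (eq_integral (fun x => \sum_(i < N) (weak_partial i u x ^+ 2)%:E)%E); last first.
  by move=> x _; rewrite sumEFin; congr EFin; apply: eq_bigr => i _; rewrite expr2.
rewrite ge0_integral_sum//; last 2 first.
- by move=> i; apply/measurable_EFinP; exact: measurable_funX.
- by move=> i x _; rewrite lee_fin sqr_ge0.
apply: lee_sum => i _; apply: ae_le_integral.
by apply: filterS (weak_partial_ae (ug i)) => x -> _.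
Qed.

Variables (p : R -> R) (L : R).
Hypotheses (sp : smoothR p) (p1L : forall t, `|derive1 p t| <= L) (p0 : p 0 = 0).

Let p_lip := smoothR_lipschitz sp p1L.

Lemma cvg_L2_comp v f : measurable_fun setT v -> (forall n, measurable_fun setT (f n)) ->
  (\int[leb]_x ((f n x - v x) ^+ 2)%:E @[n --> \oo] --> 0)%E ->
  (\int[leb]_x (((p \o v) \- (p \o f n))%R x ^+ 2)%:E @[n --> \oo] --> 0)%E.
Proof.
move=> mv mf fv; apply: cvge0_le (cvge0Z (L ^+ 2) fv).
  by move=> n; apply: integral_ge0 => x _; rewrite lee_fin sqr_ge0.
have mp u : measurable_fun setT u -> measurable_fun setT (p \o u).
  exact: measurable_smoothR_comp.
apply: nearW => n; rewrite -ge0_integralZl//; last 3 first.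
- by apply/measurable_EFinP; apply: measurable_funX; exact: measurable_funB.
- by move=> x _; rewrite lee_fin sqr_ge0.
- by rewrite lee_fin sqr_ge0.
apply: ge0_le_integral => //.
- by move=> x _; rewrite lee_fin sqr_ge0.
- by apply/measurable_EFinP; apply: measurable_funX; apply: measurable_funB; exact: mp.
- by apply: measurable_funeM; apply/measurable_EFinP; apply: measurable_funX; exact: measurable_funB.
- move=> x _; rewrite -EFinM lee_fin -exprMn -real_normK ?num_real//.
  rewrite -[leRHS]real_normK ?num_real// lerXn2r ?nnegrE//.
  have L0 : 0 <= L by apply: le_trans (p1L 0).
  by rewrite normrM (ger0_norm L0) [`|f n x - v x|]distrC; exact: p_lip.
Qed.

Lemma cvg_seminorm1_comp v g f : H1_approx v g f ->
  (seminorm_sq 1 ((p \o v) \- (p \o f n))%R @[n --> \oo] --> 0)%E.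
Proof.
move=> hv; have [[mv mg] tf _ _ _] := hv.
have c := cvge0_sum (index_enum 'I_N) (fun i => cvg_grad_chain sp p1L i hv).
apply: cvge0_le c; first by move=> n; apply: seminorm_sq_ge0; rewrite lexx ler01.
apply: nearW => n.
have h i := is_weak_partialB (weak_partial_chain sp p1L i p0 hv)
  (test_weak_partial i (test_function_comp sp p0 (tf n))).
apply: le_trans (seminorm_sq1_le h) _; apply: lee_sum => i _.
rewrite le_eqVlt; apply/orP; left; apply/eqP; apply: eq_integral => x _ /=.
rewrite partial_comp; [|exact: smooth_differentiable (tf n).1|exact: smoothR_derivable].
by rewrite -sqrrN opprB.
Qed.

(** The functions [p \o f n] are themselves the approximating test functions; each piece of the
    energy of [p \o v - p \o f n] is shown to vanish in the limit. *)
Lemma Hmu_smooth_comp v : (1 < N)%N -> Hmu mu v -> Hmu mu (p \o v).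
Proof.
move=> N1 /[dup] -[mv _] /Hmu_sequence[f [tf vf]].
have mf n := test_function_measurable (tf n).
have mp u : measurable_fun setT u -> measurable_fun setT (p \o u).
  exact: measurable_smoothR_comp.
split; first exact: mp.
have fL2 := energy_L2_cvg mv tf vf.
have cL2 := cvg_L2_comp mv mf fL2.
have ffrac := energy_frac_cvg mv tf vf.
have mh0 : measurable_fun setT (v \- f 0%N) by exact: measurable_funB.
have fin0 : (\int[mu]_(s in `]0%R, 1%R[) Bform s (v \- f 0%N)%R (v \- f 0%N)%R < +oo)%E.
  have [_ h _] := mu_energy_ge mu mh0.
  by apply: le_lt_trans h _; apply: le_lt_trans (vf 0%N) _; exact: ltry.
have iB := Bform_fin_integrable N1 mv (tf 0%N) fin0.
have cfrac := cvg_frac_comp (smoothR_continuous sp) p_lip mv mf (energy_ae_cvg mv tf vf) iB ffrac.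
have cH1 : (seminorm_sq 1 ((p \o v) \- (p \o f n))%R * mu [set 1%R] @[n --> \oo] --> 0)%E.
  (* Without an atom at 1 the product is 0 even where the seminorm is infinite. *)
  have [m0|m0] := eqVneq (mu [set 1%R : R]) 0%E.
    by apply: cvg_near_cst; apply: nearW => n; rewrite m0 mule0.
  have m1 : (0 < mu [set 1%R : R])%E by rewrite lt_neqAle eq_sym m0/=.
  have m1f : mu [set 1%R : R] \is a fin_num by exact: fin_num_measure.
  under eq_cvg do rewrite -(fineK m1f) muleC.
  have := cvge0Z (fine (mu [set 1%R : R])) (cvg_seminorm1_comp (energy_H1_approx mv tf vf m1)).
  exact.
have cE : (mu_energy mu ((p \o v) \- (p \o f n))%R @[n --> \oo] --> 0)%E.
  have m0f : mu [set 0%R : R] \is a fin_num by exact: fin_num_measure.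
  have := cvge0D (cvge0D (cvge0Z (fine (mu [set 0%R : R])) cL2) (cvge0D cfrac cH1)) cL2.
  apply: cvg_trans; apply: near_eq_cvg; apply: nearW => n.
  rewrite mu_energyE; last by apply: measurable_funB; exact: mp.
  by rewrite fineK// [in RHS]muleC.
(* Half of [e^2], because the limit provides a weak inequality and [Hmu] asks for a strict one. *)
move=> e e0; have e2 : 0 < e ^+ 2 / 2 by rewrite divr_gt0// exprn_gt0.
have [n _ /(_ _ (leqnn _)) hn] := (cvge0P (fun n => mu_energy_ge0 mu _)).1 cE _ e2.
exists (p \o f n); first exact: test_function_comp.
apply/norm_mu_lt => //; apply: le_lt_trans hn _; rewrite lte_fin.
by rewrite ltr_pdivrMr// ltr_pMr ?exprn_gt0// ltr1n.
Qed.

End smooth_composition.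

(** * The convexity inequality *)

Section convex_inequality.
Context {R : realType} {N : nat}.
Local Notation leb := (lebesgue_rV N).
Local Notation T := ('rV[R]_N).
Implicit Types (v w : T -> R) (s : R).
Variables (p : R -> R) (L : R).
Hypotheses (sp : smoothR p) (cp : convex_function (setT : set R^o) p)
  (p1L : forall t, `|derive1 p t| <= L) (p2L : forall t, `|derive1 (derive1 p) t| <= L)
  (p0 : p 0 = 0).

Lemma Bform0_comp_le v w : {ae leb, forall x, 0 <= w x} ->
  (Bform 0 (p \o v) w <= Bform 0 v (fun x => derive1 p (v x) * w x)%R)%E.
Proof.
move=> w0; rewrite /Bform eqxx; apply: ae_le_integral.
apply: filterS w0 => x wx _; rewrite lee_fin /= mulrA ler_wpM2r//.
have := convex_tangent 0 cp (@smoothR_derivable R p (v x) sp); rewrite p0; lra.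
Qed.

Lemma Bform_frac_comp_le s v w : 0 < s < 1 -> {ae leb, forall x, 0 <= w x} ->
  (Bform s (p \o v) w <= Bform s v (fun x => derive1 p (v x) * w x)%R)%E.
Proof.
move=> /[dup] s01 /andP[s0 _] w0; rewrite !BformE//.
apply: lee_wpmul2l; first by rewrite lee_fin C_frac_ge0// ltW.
have w1 : {ae (leb \x leb)%E, forall z : T * T, 0 <= w z.1} := ae_fst leb w0.
have w2 : {ae (leb \x leb)%E, forall z : T * T, 0 <= w z.2} := ae_snd leb w0.
apply: ae_le_integral; apply: filterS2 w1 w2 => z z1 z2 _.
rewrite lee_fin /frac_quot ler_wpM2r ?invr_ge0 ?powR_ge0//=.
set a := v z.1; set b := v z.2.
have h1 := convex_tangent b cp (@smoothR_derivable R p a sp).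
have h2 := convex_tangent a cp (@smoothR_derivable R p b sp).
have k1 := ler_wpM2r z1 h1; have k2 := ler_wpM2r z2 h2.
nra.
Qed.

Lemma Bform1_comp_le v w f k : H1_approx v (weak_partial^~ v) f ->
  H1_approx w (weak_partial^~ w) k -> {ae leb, forall x, 0 <= w x} ->
  (Bform 1 (p \o v) w <= Bform 1 v (fun x => derive1 p (v x) * w x)%R)%E.
Proof.
move=> hv hw w0; rewrite /Bform oner_eq0 eqxx; apply: ae_le_integral.
have c1 : {ae leb, forall x, forall i : 'I_N, weak_partial i (p \o v) x =
    derive1 p (v x) * weak_partial i v x}.
  by apply: filter_forall => i; exact: weak_partial_ae (weak_partial_chain sp p1L i p0 hv).
have c2 : {ae leb, forall x, forall i : 'I_N,
    weak_partial i (fun x => derive1 p (v x) * w x) x = derive1 p (v x) * weak_partial i w x +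
    derive1 (derive1 p) (v x) * (weak_partial i v x * w x)}.
  by apply: filter_forall => i; exact: weak_partial_ae (weak_partial_derive1M sp p1L p2L i hv hw).
apply: filterS3 w0 c1 c2 => x wx e1 e2 _; rewrite lee_fin; apply: ler_sum => i _.
rewrite e1 e2 mulrDr mulrA [_ * derive1 p _]mulrC lerDl.
rewrite [leRHS](_ : _ = derive1 (derive1 p) (v x) * w x * weak_partial i v x ^+ 2); last by ring.
by rewrite mulr_ge0 ?sqr_ge0// mulr_ge0// convex_derive2_ge0.
Qed.

End convex_inequality.

Theorem proposition4p5 (R : realType) (N : nat) (hN : (3 <= N)%N)
    (mu : {finite_measure set (measurableTypeR R) -> \bar R})
    (sbar : R) (hsbar : 0 < sbar <= 1) (hmu : (0 < mu `[sbar, 1%R]%classic)%E)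
    (phi : R -> R) (phi_ge0 : forall t, 0 <= phi t)
    (phi_smooth : smoothR phi)
    (phi_convex : convex_function (setT : set R^o) phi)
    (phi_neg : forall t : R, t <= 0 -> phi t = 0)
    (L : R) (hL : 0 <= L)
    (phi_L : forall t, `|derive1 phi t| + `|derive1n 2 phi t| <= L)
    (v : 'rV[R]_N -> R) (hv : Hmu mu v)
    (v_ge0 : {ae lebesgue_rV N, forall x, 0 <= v x}) :
  Hmu mu (phi \o v) /\
  forall w : 'rV[R]_N -> R, Hmu mu w ->
    {ae lebesgue_rV N, forall x, 0 <= w x} ->
    (\int[mu]_(s in `[0%R, 1%R]) Bform s (phi \o v) w <=
     \int[mu]_(s in `[0%R, 1%R]) Bform s v (fun x => derive1 phi (v x) * w x)%R)%E.
Proof.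
have p0 : phi 0 = 0 by exact: phi_neg.
have p1L t : `|derive1 phi t| <= L by apply: le_trans (phi_L t); rewrite lerDl.
have p2L t : `|derive1 (derive1 phi) t| <= L by apply: le_trans (phi_L t); rewrite lerDr.
split=> [|w hw w0]; first exact: (Hmu_smooth_comp phi_smooth p1L p0 (ltnW hN) hv).
have le_s (s : R) : 0 <= s <= 1 -> (s != 1) || (0 < mu [set 1%R : R])%E ->
    (Bform s (phi \o v) w <= Bform s v (fun x => derive1 phi (v x) * w x)%R)%E.
  move=> /andP[]; rewrite le_eqVlt => /predU1P[<- _ _|s0]; first exact: Bform0_comp_le.
  rewrite le_eqVlt => /predU1P[-> /=|s1 _]; last by apply: Bform_frac_comp_le; rewrite // s0.
  rewrite eqxx /= => m1.
  have [f [tf vf]] := Hmu_sequence hv; have [k [tk wk]] := Hmu_sequence hw.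
  by apply: (Bform1_comp_le phi_smooth phi_convex p1L p2L p0
    (energy_H1_approx hv.1 tf vf m1) (energy_H1_approx hw.1 tk wk m1)).
apply: ae_le_integral; have [m0|m0] := eqVneq (mu [set 1%R : R]) 0%E; last first.
  apply: aeW => s; rewrite /= in_itv/= => s01; apply: le_s => //.
  by apply/orP; right; rewrite lt_neqAle eq_sym m0/=.
exists [set 1%R : R]; split => // s /= ns; apply: contrapT => /eqP s1; apply: ns.
by rewrite in_itv/= => s01; apply: le_s; rewrite ?s1.
Qed.
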